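(* Let $m\geq k\geq 2$ be integers. Suppose there is an $\alpha$-approximation algorithm for the minimum weight $m$-fold dominating set problem on unit disk graphs and a $\rho$-approximation algorithm for S$k$CS. Then the $(k,m)$-MWCDS problem on unit disk graphs admits an $(\alpha+5\rho)$-approximation algorithm when $k\geq 3$ and an $(\alpha+2.5\rho)$-approximation algorithm when $k=2$.
   Context: A unit disk graph: nodes are points in the plane, edge iff Euclidean distance at most one. For node weights $c:V\to\mathbb R^+$ and $D\subseteq V$, $c(D)=\sum_{v\in D}c(v)$. $D$ is an $m$-fold dominating set of $G=(V,E)$ if every node of $V\setminus D$ has at least $m$ neighbors in $D$; it is a $(k,m)$-CDS if moreover $G[D]$ is $k$-connected. $(k,m)$-MWCDS: given a unit disk graph with positive node weights, find a minimum weight $(k,m)$-CDS. Minimum weight $m$-fold dominating set problem: find an $m$-fold dominating set of minimum weight. Subset $k$-connected subgraph problem (S$k$CS): given a graph with edge weights $w$ and terminal set $T$, find a subgraph in which every pair of terminals is joined by at least $k$ internally disjoint paths, minimizing total edge weight. A $\beta$-approximation algorithm for a minimization problem returns a feasible solution of cost at most $\beta$ times the optimum. *)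

(* Defs.v *)
From HB Require Import structures.
From mathcomp Require Import all_boot all_order all_algebra.
From mathcomp Require Import reals.

Set Implicit Arguments.
Unset Strict Implicit.
Unset Printing Implicit Defensive.

Import Order.TTheory GRing.Theory Num.Theory.
Local Open Scope ring_scope.

(** * Polynomial time on a real RAM

    Instances contain arbitrary real numbers (coordinates, weights), so running
    time is the number of unit-cost steps of a real RAM.  A program is finite
    text that does not depend on [R]: its only real constants are 0 and 1, it
    has the four field operations (with [x / 0 = 0]) and comparison, and no
    floor or other conversion from reals to naturals.  Index arithmetic has no
    multiplication, because unit-cost products of naturals would allow
    doubly exponential values in linearly many steps.

    Memory consists of two-dimensional arrays, of naturals and of reals; the
    array names occurring in a program are fixed, the two subscripts are
    computed. *)

Inductive nexp :=
| NConst of nat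
| NGet of nat & nexp & nexp
| NAdd of nexp & nexp
| NSub of nexp & nexp.

Inductive rexp :=
| RZero
| ROne
| RGet of nat & nexp & nexp
| RAdd of rexp & rexp
| RSub of rexp & rexp
| RMul of rexp & rexp
| RDiv of rexp & rexp.

Inductive bexp :=
| NLe of nexp & nexp
| RLe of rexp & rexp
| BNot of bexp
| BAnd of bexp & bexp.

Inductive cmd :=
| Skip
| NSet of nat & nexp & nexp & nexp
| RSet of nat & nexp & nexp & rexp
| Seq of cmd & cmd
| If of bexp & cmd & cmd
| While of bexp & cmd.

Record state (R : Type) := State {
  nmem : nat -> nat -> nat -> nat;
  rmem : nat -> nat -> nat -> R }.

Definition upd (A : Type) (M : nat -> nat -> nat -> A) (a i j : nat) (x : A) :=
  fun a' i' j' => if [&& a' == a, i' == i & j' == j] then x else M a' i' j'.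

Fixpoint neval (R : Type) (s : state R) (e : nexp) : nat :=
  match e with
  | NConst n => n
  | NGet a e1 e2 => nmem s a (neval s e1) (neval s e2)
  | NAdd e1 e2 => (neval s e1 + neval s e2)%N
  | NSub e1 e2 => (neval s e1 - neval s e2)%N
  end.

Fixpoint reval (R : realType) (s : state R) (e : rexp) : R :=
  match e with
  | RZero => 0
  | ROne => 1
  | RGet a e1 e2 => rmem s a (neval s e1) (neval s e2)
  | RAdd e1 e2 => reval s e1 + reval s e2
  | RSub e1 e2 => reval s e1 - reval s e2
  | RMul e1 e2 => reval s e1 * reval s e2
  | RDiv e1 e2 => reval s e1 / reval s e2
  end.

Fixpoint beval (R : realType) (s : state R) (b : bexp) : bool :=
  match b with
  | NLe e1 e2 => (neval s e1 <= neval s e2)%N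
  | RLe e1 e2 => reval s e1 <= reval s e2
  | BNot b1 => ~~ beval s b1
  | BAnd b1 b2 => beval s b1 && beval s b2
  end.

(* [exec p s t s']: started in [s], the program [p] halts in [s'] after [t]
   steps.  An assignment or a test is one step: the expressions in a fixed
   program have bounded size. *)
Inductive exec (R : realType) : cmd -> state R -> nat -> state R -> Prop :=
| exec_skip s : exec Skip s 1 s
| exec_nset a e1 e2 e s :
    exec (NSet a e1 e2 e) s 1
      (State (upd (nmem s) a (neval s e1) (neval s e2) (neval s e)) (rmem s))
| exec_rset a e1 e2 e s :
    exec (RSet a e1 e2 e) s 1
      (State (nmem s) (upd (rmem s) a (neval s e1) (neval s e2) (reval s e)))
| exec_seq p q s s1 s2 t1 t2 :
    exec p s t1 s1 -> exec q s1 t2 s2 -> exec (Seq p q) s (t1 + t2)%N s2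
| exec_if b p q s s1 t :
    exec (if beval s b then p else q) s t s1 -> exec (If b p q) s t.+1 s1
| exec_while_false b p s : ~~ beval s b -> exec (While b p) s 1 s
| exec_while_true b p s s1 s2 t1 t2 :
    beval s b -> exec p s t1 s1 -> exec (While b p) s1 t2 s2 ->
    exec (While b p) s (t1 + t2).+1 s2.

(** * Minimization problems and approximation algorithms *)

Record min_problem (R : realType) := MinProblem {
  inst : Type;
  isize : inst -> nat;
  sol : inst -> Type;
  feasible : forall I : inst, sol I -> Prop;
  cost : forall I : inst, sol I -> R;
  encode : inst -> state R;
  decode : forall I : inst, state R -> sol I }.

Definition optimal (R : realType) (P : min_problem R) (I : inst P) (S : sol I) :=
  feasible S /\ forall S' : sol I, feasible S' -> cost S <= cost S'.

(* The program halts in polynomial time on every instance.  The other two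
   clauses say nothing about instances without a feasible solution; otherwise
   an optimal solution exists, since the problems below have finitely many
   solutions. *)
Definition approx_algorithm (R : realType) (P : min_problem R) (beta : R)
    (p : cmd) : Prop :=
  exists a d : nat, forall I : inst P, exists (t : nat) (s : state R),
    [/\ exec p (encode I) t s,
        (t <= a * (isize I).+1 ^ d)%N
      & forall S : sol I, optimal S ->
          feasible (decode I s) /\ cost (decode I s) <= beta * cost S].

Definition admits_approx (R : realType) (P : min_problem R) (beta : R) : Prop :=
  exists p : cmd, approx_algorithm P beta p.

(** * Connectivity and domination *)

Section Graphs.
Variables (V : finType) (e : rel V).

Definition induced (S : {set V}) : rel V :=
  [rel x y | [&& x \in S, y \in S & e x y]].

Definition connected_in (S : {set V}) : Prop :=
  {in S &, forall x y, connect (induced S) x y}.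

(* [G[D]] is k-connected *)
Definition k_connected (k : nat) (D : {set V}) : Prop :=
  (k < #|D|)%N /\
  forall X : {set V}, X \subset D -> (#|X| < k)%N -> connected_in (D :\: X).

Definition m_fold_dominating (m : nat) (D : {set V}) : Prop :=
  forall v, v \notin D -> (m <= #|[set u in D | e v u]|)%N.

Definition km_CDS (k m : nat) (D : {set V}) : Prop :=
  m_fold_dominating m D /\ k_connected k D.

(* [p i] lists the internal vertices of the i-th path.  Injectivity is needed
   besides disjointness: the path consisting of the edge [st] alone has no
   internal vertex and must be counted only once. *)
Definition disjoint_paths (k : nat) (s t : V) : Prop :=
  exists p : 'I_k -> seq V,
    [/\ forall i, path e s (rcons (p i) t) /\ uniq (s :: rcons (p i) t),
        injective p
      & forall i j, i != j -> [disjoint p i & p j]].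

End Graphs.

(** * Node-weighted unit disk graphs *)

Record wudg (R : realType) := WUDG {
  un : nat;
  upos : 'I_un -> R * R;
  uweight : 'I_un -> R;
  upos_inj : injective upos;
  uweight_gt0 : forall v, 0 < uweight v }.

Definition edist (R : realType) (p q : R * R) : R :=
  Num.sqrt ((p.1 - q.1) ^+ 2 + (p.2 - q.2) ^+ 2).

Definition uadj (R : realType) (G : wudg R) : rel 'I_(un G) :=
  [rel u v | (u != v) && (edist (upos u) (upos v) <= 1)].

Definition set_weight (R : realType) (G : wudg R) (D : {set 'I_(un G)}) : R :=
  \sum_(v in D) uweight v.

Definition pad (A : Type) (n : nat) (x0 : A) (f : 'I_n -> A) (i : nat) : A :=
  oapp f x0 (insub i).

(* Natural cell 0[0,0]: number of nodes; real cells 0[v,0], 0[v,1]: coordinates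
   of v; real cell 1[v,0]: weight of v; all other cells are 0. *)
Definition wudg_encode (R : realType) (G : wudg R) : state R :=
  State
    (fun a i j => if (a, i, j) == (0, 0, 0)%N then un G else 0%N)
    (fun a i j =>
       if (a, j) == (0, 0)%N then pad 0 (fun v => (upos (w := G) v).1) i
       else if (a, j) == (0, 1)%N then pad 0 (fun v => (upos (w := G) v).2) i
       else if (a, j) == (1, 0)%N then pad 0 (uweight (w := G)) i
       else 0).

(* The answer is read from the natural array 3, as it is for [skcs_decode]. *)
Definition wudg_decode (R : realType) (G : wudg R) (s : state R) :
    {set 'I_(un G)} :=
  [set v : 'I_(un G) | nmem s 3 v 0 != 0%N].

Definition MW_mfold_DS (R : realType) (m : nat) : min_problem R :=
  @MinProblem R (wudg R) (@un R) (fun G => {set 'I_(un G)})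
    (fun G => m_fold_dominating (@uadj R G) m)
    (@set_weight R) (@wudg_encode R) (@wudg_decode R).

Definition MWCDS (R : realType) (k m : nat) : min_problem R :=
  @MinProblem R (wudg R) (@un R) (fun G => {set 'I_(un G)})
    (fun G => km_CDS (@uadj R G) k m)
    (@set_weight R) (@wudg_encode R) (@wudg_decode R).

(** * Subset k-connected subgraph *)

Record skcs_inst (R : realType) := SkCSInst {
  sn : nat;
  sadj : rel 'I_sn;
  sweight : 'I_sn -> 'I_sn -> R;
  sterm : {set 'I_sn};
  sadj_sym : symmetric sadj;
  sadj_irr : irreflexive sadj;
  sweight_sym : forall u v, sadj u v -> sweight u v = sweight v u;
  sweight_ge0 : forall u v, sadj u v -> 0 <= sweight u v }.

(* A subgraph is given by its edge relation. *)
Definition skcs_feasible (R : realType) (k : nat) (I : skcs_inst R)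
    (F : rel 'I_(sn I)) : Prop :=
  [/\ symmetric F, subrel F (sadj (s := I))
    & {in sterm I &, forall x y, x != y -> disjoint_paths F k x y}].

Definition skcs_cost (R : realType) (I : skcs_inst R) (F : rel 'I_(sn I)) : R :=
  \sum_(u < sn I) \sum_(v < sn I | (u < v)%N && F u v) sweight u v.

(* Natural cell 0[0,0]: number of nodes; natural array 1: adjacency matrix;
   natural cell 2[v,0]: whether v is a terminal; real array 0: weights of the
   edges; all other cells are 0. *)
Definition skcs_encode (R : realType) (I : skcs_inst R) : state R :=
  State
    (fun a i j =>
       if (a, i, j) == (0, 0, 0)%N then sn I
       else if a == 1%N then
         pad 0%N (fun u => pad 0%N (fun v => nat_of_bool (sadj (s := I) u v)) j) i
       else if (a, j) == (2, 0)%N then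
         pad 0%N (fun v => nat_of_bool (v \in sterm I)) i
       else 0%N)
    (fun a i j =>
       if a == 0%N then
         pad 0 (fun u => pad 0 (fun v =>
           if sadj (s := I) u v then sweight u v else 0) j) i
       else 0).

Definition skcs_decode (R : realType) (I : skcs_inst R) (s : state R) :
    rel 'I_(sn I) :=
  [rel u v : 'I_(sn I) | nmem s 3 u v != 0%N].

Definition SkCS (R : realType) (k : nat) : min_problem R :=
  @MinProblem R (skcs_inst R) (@sn R) (fun I => rel 'I_(sn I))
    (@skcs_feasible R k) (@skcs_cost R) (@skcs_encode R) (@skcs_decode R).

(* Main.v *)
From HB Require Import structures.
Require Import Defs.
From mathcomp Require Import all_boot all_order all_algebra.
From mathcomp Require Import reals boolp zify ring lra.

(** Let [D] be the given [m]-fold dominating set and [S] a [(k,m)]-CDS; then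
    [G[D + S]] is [k]-connected.  Give the nodes outside [D] half their weight
    per incident edge, and buy a subgraph that [k]-connects the terminals [D].
    Using plain edges of [G] would need up to [5k] edges at a node.  Instead
    every node [v] gets eight hubs, one per octant of the plane around [v]: the
    hub is joined to [v] and to the neighbours of [v] in that octant.  These
    nodes form a clique, so paths through hubs project to paths of [G], while
    [v] pays for at most one edge per hub.  All edges meeting [D] are kept in
    this way.  Among the other edges of [G[D + S]] keep a minimal set preserving
    [k]-connectivity: each of its end points has [k] further neighbours in [D],
    so by Mader's theorem on critical edges this set is a forest, and a node
    pays one more edge to the hub of its parent.  Thus nine half-weights, i.e.
    a factor [9/2 <= 5], suffice for every [k].

    For [k = 2] take instead a spanning 2-connected subgraph of [G[D + S]] of
    minimal length: replacing an edge [v u1] by [u1 u2] keeps it 2-connected as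
    soon as [v] has three neighbours, hence all degrees are at most five.

    Menger's theorem turns vertex connectivity into disjoint paths.  It is only
    equivalent to it when there are more than [k] nodes, so when the computed
    set has [k] nodes (then [|D| = k = m]) the cheapest other node is added. *)

Set Implicit Arguments.
Unset Strict Implicit.
Unset Printing Implicit Defensive.

Import Order.TTheory GRing.Theory Num.Theory.

(** * Menger's theorem *)

(** The half-weights fit the rounding: an interior node of a path has two incident edges, which
    together pay its full weight, so only nodes outside [D] with at least two bought edges are
    taken, and rounding loses nothing. Nodes of [D] and hubs are free. The whole loss lies in the
    other direction, where a solution [S] has to be turned into a cheap subgraph; the budget [5]
    allows ten half-weights per node, of which nine are spent. Hubs must be harmless in both
    directions. A path through a hub may be shortened, because the neighbours of a hub are pairwise
    equal or adjacent. Conversely, deleting a hub must not be a cheaper attack than deleting a node: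
    every edge lifted through a hub uses one owned by an end of that edge outside [D], so a deleted
    hub is charged to its owner. The given algorithms promise something only relative to an optimal
    solution. Hence optima must be shown to exist, and [1 <= alpha] and [1 <= rho] have to be
    extracted from instances with positive optimum: these bounds allow inequalities to be multiplied
    by the ratios, and they pay for the extra node when the rounded set is too small. *)

Section Connect.
Variable V : finType.
Implicit Types (e : rel V) (X Y A B : {set V}).

Lemma connect_indP e (P : V -> Prop) x :
  P x -> (forall u w, P u -> e u w -> P w) -> forall y, connect e x y -> P y.
Proof.
move=> Px Pe y /connectP[p]; elim: p x Px => [|z p IH] x Px /=; first by move=> _ ->.
by case/andP=> exz ep ey; apply: (IH z) => //; apply: Pe exz.
Qed.

Lemma connect_indPr e (P : V -> Prop) y :
  P y -> (forall u w, P w -> e u w -> P u) -> forall x, connect e x y -> P x.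
Proof.
move=> Py Pe x /connectP[p]; elim: p x => [|z p IH] x /=; first by move=> _ <-.
by case/andP=> exz ep ey; apply: (Pe _ z) => //; apply: IH.
Qed.

Lemma connect_subP e e' : (forall u w, e u w -> connect e' u w) ->
  forall x y, connect e x y -> connect e' x y.
Proof.
move=> see x; apply: connect_indP => // u w cu /see; exact: connect_trans.
Qed.

Lemma inducedE e X x y : induced e X x y = [&& x \in X, y \in X & e x y].
Proof. by []. Qed.

Lemma induced_sym e X : symmetric e -> symmetric (induced e X).
Proof. by move=> es x y; rewrite !inducedE es; case: (x \in X); case: (y \in X). Qed.

Lemma path_induced e X x p : path e x p -> all (mem X) (x :: p) ->
  connect (induced e X) x (last x p).
Proof.
elim: p x => [|z p IH] x //= /andP[exz ep] /and3P[xX zX pX].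
by apply: (connect_trans (connect1 _) (IH z ep _)); rewrite ?inducedE /= ?xX ?zX.
Qed.

Lemma connect_in e X x y : connect (induced e X) x y -> x \in X -> y \in X.
Proof.
by move=> c xX; move: y c; apply: connect_indP => // u w _ /and3P[].
Qed.

Definition del_edge e x y : rel V :=
  [rel u v | e u v && ~~ ((u == x) && (v == y) || (u == y) && (v == x))].

Lemma del_edge_sym e x y : symmetric e -> symmetric (del_edge e x y).
Proof.
by move=> es u v; rewrite /del_edge /= es orbC; congr (_ && ~~ (_ || _)); exact: andbC.
Qed.

Lemma del_edge_sub e x y : subrel (del_edge e x y) e.
Proof. by move=> u v /andP[]. Qed.

End Connect.

Section Menger.
Variable V : finType.
Implicit Types (e : rel V) (A B X Z : {set V}).

(** Since [connect] is reflexive, a separator must contain [A :&: B]. An end [b] inside [X] cannot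
    be reached from outside [X], so the condition holds for it automatically. *)
Definition separates e A B X :=
  forall a b, a \in A -> b \in B -> a \notin X ->
    ~~ connect (induced e (~: X)) a b.

Definition verts (q : V * seq V) : seq V := q.1 :: q.2.

Definition AB_path e A B (q : V * seq V) :=
  [&& q.1 \in A, path e q.1 q.2, last q.1 q.2 \in B & uniq (verts q)].

Definition linkage e A B k (p : 'I_k -> V * seq V) :=
  (forall i, AB_path e A B (p i)) /\
  (forall i j, i != j -> [disjoint verts (p i) & verts (p j)]).

Lemma linkage_share e A B k (p : 'I_k -> V * seq V) i j u :
  linkage e A B p -> u \in verts (p i) -> u \in verts (p j) -> i = j.
Proof.
move=> [_ dp] ui uj; apply/eqP/negPn/negP => /dp /pred0P/(_ u) /=.
by rewrite ui uj.
Qed.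

(** Pigeonhole: disjoint paths select distinct nodes, so [k] of them exhaust a set of [k] nodes.
    Applied to last nodes in [x |: X] and to first nodes in [y |: X], this gives the matching along
    which paths are glued. *)
Lemma linkage_onto e A B k (p : 'I_k -> V * seq V) (f : V * seq V -> V) X :
  linkage e A B p -> (forall q, f q \in verts q) -> (forall i, f (p i) \in X) ->
  #|X| = k -> forall z, z \in X -> exists i, f (p i) = z.
Proof.
move=> lp fv fX cX z zX.
have inj : injective (fun i => f (p i)).
  move=> i j /= E; apply: (linkage_share lp (fv _)); rewrite E; exact: fv.
have : z \in [set f (p i) | i : 'I_k].
  suff -> : [set f (p i) | i : 'I_k] = X by [].
  apply/eqP; rewrite eqEcard card_imset // card_ord cX leqnn andbT.
  by apply/subsetP=> _ /imsetP[i _ ->].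
by case/imsetP=> i _ ->; exists i.
Qed.

(* Goring's proof: if deleting the edge xy creates a separator X of size < k,
   then X + x and X + y are separators of size k, and the linkages from A to
   X + x and from X + y to B obtained by induction are glued along X and xy. *)
Lemma menger_sets e A B k :
  (forall X, separates e A B X -> (k <= #|X|)%N) ->
  exists p : 'I_k -> V * seq V, linkage e A B p.
Proof.
have [N] := ubnP #|[set q : V * V | e q.1 q.2]|.
elim: N e A B => // N IH e A B leN hsep.
have [[x y] /= exy|noe] := pickP (fun q : V * V => e q.1 q.2); last first.
  (* Without edges a node reaches only itself, so the linkage consists of one-node paths in
     [A :&: B]. *)
  have sAB : separates e A B (A :&: B).
    move=> a b aA bB; rewrite inE aA /= => aB; apply/negP => c.
    have : b = a.
      by move: b c {bB}; apply: connect_indP => // u w _ /and3P[_ _]; rewrite (noe (u, w)).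
    by move=> E; rewrite E (negPf aB) in bB.
  have lek := hsep _ sAB.
  exists (fun i => (enum_val (widen_ord lek i), [::])); split=> [i|i j nij] /=.
    have := enum_valP (widen_ord lek i); rewrite inE => /andP[iA iB].
    by rewrite /AB_path /= iA iB.
  rewrite /verts /= disjoint_has /= orbF inE.
  by apply: contra nij => /eqP/enum_val_inj E; apply/eqP/val_inj; case: E.
(* Edges are directed in this section: only the orientation from [x] to [y] is removed. *)
pose e' := [rel u v | e u v && ((u, v) != (x, y))].
have see' : subrel e' e by move=> u v /andP[].
have lt' : (#|[set q : V * V | e' q.1 q.2]| < N)%N.
  rewrite -ltnS; apply: leq_trans leN; rewrite ltnS; apply: proper_card; apply/properP; split.
    by apply/subsetP=> q; rewrite !inE => /andP[].
  by exists (x, y); rewrite !inE //= eqxx andbF.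
have APsub C C' q : AB_path e' C C' q -> path e q.1 q.2.
  by case/and4P=> _ p _ _; apply: sub_path p.
case: (pselect (forall X, separates e' A B X -> (k <= #|X|)%N)) => [h'|].
  have [p [pw pd]] := IH e' A B lt' h'; exists p; split=> // i.
  have := pw i; rewrite /AB_path => /and4P[-> p' -> ->].
  by rewrite (sub_path see' p').
move=> /existsNP[X] /not_implyP[sX /negP]; rewrite -ltnNge => ltX.
(* The edge from [x] to [y] is all that [e'] lacks, and deleting either of its ends removes it. *)
have sepU z : (z = x \/ z = y) -> separates e A B (z |: X).
  move=> zxy a b aA bB; rewrite !inE negb_or => /andP[_ aX].
  apply: contra (sX a b aA bB aX); apply: connect_subP => u w.
  rewrite inducedE !inE !negb_or => /and3P[/andP[uz uX] /andP[wz wX] euw].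
  apply: connect1; rewrite inducedE /= !inE uX wX euw /=.
  apply/eqP => -[ux wy].
  by case: zxy => E; [rewrite ux E eqxx in uz | rewrite wy E eqxx in wz].
have cardU z : (z = x \/ z = y) -> z \notin X /\ #|z |: X| = k.
  move=> /sepU /hsep; rewrite cardsU1; case: (z \in X) => /=; first by lia.
  by move=> ?; split=> //; lia.
have [xX cx] := cardU x (or_introl erefl).
have [yX cy] := cardU y (or_intror erefl).
(* A walk from [A] avoiding [Z] never enters [x |: X]: until it does, it cannot use the edge from
   [x] to [y], so it is a walk of [e'] and [Z] stops it. As [x |: X] separates in [e], the walk does
   not reach [B]. The claim [s2] is the mirror image, followed backwards from [B]. *)
have s1 : forall Z, separates e' A (x |: X) Z -> (k <= #|Z|)%N.
  move=> Z sZ; apply: hsep => a b aA bB aZ; apply/negP => cab.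
  pose P w := connect (induced e' (~: Z)) a w /\
              connect (induced e (~: (x |: X))) a w.
  have PX w : P w -> w \notin x |: X.
    by move=> [c _]; apply/negP => wX; move: (sZ a w aA wX aZ); rewrite c.
  suff [_ c] : P b by move: (sepU x (or_introl erefl) a b aA bB (PX a (conj (connect0 _ _) (connect0 _ _)))); rewrite c.
  move: b cab {bB}; apply: connect_indP => // u w Pu /and3P[uZ wZ euw].
  have uX := PX _ Pu; case: (Pu) => c1 c2.
  have c1' : connect (induced e' (~: Z)) a w.
    apply: connect_trans c1 (connect1 _); rewrite inducedE /= uZ wZ euw /=.
    by apply: contra uX => /eqP[-> _]; rewrite !inE eqxx.
  split=> //; apply: connect_trans c2 (connect1 _); rewrite inducedE /= euw !in_setC uX.
  have -> // : w \notin x |: X.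
  by apply/negP => wX; move: (sZ a w aA wX aZ); rewrite c1'.
have s2 : forall Z, separates e' (y |: X) B Z -> (k <= #|Z|)%N.
  move=> Z sZ; apply: hsep => a b aA bB aZ; apply/negP => cab.
  have bZ : b \notin Z by rewrite -in_setC (connect_in cab) ?in_setC.
  pose P w := [/\ connect (induced e' (~: Z)) w b,
    connect (induced e (~: (y |: X))) w b & w \notin Z].
  have PX w : P w -> w \notin y |: X.
    by move=> [c _ wZ]; apply/negP => wX; move: (sZ w b wX bB wZ); rewrite c.
  suff Pa : P a.
    case: (Pa) => _ c _.
    by move: (sepU y (or_intror erefl) a b aA bB (PX a Pa)); rewrite c.
  move: a cab {aA aZ}; apply: connect_indPr => // u w Pw /and3P[].
  rewrite !in_setC => uZ wZ euw.
  have wX := PX _ Pw; case: (Pw) => c1 c2 _.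
  have c1' : connect (induced e' (~: Z)) u b.
    apply: connect_trans (connect1 _) c1; rewrite inducedE /= !in_setC uZ wZ euw /=.
    by apply: contra wX => /eqP[_ ->]; rewrite !inE eqxx.
  split=> //; apply: connect_trans (connect1 _) c2; rewrite inducedE /= euw !in_setC wX.
  have -> // : u \notin y |: X.
  by apply/negP => uX; move: (sZ u b uX bB uZ); rewrite c1'.
have [p lp] := IH e' _ _ lt' s1; have [q lq] := IH e' _ _ lt' s2.
have [pw _] := lp; have [qw _] := lq.
pose lst (r : V * seq V) := last r.1 r.2.
have lstv r : lst r \in verts r by rewrite /lst /verts mem_last.
have plst i : lst (p i) \in x |: X by case/and4P: (pw i).
have onto_p := linkage_onto lp lstv plst cx.
have hdv (r : V * seq V) : r.1 \in verts r by rewrite mem_head.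
have qhd i : (q i).1 \in y |: X by case/and4P: (qw i).
have onto_q := linkage_onto lq hdv qhd cy.
have p_last i u : u \in verts (p i) -> u \in X -> u = lst (p i).
  move=> ui uX; have [|j ej] := onto_p u; first by rewrite !inE uX orbT.
  by rewrite -ej; congr (lst (p _)); apply: (linkage_share lp _ ui); rewrite -ej.
have q_head i u : u \in verts (q i) -> u \in X -> u = (q i).1.
  move=> ui uX; have [|j ej] := onto_q u; first by rewrite !inE uX orbT.
  by rewrite -ej; congr (q _).1; apply: (linkage_share lq _ ui); rewrite -ej.
(* Each path meets [X] only at its end towards [X]. A common node outside [X] would therefore join
   the start of [p i] to the end of [q j] in [e'] without meeting [X]. *)
have meet i j u : u \in verts (p i) -> u \in verts (q j) -> u \in X.
  move=> ui uj; apply/negPn/negP => uX.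
  have c1 : (p i).1 \notin X /\ connect (induced e' (~: X)) (p i).1 u.
    have allp w : w \in verts (p i) -> w \in X -> w = lst (p i) := @p_last i w.
    have /and4P[_ pp _ up] := pw i.
    move: ui allp pp up; rewrite /verts /lst; case: (p i) => a r /=.
    rewrite inE => ur allp pp up; case/predU1P: ur => [<- //|ur].
    case/splitPr: ur allp pp up => r1 r2 allp pp up.
    have al : all (mem (~: X)) (a :: r1).
      apply/allP => w wr; rewrite /= in_setC; apply/negP => wX.
      have E : w = last a (r1 ++ u :: r2).
        by apply: allp => //; rewrite -cat_cons mem_cat wr.
      move: (up : uniq (a :: r1 ++ u :: r2)); rewrite -cat_cons cat_uniq => /and3P[_ /hasPn /(_ w) H _].
      have wl : w \in u :: r2 by rewrite E last_cat /= mem_last.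
      by move: (H wl); rewrite /= wr.
    split; first by move: al => /= /andP[]; rewrite in_setC.
    have -> : u = last a (rcons r1 u) by rewrite last_rcons.
    apply: path_induced; last by rewrite -rcons_cons all_rcons al /= in_setC uX.
    by move: pp; rewrite -cat_rcons cat_path => /andP[].
  have c2 : exists2 b, b \in B & connect (induced e' (~: X)) u b.
    have allq w : w \in verts (q j) -> w \in X -> w = (q j).1 := @q_head j w.
    have /and4P[_ pp lB uq] := qw j.
    move: uj allq pp lB uq; rewrite /verts; case: (q j) => a r /=.
    rewrite inE => ur allq pp lB uq.
    exists (last a r) => //.
    case/predU1P: ur => [E|ur].
      rewrite E; apply: path_induced => //; apply/allP => w wr.
      rewrite /= in_setC; apply/negP => wX.
      by move: uX; rewrite E -(allq w wr wX) wX.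
    case/splitPr: ur allq pp lB uq => r1 r2 allq pp lB uq.
    rewrite last_cat /=; apply: path_induced.
      by move: pp; rewrite cat_path /= => /and3P[].
    apply/allP => w wr; rewrite /= in_setC; apply/negP => wX.
    have E : w = a by apply: allq => //; rewrite inE mem_cat wr !orbT.
    by move: uq => /= /andP[/negP[]]; rewrite mem_cat -E wr orbT.
  case: c1 => pX c1; case: c2 => b bB c2.
  have pA : (p i).1 \in A by case/and4P: (pw i).
  by move: (sX _ _ pA bB pX); rewrite (connect_trans c1 c2).
pose f z := if z == x then y else z.
have fy z : z \in x |: X -> f z \in y |: X.
  rewrite !inE /f; case: eqP => [_ _|_ /= ->]; rewrite ?eqxx ?orbT //.
have /choice[sg sgE] : forall i, exists j, (q j).1 = f (lst (p i)).
  by move=> i; apply: onto_q; apply: fy.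
have sg_inj : injective sg.
  move=> i j E; have := sgE i; rewrite E sgE /f => H.
  apply: (linkage_share lp (lstv _)).
  suff -> : lst (p i) = lst (p j) by [].
  move: H (plst i) (plst j); rewrite !inE.
  case: eqP => [->|_]; case: eqP => [->|_] //= H.
    by move=> H2; rewrite -H (negPf yX) in H2.
  by move=> _ H2; rewrite H (negPf yX) in H2.
(* A path ending in [x] crosses the edge to [y] and takes over its whole partner; any other path
   already ends at the first node of its partner, which must not be repeated. *)
pose tl i := if lst (p i) == x then verts (q (sg i)) else (q (sg i)).2.
pose r i := ((p i).1, (p i).2 ++ tl i).
have tlq i u : u \in tl i -> u \in verts (q (sg i)).
  by rewrite /tl; case: ifP => // _ ut; rewrite inE ut orbT.
have ptl i j u : u \in verts (p i) -> u \in tl j -> False.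
  move=> ui uj; have uX := meet _ _ _ ui (tlq _ _ uj).
  have hq := q_head _ _ (tlq _ _ uj) uX.
  move: uj; rewrite /tl; have := sgE j; rewrite /f.
  case: ifP => _ E; first by rewrite hq E (negPf yX) in uX.
  have /and4P[_ _ _ /andP[]] := qw (sg j).
  by rewrite /= -hq => /negPf ->.
have vr i : verts (r i) = verts (p i) ++ tl i by [].
exists r; split=> [i|i j nij].
  have /and4P[pA _ _ pu] := pw i; have pp := APsub _ _ _ (pw i).
  have /and4P[_ _ qB qu] := qw (sg i); have qp := APsub _ _ _ (qw (sg i)).
  have /andP[pt lt] : path e (lst (p i)) (tl i) && (last (lst (p i)) (tl i) \in B).
    rewrite /tl; have := sgE i; rewrite /f; case: eqP => [->|_] E.
      by rewrite /= {1}E exy qp qB.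
    by rewrite -E qp qB.
  have U : uniq (verts (p i) ++ tl i).
    rewrite cat_uniq pu andTb; apply/andP; split.
      by apply/hasPn => u ut; apply/negP => /ptl /(_ ut).
    by rewrite /tl; case: ifP => // _; case/andP: qu.
  by apply/and4P; split; rewrite ?vr //= ?cat_path ?last_cat ?pp.
apply/pred0P => u /=; rewrite !vr !mem_cat; apply/negbTE/negP.
case/andP=> /orP[ui|ui] /orP[uj|uj].
- by move: nij; rewrite (linkage_share lp ui uj) eqxx.
- exact: ptl ui uj.
- exact: ptl uj ui.
move: nij; rewrite (sg_inj i j) ?eqxx //.
exact: (linkage_share lq (tlq _ _ ui) (tlq _ _ uj)).
Qed.

End Menger.

(** * Vertex connectivity and critical edges *)

Section VertexConnectivity.
Variable V : finType.
Implicit Types (e : rel V) (A B N W X Y : {set V}).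

(** The edge [st], if present, is one path with empty interior. The other [k - e s t] paths come
    from the set version of Menger's theorem between the neighbours of [s] and those of [t], with
    [s] and [t] removed. This is why cuts are tested in the graph without the edge, with [e s t]
    added to their size. *)
Lemma disjoint_pathsP e s t k : s != t ->
  (forall X, s \notin X -> t \notin X -> (#|X| + e s t < k)%N ->
     connect (induced (del_edge e s t) (~: X)) s t) ->
  disjoint_paths e k s t.
Proof.
move=> nst cut; pose st : {set V} := [set s; t].
pose e0 := induced (del_edge e s t) (~: st).
pose A := [set u | e s u & u \notin st]; pose B := [set u | e u t & u \notin st].
have notst w : w \notin st -> (w != s) && (w != t) by rewrite !inE negb_or.
have sep X : separates e0 A B X -> (k - e s t <= #|X|)%N.
  move=> sX; rewrite leqNgt; apply/negP => ltX.
  pose X' := X :\: st.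
  have leX' : (#|X'| <= #|X|)%N by rewrite subset_leq_card // subsetDl.
  have := cut X'; rewrite !inE !eqxx /= orbT /= => /(_ isT isT).
  have -> : (#|X'| + e s t < k)%N by lia.
  move=> /(_ isT) c.
  pose P w := w = s \/ w \notin st /\
    exists a, [/\ a \in A, a \notin X & connect (induced e0 (~: X)) a w].
  suff: P t by case=> [E|[]]; [rewrite E eqxx in nst | rewrite !inE eqxx orbT].
  have inX w : w \notin st -> w \in ~: X' -> w \notin X.
    by move=> wst; rewrite /X' inE in_setD (wst).
  have Ps : P s by left.
  apply: (connect_indP Ps _ c) => u w Pu /and3P[uX wX euw].
  have [ws|/negP/negP wst] := boolP (w \in st).
    move: ws; rewrite !inE => /orP[/eqP->|/eqP wt]; first by left.
    case: Pu => [us|[ust [a [aA aX ca]]]].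
      by move: euw; rewrite us wt /del_edge /= !eqxx andbF.
    have uB : u \in B by rewrite inE ust andbT -wt (del_edge_sub euw).
    by move: (sX a u aA uB aX); rewrite ca.
  have wX' := inX _ wst wX; right; split=> //.
  case: Pu => [us|[ust [a [aA aX ca]]]].
    exists w; split=> //.
    by rewrite inE wst andbT -us (del_edge_sub euw).
  exists a; split=> //; apply: connect_trans ca (connect1 _).
  by rewrite inducedE !in_setC (inX _ ust uX) wX' /e0 inducedE !in_setC ust wst.
have [p lp] := menger_sets sep.
have [pw pd] := lp.
have pst i u : u \in verts (p i) -> u \notin st.
  have /and4P[pA pp _ _] := pw i.
  rewrite /verts inE => /predU1P[->|]; first by move: pA; rewrite inE => /andP[].
  elim: (p i).2 (p i).1 pp {pA} => // y r IH x /= /andP[/and3P[_ yst _] er].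
  rewrite inE => /predU1P[->|]; last exact: IH er.
  by rewrite -in_setC.
(* At most one index lies beyond [k - e s t], and it receives the empty interior of the edge [st].
   The vertex lists of the linkage are nonempty, so [P] is injective. *)
pose P (i : 'I_k) := oapp (fun j => verts (p j)) [::] (insub (val i) : option 'I_(k - e s t)).
exists P; split.
- move=> i; rewrite /P; case: insubP => [j _ _|] /=; last first.
    rewrite -leqNgt => le; have := ltn_ord i => lt.
    have est : e s t by case: (e s t) le lt => //; lia.
    by rewrite est /= inE nst.
  have /and4P[pA pp pB pu] := pw j.
  split.
    move: pA pp pB; rewrite /verts !inE => /andP[-> _] pp /andP[lt _] /=.
    rewrite rcons_path lt andbT; apply: sub_path pp => u w /and3P[_ _].
    exact: del_edge_sub.
  suff : uniq (s :: rcons (verts (p j)) t) by [].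
  rewrite cons_uniq mem_rcons rcons_uniq pu andbT inE negb_or nst andTb.
  apply/andP; split; apply/negP => /pst /notst; first by rewrite eqxx.
  by rewrite eqxx andbF.
- move=> i j; rewrite /P; case: insubP => [i' _ ei|]; case: insubP => [j' _ ej|] //=.
    move=> E; apply: val_inj; rewrite -ei -ej; congr val.
    by apply: (linkage_share lp (mem_head _ _)); rewrite -/(verts _) -E mem_head.
  move=> lj li _; apply: val_inj => /=; have := ltn_ord i; have := ltn_ord j.
  by move: li lj; rewrite -!leqNgt; case: (e s t) => /=; lia.
move=> i j nij; rewrite /P; case: insubP => [i' _ ei|]; case: insubP => [j' _ ej|] //=.
- apply: pd; apply: contra nij => /eqP E; apply/eqP/val_inj.
  by rewrite -ei -ej E.
- by move=> _; rewrite disjoint_sym; apply/pred0P.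
- by move=> _; apply/pred0P.
by move=> _ _; apply/pred0P.
Qed.

Lemma k_connected_cut e k W X : k_connected e k W -> (#|X| < k)%N ->
  connected_in e (W :\: X).
Proof.
move=> [_ cW] ltX; have -> : W :\: X = W :\: (X :&: W).
  by apply/setP => z; rewrite !inE; case: (z \in W); rewrite ?andbT ?andbF.
apply: cW; first exact: subsetIr.
by apply: leq_ltn_trans ltX; rewrite subset_leq_card // subsetIl.
Qed.

Lemma k_connected_del_edge e k W s t X : symmetric e -> k_connected e k W ->
  s \in W :\: X -> t \in W :\: X -> s != t -> (#|X| + e s t < k)%N ->
  connect (induced (del_edge e s t) (W :\: X)) s t.
Proof.
move=> es kW sW tW nst; case: (boolP (e s t)) => [est|nest] ltX; last first.
  have := k_connected_cut kW (_ : #|X| < k)%N; rewrite addn0 in ltX.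
  move=> /(_ ltX s t sW tW); apply: connect_sub => u w /and3P[uW wW euw].
  apply: connect1; rewrite inducedE uW wW /del_edge /= euw /=.
  apply/norP; split; apply/negP => /andP[/eqP E1 /eqP E2].
    by rewrite E1 E2 (negPf nest) in euw.
  by rewrite E1 E2 es (negPf nest) in euw.
have [z zW] : exists z, z \in W :\: (s |: (t |: X)).
  apply/set0Pn; rewrite -card_gt0 cardsD.
  have := subset_leq_card (subsetIr W (s |: (t |: X))).
  have := cardsU1 s (t |: X); have := cardsU1 t X; have [] := kW.
  by case: (s \notin _); case: (t \notin _); lia.
have sub r u w : r \in [set s; t] -> connect (induced e (W :\: (r |: X))) u w ->
    connect (induced (del_edge e s t) (W :\: X)) u w.
  move=> rst; apply: connect_sub => {}u {}w /and3P[uW wW euw]; apply: connect1.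
  move: uW wW; rewrite inducedE !in_setD !in_setU1 !negb_or.
  move=> /andP[/andP[ur ->] ->] /andP[/andP[wr ->] ->] /=; rewrite /del_edge /= euw /=.
  move: rst; rewrite !inE => /orP[] /eqP E; rewrite E in ur wr.
    by rewrite (negPf ur) (negPf wr) andbF.
  by rewrite (negPf wr) (negPf ur) andbF.
have zin r : r \in [set s; t] -> z \in W :\: (r |: X).
  move: zW; rewrite !inE !negb_or => /andP[/and3P[zs zt ->] ->].
  by case/orP => /eqP ->; rewrite ?zs ?zt.
have lt r : (#|r |: X| < k)%N by rewrite cardsU1; case: (_ \notin _); lia.
have ins u r : r != u -> u \in W :\: X -> u \in W :\: (r |: X).
  by move=> nru; rewrite !inE negb_or => /andP[-> ->]; rewrite eq_sym nru.
have sI : s \in [set s; t] by rewrite !inE eqxx.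
have tI : t \in [set s; t] by rewrite !inE eqxx orbT.
apply: (@connect_trans _ _ z).
  apply: (sub t) => //; apply: (k_connected_cut kW (lt t)); last exact: zin.
  by apply: ins => //; rewrite eq_sym.
apply: (sub s) => //; apply: (k_connected_cut kW (lt s)); first exact: zin.
exact: ins.
Qed.

(** [N] contains every neighbour of [A] outside [A] and misses [r], so it separates [A] from [r]. *)
Lemma k_connected_frag e k W A N r : k_connected e k W -> A \subset W ->
  A != set0 -> r \in W -> r \notin A -> r \notin N ->
  [disjoint A & N] ->
  (forall u w, u \in A -> w \in W -> e u w -> (w \in A) || (w \in N)) ->
  (k <= #|N|)%N.
Proof.
move=> kW AW /set0Pn[a aA] rW rA rN dAN cl; rewrite leqNgt; apply/negP => ltN.
have aN : a \notin N by have /pred0P/(_ a)/= := dAN; rewrite aA /= => ->.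
have := k_connected_cut kW ltN; rewrite /connected_in => /(_ a r).
rewrite !inE aN rN rW (subsetP AW) // => /(_ isT isT) c.
move/negP: rA; apply; move: r c {rW rN}; apply: connect_indP => // u w uA.
rewrite inducedE !inE => /and3P[_ /andP[wN wW] euw].
by have := cl u w uA wW euw; rewrite (negPf wN) orbF.
Qed.

(** Fewer than [k] deletions leave every surviving node outside [B] a neighbour in [B], so it
    suffices to connect the nodes of [B]. This serves both [D :|: S] and the rounded solution. *)
Lemma dominated_connected e k B W : symmetric e -> B \subset W ->
  (forall Y, (#|Y| < k)%N -> {in B :\: Y &, forall x y,
     connect (induced e (W :\: Y)) x y}) ->
  (forall w, w \in W -> w \notin B -> (k <= #|[set u in B | e w u]|)%N) ->
  forall Y, (#|Y| < k)%N -> connected_in e (W :\: Y).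
Proof.
move=> es BW cB dom Y ltY.
have toB x : x \in W :\: Y -> exists2 b, b \in B :\: Y & connect (induced e (W :\: Y)) x b.
  move=> xW; case: (boolP (x \in B)) => [xB|xB].
    by exists x => //; move: xW; rewrite !inE xB => /andP[->].
  move: (xW); rewrite !inE => /andP[xY xW'].
  have /subsetPn[b bN bY] : ~~ ([set u in B | e x u] \subset Y).
    by apply/negP => /subset_leq_card; have := dom x xW' xB; lia.
  move: bN; rewrite inE => /andP[bB exb]; exists b; first by rewrite inE bY.
  by apply: connect1; rewrite inducedE xW exb !inE bY (subsetP BW).
move=> x y xW yW; have [b bB cb] := toB x xW; have [c cB' cc] := toB y yW.
apply: connect_trans cb (connect_trans (cB Y ltY b c bB cB') _).
by rewrite (sym_connect_sym (induced_sym _ es)).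
Qed.

End VertexConnectivity.

(** * Critical edges of [k]-connected graphs and uncrossing of fragments *)

Section CriticalEdges.
Variable V : finType.
Variables (e : rel V) (k : nat) (W : {set V}).
Hypotheses (e_sym : symmetric e) (e_irr : irreflexive e) (kW : k_connected e k W).
Implicit Types (P Q X : {set V}).

(* [Q] and its complement in [W :\: X] are joined by the edge [xy] only. *)
Definition bridging x y Q X :=
  [&& Q \subset W, [disjoint Q & X], y \in Q, x \in W :\: (Q :|: X), (#|X| < k)%N &
  [forall u in Q, forall w in W :\: (Q :|: X), e u w ==> (u == y) && (w == x)]].

(** Some cut [X] witnesses that deleting [xy] spoils [k]-connectivity. Both ends survive [X] and
    fall into different components, as otherwise the edge could be bypassed; [Q] is the component of
    [y]. *)
Lemma critical_bridging x y : x \in W -> y \in W -> x != y ->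
  ~ k_connected (del_edge e x y) k W -> exists Q X, bridging x y Q X.
Proof.
move=> xW yW nxy ncon.
have ds := del_edge_sym x y e_sym.
have [X [ltX ncX]] : exists X : {set V}, (#|X| < k)%N /\
    ~ connected_in (del_edge e x y) (W :\: X).
  apply: contrapT => H; apply: ncon; split=> [|X _ ltX]; first by case: kW.
  by apply: contrapT => ncX; apply: H; exists X.
pose dX := induced (del_edge e x y) (W :\: X).
have symX : connect_sym dX := sym_connect_sym (induced_sym _ ds).
have red : (x \notin X -> y \notin X -> connect dX x y) -> False.
  move=> cxy; apply: ncX => a b aW bW.
  have := k_connected_cut kW ltX aW bW; apply: connect_subP => u w /and3P[uW wW euw].
  have [|no] := boolP ((u == x) && (w == y) || (u == y) && (w == x)).
    have inX v : v \in W :\: X -> v \notin X by rewrite inE => /andP[].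
    case/orP=> /andP[/eqP E1 /eqP E2]; rewrite E1 E2 in uW wW *.
      by apply: cxy; apply: inX.
    by rewrite -/dX symX; apply: cxy; apply: inX.
  by apply: connect1; rewrite inducedE uW wW /del_edge /= euw no.
have xX : x \notin X by apply/negP => xX; apply: red; rewrite xX.
have yX : y \notin X by apply/negP => yX; apply: red; rewrite yX => _.
have nc : ~~ connect dX y x by apply/negP; rewrite symX => c; apply: red.
have yWX : y \in W :\: X by rewrite inE yX.
pose Q := [set z | connect dX y z].
have QWX : Q \subset W :\: X.
  by apply/subsetP => z; rewrite inE => c; apply: connect_in c yWX.
exists Q, X; apply/and5P; split.
- by apply: subset_trans QWX (subsetDl _ _).
- rewrite disjoint_subset; apply/subsetP => z /(subsetP QWX).
  by rewrite inE => /andP[].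
- by rewrite inE connect0.
- by rewrite !inE negb_or nc xX.
rewrite ltX /=; apply/forall_inP => u uQ; apply/forall_inP => w wP.
apply/implyP => euw; have uWX := subsetP QWX u uQ.
move: wP; rewrite !inE negb_or => /andP[/andP[wQ wX] wW].
have [/orP[/andP[/eqP ux _]|//]|no] := boolP ((u == x) && (w == y) || (u == y) && (w == x)).
  by move: uQ nc; rewrite ux inE => ->.
move: uQ wQ; rewrite !inE => c /negP[]; apply: connect_trans c (connect1 _).
by rewrite /dX inducedE uWX !inE wX wW /del_edge /= euw no.
Qed.

Lemma bridgingC x y Q X : bridging x y Q X -> bridging y x (W :\: (Q :|: X)) X.
Proof.
case/and5P=> QW dQX yQ xP /andP[ltX /forall_inP br].
have yX : y \notin X by have /pred0P/(_ y)/= := dQX; rewrite yQ /= => ->.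
apply/and5P; split=> //.
- exact: subsetDl.
- by apply/pred0P => z /=; rewrite !inE; case: (z \in X); rewrite ?orbT ?andbF.
- by rewrite !inE yQ yX (subsetP QW).
rewrite ltX /=; apply/forall_inP => u uP; apply/forall_inP => w wQ.
have wQ' : w \in Q.
  move: wQ; rewrite !inE; case: (w \in Q) => //=; case: (w \in W); rewrite ?andbF //.
  by case: (w \in X).
apply/implyP => euw; have /forall_inP/(_ u uP) := br w wQ'.
by rewrite e_sym euw /= andbC.
Qed.

Variable K : rel V.
Hypotheses (K_sym : symmetric K) (K_sub : subrel K e).
Hypothesis K_W : forall x y, K x y -> (x \in W) && (y \in W).
Hypothesis K_crit : forall x y, K x y -> ~ k_connected (del_edge e x y) k W.
Hypothesis K_deg : forall x y, K x y ->
  (k <= #|[set u in W | e y u & ~~ K y u]|)%N.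

(* Mader: two critical edges [xy], [yz] whose end [y] has degree more than [k]
   have crossing fragments, and uncrossing them gives a smaller fragment.  So
   the end [y] inside a smallest fragment is a leaf of the critical edges. *)
Lemma critical_leaf : (exists x y, K x y) ->
  exists x y, K x y /\ forall z, K y z -> z = x.
Proof.
move=> [x0 [y0 K0]].
have Kne x y : K x y -> x != y.
  by move=> /K_sub; apply: contraTneq => ->; rewrite e_irr.
have Kbr x y : K x y -> exists Q X, bridging x y Q X.
  move=> Kxy; have /andP[xW yW] := K_W Kxy.
  exact: critical_bridging (Kne _ _ Kxy) (K_crit Kxy).
pose good (q : V * V * {set V} * {set V}) :=
  K q.1.1.1 q.1.1.2 && bridging q.1.1.1 q.1.1.2 q.1.2 q.2.
have [Q0 [X0 b0]] := Kbr _ _ K0.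
have g0 : good (x0, y0, Q0, X0) by rewrite /good /= K0.
case: (arg_minnP (fun q : V * V * {set V} * {set V} => #|q.1.2|) g0).
move=> [[[x y] Q] X] /andP[/= Kxy br] qmin.
have minQ x' y' Q' X' : K x' y' -> bridging x' y' Q' X' -> (#|Q| <= #|Q'|)%N.
  by move=> Kx bx; apply: (qmin (x', y', Q', X')); rewrite /good /= Kx.
exists x, y; split=> // z Kyz; apply/eqP; apply: contrapT => /negP nzx.
have [Q' [X' br']] := Kbr _ _ Kyz.
have brC := bridgingC br; have brC' := bridgingC br'.
pose P := W :\: (Q :|: X); pose P' := W :\: (Q' :|: X').
have leP := minQ _ _ _ _ (etrans (K_sym y x) Kxy) brC.
have leQ' := minQ _ _ _ _ Kyz br'.
have {}leP : (#|Q| <= #|P|)%N := leP.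
case/and5P: (br) => QW dQX yQ xP /andP[ltX /forall_inP nb].
case/and5P: (br') => Q'W dQX' zQ' yP' /andP[ltX' /forall_inP nb'].
have nbQP u w : u \in Q -> w \in P -> e u w -> (u = y) /\ (w = x).
  by move=> uQ wP euw; have /forall_inP/(_ w wP) := nb u uQ; rewrite euw => /andP[/eqP ? /eqP].
have nbQP' u w : u \in Q' -> w \in P' -> e u w -> (u = z) /\ (w = y).
  by move=> uQ wP euw; have /forall_inP/(_ w wP) := nb' u uQ; rewrite euw => /andP[/eqP ? /eqP].
have inW w : w \in W -> [|| w \in P, w \in Q | w \in X].
  by move=> wW; rewrite /P !inE wW andbT negb_or; case: (w \in Q); case: (w \in X).
have inW' w : w \in W -> [|| w \in P', w \in Q' | w \in X'].
  by move=> wW; rewrite /P' !inE wW andbT negb_or; case: (w \in Q'); case: (w \in X').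
have PnQ w : w \in P -> (w \notin Q) && (w \notin X).
  by rewrite !inE negb_or => /andP[].
have PnQ' w : w \in P' -> (w \notin Q') && (w \notin X').
  by rewrite !inE negb_or => /andP[].
have QnX w : w \in Q -> w \notin X by move=> wQ; have /pred0P/(_ w)/= := dQX; rewrite wQ /= => ->.
have QnX' w : w \in Q' -> w \notin X' by move=> wQ; have /pred0P/(_ w)/= := dQX'; rewrite wQ /= => ->.
have /andP[xW yW] := K_W Kxy; have /andP[_ zW] := K_W Kyz.
have exy := K_sub Kxy; have eyz := K_sub Kyz.
have xnQ' : x \notin Q'.
  apply/negP => xQ'; have [E _] := nbQP' x y xQ' yP' exy.
  by rewrite E eqxx in nzx.
have znP : z \notin P.
  apply/negP => zP; have [_ E] := nbQP y z yQ zP eyz.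
  by rewrite E eqxx in nzx.
have /andP[ynQ' ynX'] := PnQ' _ yP'.
have ynX := QnX _ yQ; have /andP[xnQ xnX] := PnQ _ xP.
have nxy := Kne _ _ Kxy; have nyz := Kne _ _ Kyz.
(* Up to the ends of [xy] and [yz], these sets contain the neighbourhoods of the corners [Q :&: Q'],
   [P :&: P'], [P :&: Q'] and [Q :&: P']. For opposite corners, [#|T1| + #|T2|] and [#|T3| + #|T4|]
   are at most [#|X| + #|X'|], hence at most [2 * k - 2]. *)
pose T1 := (X :&: Q') :|: (X :&: X') :|: (Q :&: X').
pose T2 := (X :&: P') :|: (X :&: X') :|: (P :&: X').
pose T3 := (X :&: Q') :|: (X :&: X') :|: (P :&: X').
pose T4 := (X :&: P') :|: (X :&: X') :|: (Q :&: X').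
have c3 (A B C : {set V}) : (#|A :|: B :|: C| <= #|A| + #|B| + #|C|)%N.
  by apply: leq_trans (leq_card_setU _ _) _; rewrite leq_add2r leq_card_setU.
have u1 := c3 (X :&: Q') (X :&: X') (Q :&: X').
have u2 := c3 (X :&: P') (X :&: X') (P :&: X').
have u3 := c3 (X :&: Q') (X :&: X') (P :&: X').
have u4 := c3 (X :&: P') (X :&: X') (Q :&: X').
rewrite -/T1 in u1; rewrite -/T2 in u2; rewrite -/T3 in u3; rewrite -/T4 in u4.
have split3 (A B C D : {set V}) : (forall w, w \in A -> [&& ~~ (w \in B), ~~ (w \in C) & w \in D] || [&& w \in B, ~~ (w \in C) & ~~ (w \in D)] || [&& ~~ (w \in B), w \in C & ~~ (w \in D)] || [&& ~~ (w \in B), ~~ (w \in C) & ~~ (w \in D)] ) ->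
  (#|A :&: B| + #|A :&: C| + #|A :&: D| <= #|A|)%N.
  move=> H; rewrite -cardsUI -[X in (_ <= X)%N]addn0.
  have -> : (A :&: B) :&: (A :&: C) = set0.
    apply/setP => w; rewrite !inE; apply/negbTE/negP => /andP[/andP[wA wB] /andP[_ wC]].
    by have := H w wA; rewrite wB wC.
  rewrite cards0 addn0 -cardsUI.
  have -> : (A :&: B :|: A :&: C) :&: (A :&: D) = set0.
    apply/setP => w; rewrite !inE; apply/negbTE/negP => /andP[H1 /andP[wA wD]].
    by have := H w wA; move: H1; rewrite wA wD /=; case: (w \in B); case: (w \in C).
  by rewrite cards0 !addn0 subset_leq_card // !subUset !subsetIl.
have trich w : (w \in P') + (w \in Q') + (w \in X') <= 1.
  case: (boolP (w \in Q')) => [wQ'|_] /=.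
    rewrite (negPf (QnX' _ wQ')); case: (boolP (w \in P')) => // /PnQ' /andP[].
    by rewrite wQ'.
  case: (boolP (w \in P')) => [/PnQ' /andP[_ /negPf ->]|_] //=.
  by case: (w \in X').
have trichX w : (w \in P) + (w \in Q) + (w \in X) <= 1.
  case: (boolP (w \in Q)) => [wQ'|_] /=.
    rewrite (negPf (QnX _ wQ')); case: (boolP (w \in P)) => // /PnQ /andP[].
    by rewrite wQ'.
  case: (boolP (w \in P)) => [/PnQ /andP[_ /negPf ->]|_] //=.
  by case: (w \in X).
have cX : (#|X :&: P'| + #|X :&: Q'| + #|X :&: X'| <= #|X|)%N.
  by apply: split3 => w _; have := trich w; do 3 case: (w \in _).
have cX' : (#|X' :&: P| + #|X' :&: Q| + #|X' :&: X| <= #|X'|)%N.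
  by apply: split3 => w _; have := trichX w; do 3 case: (w \in _).
rewrite (setIC X' P) (setIC X' Q) (setIC X' X) in cX'.
have ltQ : (#|Q :&: X'| < #|Q|)%N.
  apply: proper_card; apply/properP; split; first exact: subsetIl.
  by exists y => //; rewrite inE yQ.
have nbr u w (A := W) : u \in Q -> w \in W -> e u w -> ~~ ((u == y) && (w == x)) -> (w \in Q) || (w \in X).
  move=> uQ wW euw no; have /or3P[wP|->|->] := inW w wW; rewrite ?orbT //.
  by have [E1 E2] := nbQP u w uQ wP euw; move: no; rewrite E1 E2 !eqxx.
have nbrP u w : u \in P -> w \in W -> e u w -> ~~ ((u == x) && (w == y)) -> (w \in P) || (w \in X).
  move=> uP wW euw no; have /or3P[->|wQ|->] := inW w wW; rewrite ?orbT //.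
  rewrite e_sym in euw.
  by have [E1 E2] := nbQP w u wQ uP euw; move: no; rewrite E1 E2 !eqxx.
have nbr' u w : u \in Q' -> w \in W -> e u w -> ~~ ((u == z) && (w == y)) -> (w \in Q') || (w \in X').
  move=> uQ wW euw no; have /or3P[wP|->|->] := inW' w wW; rewrite ?orbT //.
  by have [E1 E2] := nbQP' u w uQ wP euw; move: no; rewrite E1 E2 !eqxx.
have nbrP' u w : u \in P' -> w \in W -> e u w -> ~~ ((u == y) && (w == z)) -> (w \in P') || (w \in X').
  move=> uP wW euw no; have /or3P[->|wQ|->] := inW' w wW; rewrite ?orbT //.
  rewrite e_sym in euw.
  by have [E1 E2] := nbQP' w u wQ uP euw; move: no; rewrite E1 E2 !eqxx.
(* The degree of [y] enters here: if the corner is [y] alone, the neighbours of [y] along edges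
   outside [K] all lie in [T4]. Otherwise the corner without [y] is a fragment whose neighbourhood
   lies in [y |: T4]. *)
have t4 : (k <= #|T4| + 1)%N.
  have [E|ne] := eqVneq ((Q :&: P') :\ y) set0.
    apply: leq_trans (K_deg Kxy) (leq_trans _ (leq_addr 1 _)).
    apply/subset_leq_card/subsetP => u; rewrite inE => /and3P[uW eyu nK].
    have uy : u != y by apply: contraTneq eyu => ->; rewrite e_irr.
    have ux : u != x by apply: contraNneq nK => ->; rewrite K_sym.
    have uz : u != z by apply: contraNneq nK => ->.
    have := nbr y u yQ uW eyu; rewrite eqxx (negPf ux) => /(_ isT).
    have := nbrP' y u yP' uW eyu; rewrite eqxx (negPf uz) => /(_ isT).
    have /setP/(_ u) := E; rewrite !in_setD1 !in_setU !in_setI in_set0 uy /=.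
    by case: (u \in Q); case: (u \in X); case: (u \in P'); case: (u \in X').
  have : (k <= #|y |: T4|)%N.
    apply: (k_connected_frag (A := (Q :&: P') :\ y) (r := x) kW) => //.
    - by apply/subsetP => u; rewrite !in_setD1 in_setI => /and3P[_ /(subsetP QW)].
    - by rewrite in_setD1 in_setI (negPf xnQ) andbF.
    - by rewrite in_setU1 negb_or nxy !in_setU !in_setI (negPf xnX) (negPf xnQ).
    - apply/pred0P => u /=; rewrite in_setD1 in_setU1 !in_setU !in_setI.
      apply/negbTE/negP => /andP[/and3P[uy uQ uP'] /predU1P[E|]].
        by rewrite E eqxx in uy.
      by have /andP[_ /negPf ->] := PnQ' _ uP'; rewrite (negPf (QnX _ uQ)) !andbF.
    move=> u w; rewrite !in_setD1 in_setI => /and3P[uy uQ uP'] wW euw.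
    have := nbr u w uQ wW euw; rewrite (negPf uy) => /(_ isT).
    have := nbrP' u w uP' wW euw; rewrite (negPf uy) => /(_ isT).
    rewrite in_setU1 !in_setU !in_setI; case: (w == y) => //=; rewrite ?orbT //.
    by case: (w \in Q); case: (w \in X); case: (w \in P'); case: (w \in X').
  by move/leq_trans; apply; rewrite cardsU1 addnC leq_add2l leq_b1.
(* A nonempty corner would give [k <= #|T3|], which together with [t4] exceeds the bound for
   opposite corners. *)
have PQ0 : P :&: Q' = set0.
  apply/eqP/negPn/negP => ne.
  have : (k <= #|T3|)%N.
    apply: (k_connected_frag (A := P :&: Q') (r := y) kW) => //.
    - by apply/subsetP => u; rewrite in_setI => /andP[_ /(subsetP Q'W)].
    - by rewrite in_setI (negPf ynQ') andbF.
    - by rewrite !in_setU !in_setI (negPf ynX) (negPf ynX') !andbF.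
    - apply/pred0P => u /=; rewrite !in_setU !in_setI.
      apply/negbTE/negP => /andP[/andP[uP uQ']].
      by have /andP[_ /negPf ->] := PnQ _ uP; rewrite (negPf (QnX' _ uQ')) !andbF.
    move=> u w; rewrite in_setI => /andP[uP uQ'] wW euw.
    have ux : u != x by apply: contraNneq xnQ' => <-.
    have uz : u != z by apply: contraNneq znP => <-.
    have := nbrP u w uP wW euw; rewrite (negPf ux) => /(_ isT).
    have := nbr' u w uQ' wW euw; rewrite (negPf uz) => /(_ isT).
    rewrite !in_setU !in_setI.
    by case: (w \in P); case: (w \in X); case: (w \in Q'); case: (w \in X').
  by move: u3 u4 cX cX' t4 ltX ltX'; clear; lia.
(* If this corner were empty too, [Q'] would lie in [X], and [t4] would force
   [#|Q'| <= #|Q :&: X'| < #|Q|], against the minimality of [Q]. *)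
have [QQ0|neQQ] := eqVneq (Q :&: Q') set0.
  have : Q' \subset X :&: Q'.
    apply/subsetP => u uQ'; rewrite in_setI uQ' andbT.
    have /or3P[uP|uQ|//] := inW u (subsetP Q'W u uQ').
      by have /setP/(_ u) := PQ0; rewrite !inE uQ'; move: uP; rewrite !inE => ->.
    by have /setP/(_ u) := QQ0; rewrite !inE uQ' uQ.
  by move/subset_leq_card; move: u4 cX t4 ltX leQ' ltQ; clear; lia.
(* The edge [yz] leaves this corner only if [z] is in [Q]; then [y] joins the neighbourhood. *)
have frag1 (T := if z \in Q then y |: T1 else T1) : (k <= #|T|)%N.
  apply: (k_connected_frag (A := Q :&: Q') (r := x) kW) => //.
  - by apply/subsetP => u; rewrite in_setI => /andP[_ /(subsetP Q'W)].
  - by rewrite in_setI (negPf xnQ).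
  - rewrite /T; case: ifP => _; last by rewrite !in_setU !in_setI (negPf xnX) (negPf xnQ).
    by rewrite in_setU1 negb_or nxy !in_setU !in_setI (negPf xnX) (negPf xnQ).
  - apply/pred0P => u /=; rewrite in_setI; apply/negbTE/negP => /andP[/andP[uQ uQ']].
    have uy : u != y by apply: contraNneq ynQ' => <-.
    suff /negPf H : u \notin T1 by rewrite /T; case: ifP => _; rewrite ?in_setU1 ?(negPf uy) H.
    by rewrite !in_setU !in_setI (negPf (QnX _ uQ)) (negPf (QnX' _ uQ')) !andbF.
  move=> u w; rewrite in_setI => /andP[uQ uQ'] wW euw.
  have uy : u != y by apply: contraNneq ynQ' => <-.
  have := nbr u w uQ wW euw; rewrite (negPf uy) => /(_ isT) H1.
  have [/andP[/eqP uz /eqP wy]|no] := boolP ((u == z) && (w == y)).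
    by rewrite /T -uz uQ in_setU1 wy eqxx orbT.
  have := nbr' u w uQ' wW euw no; move: H1.
  suff H : w \in T1 -> w \in T.
    rewrite in_setI; move: H; rewrite /T1 !in_setU !in_setI.
    by case: (w \in Q); case: (w \in X); case: (w \in Q'); case: (w \in X') => //= ->.
  by rewrite /T; case: ifP => // _ ?; rewrite in_setU1 orbC; apply/orP; left.
have leT1 : (k <= #|T1| + (z \in Q))%N.
  move: frag1; case: (z \in Q) => /=; last by rewrite addn0.
  by rewrite cardsU1 addnC => /leq_trans; apply; rewrite leq_add2l leq_b1.
(* If this corner were empty, [P] would lie in [X'], whence [#|P| <= #|X :&: Q'| <= #|Q :&: X'| <
   #|Q|]. But [P] is a bridging set for the reversed edge, hence at least as large as [Q]. *)
have [PP0|nePP] := eqVneq (P :&: P') set0.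
  have : P \subset P :&: X'.
    apply/subsetP => u uP; rewrite in_setI uP /=.
    have uW : u \in W by move: uP; rewrite !inE => /andP[].
    have /or3P[uP'|uQ'|//] := inW' u uW.
      by have /setP/(_ u) := PP0; rewrite in_setI uP uP' inE.
    by have /setP/(_ u) := PQ0; rewrite in_setI uP uQ' inE.
  by move/subset_leq_card; move: (leq_b1 (z \in Q)) u1 u4 cX cX' t4 leT1 ltX ltX' leP ltQ; clear; lia.
have t2 : (k <= #|y |: T2|)%N.
  apply: (k_connected_frag (A := P :&: P') (r := z) kW) => //.
  - by apply/subsetP => u; rewrite in_setI !inE => /andP[/andP[]].
  - by rewrite in_setI (negPf znP).
  - rewrite in_setU1 negb_or eq_sym nyz !in_setU !in_setI (negPf znP) (negPf (QnX' _ zQ')) !andbF.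
    rewrite !orbF; apply/negP => /andP[_ /PnQ'].
    by rewrite zQ'.
  - apply/pred0P => u /=; rewrite in_setU1 in_setI; apply/negbTE/negP.
    case/andP=> /andP[uP uP'] /predU1P[E|].
      by have /andP[] := PnQ _ uP; rewrite E yQ.
    have /andP[_ /negPf n1] := PnQ _ uP; have /andP[_ /negPf n2] := PnQ' _ uP'.
    by rewrite !in_setU !in_setI n1 n2 !andbF.
  move=> u w; rewrite in_setI => /andP[uP uP'] wW euw.
  have uy : u != y by apply: contraTneq yQ => <-; case/andP: (PnQ _ uP).
  have [/andP[/eqP ux /eqP wy]|no] := boolP ((u == x) && (w == y)).
    by rewrite in_setU1 wy eqxx orbT.
  have := nbrP u w uP wW euw no.
  have := nbrP' u w uP' wW euw; rewrite (negPf uy) => /(_ isT).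
  rewrite in_setU1 !in_setU !in_setI; case: (w == y) => //=; rewrite ?orbT //.
  by case: (w \in P); case: (w \in X); case: (w \in P'); case: (w \in X').
have leT2 : (k <= #|T2| + 1)%N by apply: leq_trans t2 _; rewrite cardsU1 addnC leq_add2l leq_b1.
(* As [T2] has at least [k - 1] nodes, at most [k - 1] are left for [T1]. So [z] is in [Q], and
   [Q :&: Q'] is a bridging set for [yz] that misses [y]: a proper subset of [Q]. *)
have zQ : z \in Q by move: leT1; case: (z \in Q) => //=; move: u1 u2 cX cX' leT2 ltX ltX'; clear; lia.
have ltT1 : (#|T1| < k)%N by move: u1 u2 cX cX' leT2 ltX ltX'; clear; lia.
have : bridging y z (Q :&: Q') T1.
  apply/and5P; split.
  - by apply/subsetP => u; rewrite in_setI => /andP[_ /(subsetP Q'W)].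
  - apply/pred0P => u /=; rewrite !in_setU !in_setI; apply/negbTE/negP => /andP[/andP[uQ uQ']].
    by rewrite (negPf (QnX _ uQ)) (negPf (QnX' _ uQ')) !andbF.
  - by rewrite in_setI zQ.
  - rewrite in_setD yW andbT in_setU negb_or in_setI (negPf ynQ') andbF /=.
    by rewrite !in_setU !in_setI (negPf ynX) (negPf ynX') !andbF.
  rewrite ltT1; apply/forall_inP => u; rewrite in_setI => /andP[uQ uQ'].
  apply/forall_inP => w; rewrite in_setD in_setU negb_or => /andP[/andP[w1 w2] wW].
  apply/implyP => euw; apply/negPn/negP => no.
  have uy : u != y by apply: contraNneq ynQ' => <-.
  have := nbr u w uQ wW euw; rewrite (negPf uy) => /(_ isT).
  have := nbr' u w uQ' wW euw no.
  move: w1 w2; rewrite !in_setU !in_setI.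
  by case: (w \in Q); case: (w \in X); case: (w \in Q'); case: (w \in X').
move/(minQ _ _ _ _ Kyz).
rewrite leqNgt => /negP[]; apply: proper_card; apply/properP; split.
  exact: subsetIl.
by exists y => //; rewrite in_setI (negPf ynQ') andbF.
Qed.

End CriticalEdges.

(** * Sparse [k]-connected subgraphs: all edges at [D] plus a forest *)

Section Sparsify.
Variable V : finType.
Implicit Types (e K : rel V) (D W X Y : {set V}).

Lemma k_connected_sub e e' k W : subrel e e' -> k_connected e k W ->
  k_connected e' k W.
Proof.
move=> see' [ltW cW]; split=> // X XW ltX x y xW yW.
apply: connect_subP (cW X XW ltX x y xW yW) => u w /and3P[uW wW /see' euw].
by apply: connect1; rewrite inducedE uW wW.
Qed.

Definition edges e : {set V * V} := [set q | e q.1 q.2].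

Lemma del_edge_lt e x y : e x y -> (#|edges (del_edge e x y)| < #|edges e|)%N.
Proof.
move=> exy; apply: proper_card; apply/properP; split.
  by apply/subsetP=> q; rewrite !inE => /del_edge_sub.
by exists (x, y); rewrite !inE //= /del_edge /= !eqxx andbF.
Qed.

(** Leaves are stripped one at a time, each taking its only neighbour as parent. The hypothesis
    covers all nonempty symmetric subrelations, so a leaf is available until no edge is left. *)
Lemma forest_parent K : symmetric K ->
  (forall K', symmetric K' -> subrel K' K -> (exists x y, K' x y) ->
     exists x y, K' x y /\ forall z, K' y z -> z = x) ->
  exists par : V -> V, forall u v, K u v -> par u = v \/ par v = u.
Proof.
have [N] := ubnP #|edges K|; elim: N K => // N IH K leN Ks leaf.
case: (pselect (exists x y, K x y)) => [exK|noK]; last first.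
  by exists id => u v Kuv; case: noK; exists u, v.
have [x [y [Kxy Ky]]] := leaf K Ks (fun _ _ h => h) exK.
have [||par parP] := IH (del_edge K x y) _ (del_edge_sym x y Ks).
- by rewrite -ltnS; apply: leq_trans leN; rewrite ltnS; apply: del_edge_lt.
- by move=> K' K's K'sub; apply: leaf => // u v /K'sub; apply: del_edge_sub.
exists (fun u => if u == y then x else par u) => u v Kuv.
have [uy|nuy] := eqVneq u y; first by left; rewrite (Ky v) // -uy.
have [vy|nvy] := eqVneq v y; first by right; rewrite (Ky u) // -vy Ks.
by apply: parP; rewrite /del_edge /= Kuv (negPf nuy) (negPf nvy) andbF.
Qed.

Definition keep_edges e D K : rel V :=
  [rel u v | e u v && [|| u \in D, v \in D | K u v]].

Lemma keep_edges_sym e D K : symmetric e -> symmetric K ->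
  symmetric (keep_edges e D K).
Proof. by move=> es Ks u v; rewrite /keep_edges /= es Ks orbCA. Qed.

Lemma critical_subset e D W k K0 : symmetric K0 -> k_connected (keep_edges e D K0) k W ->
  exists K, [/\ symmetric K, subrel K K0, k_connected (keep_edges e D K) k W &
    forall x y, K x y -> ~ k_connected (keep_edges e D (del_edge K x y)) k W].
Proof.
have [N] := ubnP #|edges K0|; elim: N K0 => // N IH K0 leN Ks kK.
case: (pselect (exists x y, K0 x y /\ k_connected (keep_edges e D (del_edge K0 x y)) k W)).
  case=> x [y [Kxy kxy]].
  have [|K [? Ksub ? ?]] := IH _ _ (del_edge_sym x y Ks) kxy.
    by rewrite -ltnS; apply: leq_trans leN; rewrite ltnS; apply: del_edge_lt.
  by exists K; split=> // u v /Ksub; apply: del_edge_sub.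
move=> no; exists K0; split=> // x y Kxy kxy; apply: no; exists x, y; split=> //.
Qed.

(** Every nonempty symmetric part of the minimal [K] still consists of critical edges, so it has a
    leaf. The degree condition of [critical_leaf] holds because the [k] neighbours in [D] are
    reached by edges outside [K]. *)
Lemma sparse_k_connected e D W k : symmetric e -> irreflexive e ->
  k_connected e k W -> D \subset W ->
  (forall w, w \in W -> w \notin D -> (k <= #|[set u in D | e w u]|)%N) ->
  exists (K : rel V) (par : V -> V),
    k_connected (keep_edges e D K) k W /\
    forall u v, K u v -> [/\ e u v, u \in W :\: D, v \in W :\: D &
      par u = v \/ par v = u].
Proof.
move=> es ei kW DW dom.
pose K0 := [rel u v | [&& e u v, u \in W :\: D & v \in W :\: D]].
have K0s : symmetric K0 by move=> u v; rewrite /K0 /= es [X in _ && X]andbC.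
have kK0 : k_connected (keep_edges e D K0) k W.
  have kI : k_connected (induced e W) k W.
    case: kW => ltW cW; split=> // X XW ltX x y xW yW.
    apply: connect_subP (cW X XW ltX x y xW yW) => u w /and3P[uW wW euw].
    apply: connect1; rewrite inducedE uW wW inducedE euw.
    by move: uW wW; rewrite !inE => /andP[_ ->] /andP[_ ->].
  apply: k_connected_sub kI => u w /and3P[uW wW euw].
  by rewrite /keep_edges /= euw !inE uW wW !andbT; do 2 case: (_ \in D).
have [K [Ks Ksub kK crit]] := critical_subset K0s kK0.
have Kin u v : K u v -> [/\ e u v, u \in W :\: D & v \in W :\: D].
  by move/Ksub => /and3P[].
have [|par parP] := forest_parent Ks; last first.
  by exists K, par; split=> // u v Kuv; have [? ? ?] := Kin _ _ Kuv; split=> //; apply: parP.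
move=> K' K's K'sub exK'.
have eKs := keep_edges_sym D es Ks.
apply: (@critical_leaf _ (keep_edges e D K) k W eKs _ kK K' K's) => //.
- by move=> u; rewrite /keep_edges /= ei.
- by move=> u v /K'sub Kuv; rewrite /keep_edges /= Kuv; have [-> _ _] := Kin _ _ Kuv; rewrite !orbT.
- move=> u v /K'sub /Kin[_]; rewrite !inE => /andP[_ ->] /andP[_ ->] //.
- move=> u v /K'sub Kuv kd; apply: (crit _ _ Kuv); apply: k_connected_sub kd.
  have [_ uD vD] := Kin _ _ Kuv.
  move=> a b; rewrite /del_edge /keep_edges /= => /andP[/andP[-> /or3P[->|->|->]]];
    by rewrite ?orbT //= => ->; rewrite !orbT.
move=> x y K'xy; have [_ _] := Kin _ _ (K'sub _ _ K'xy); rewrite inE => /andP[yD yW].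
apply: leq_trans (dom y yW yD) _; apply/subset_leq_card/subsetP => u.
rewrite !inE => /andP[uD eyu]; rewrite (subsetP DW) // /keep_edges /= eyu uD orbT /=.
apply/negP => /K'sub/Kin[_ _]; rewrite inE uD //.
Qed.

End Sparsify.

(** * Edge swaps that preserve 2-connectivity *)

Section Swap.
Variable V : finType.
Variables (e : rel V) (W : {set V}).
Hypotheses (e_sym : symmetric e) (e_irr : irreflexive e).
Hypothesis e_W : forall x y, e x y -> (x \in W) && (y \in W).
Hypothesis W2 : k_connected e 2 W.

Definition swap_edge v u1 u2 : rel V :=
  [rel a b | del_edge e v u1 a b ||
    ((a == u1) && (b == u2) || (a == u2) && (b == u1))].

Lemma connect_split x y (e' : rel V) (U : {set V}) :
  connect_sym (induced e' U) -> subrel (del_edge e x y) e' ->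
  (x \in U -> y \in U -> connect (induced e' U) x y) ->
  forall a b, connect (induced e U) a b -> connect (induced e' U) a b.
Proof.
move=> sym sub cxy; apply: connect_subP => u w /and3P[uU wU euw].
have [|no] := boolP ((u == x) && (w == y) || (u == y) && (w == x)).
  case/orP=> /andP[/eqP E1 /eqP E2]; rewrite E1 E2 in uU wU *; first exact: cxy.
  by rewrite sym; apply: cxy.
apply: connect1; rewrite inducedE uU wU; apply: sub.
by rewrite /del_edge /= euw no.
Qed.

(* If deleting [u2] makes [v u1] a bridge, then [v] reaches [u2] both through
   [u1] and through [u3], so [v u2] is not critical. *)
Lemma swap_2_connected v u1 u2 u3 : e v u1 -> e v u2 -> e v u3 ->
  u1 != u2 -> u1 != u3 -> u2 != u3 ->
  ~ k_connected (del_edge e v u2) 2 W -> k_connected (swap_edge v u1 u2) 2 W.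
Proof.
move=> e1 e2 e3 n12 n13 n23 crit.
have ne x y : e x y -> x != y by apply: contraTneq => ->; rewrite e_irr.
have [nv1 nv2 nv3] := And3 (ne _ _ e1) (ne _ _ e2) (ne _ _ e3).
have /andP[vW u1W] := e_W e1; have /andP[_ u2W] := e_W e2; have /andP[_ u3W] := e_W e3.
have ss : symmetric (swap_edge v u1 u2).
  move=> a b; rewrite /swap_edge /= (del_edge_sym v u1 e_sym a b).
  by rewrite (andbC (a == u1)) (andbC (a == u2)) (orbC ((b == u2) && _)).
have subs : subrel (del_edge e v u1) (swap_edge v u1 u2).
  by move=> a b; rewrite /swap_edge /= => ->.
have [ltW _] := W2.
split=> // X XW ltX a b aX bX.
apply: (connect_split (sym_connect_sym (induced_sym _ ss)) subs);
  last exact: (k_connected_cut W2 ltX).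
(* Only [v] and [u1] have to be reconnected. While [u2] survives, the walk [v u2 u1] does it, so the
   dangerous deletion is [X = [set u2]]. *)
move=> vX u1X; have [u2X|u2X] := boolP (u2 \in W :\: X).
  apply: (@connect_trans _ _ u2); apply: connect1; rewrite inducedE.
    rewrite vX u2X; apply: subs.
    by rewrite /del_edge /= e2 eq_sym (negPf n12) (negPf nv1) andbF.
  by rewrite u2X u1X /swap_edge /= !eqxx !orbT.
have u2X' : u2 \in X by move: u2X; rewrite inE u2W andbT negbK.
have XE : X = [set u2].
  by apply/eqP; rewrite eq_sym eqEcard sub1set u2X' cards1.
apply: contrapT => nc; apply: crit; split=> // Y YW ltY c d cY dY.
pose f := induced (del_edge e v u1) (W :\ u2).
(* [A] is the side of [v] once [u2] and the edge [v u1] are gone, and it misses [u1]. At most one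
   node is deleted by [Y], so [v u2] can be bypassed on the other side: through [u1] if that node is
   in [A], else through [u3]. *)
pose A := [set z | connect f v z].
have fs : connect_sym f := sym_connect_sym (induced_sym _ (del_edge_sym _ _ e_sym)).
have u1A : u1 \notin A.
  rewrite inE; apply/negP => cv; apply: nc; apply: connect_subP cv => u w /and3P[uW wW duw].
  by apply: connect1; rewrite inducedE XE uW wW subs.
have Acl u w : u != v -> w != v -> u != u2 -> w != u2 -> e u w -> u \in A -> w \in A.
  move=> uv wv u2' w2' euw; rewrite !inE => cu; apply: connect_trans cu (connect1 _).
  have /andP[uW wW] := e_W euw.
  by rewrite /f inducedE !inE uW wW u2' w2' /del_edge /= euw (negPf uv) (negPf wv) andbF.
have ds := del_edge_sym v u2 e_sym.
apply: (connect_split (sym_connect_sym (induced_sym _ ds)) (fun _ _ h => h));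
  last exact: (k_connected_cut W2 ltY).
move=> vY u2Y; pose g := induced (del_edge e v u2) (W :\: Y).
(* [S] can be left only through [v] or [u2]. As [W :\ v] is connected, a walk in it from [z] to [u2]
   stays in [S] until it meets [u2]. *)
have toU2 (S : {set V}) z : z \in S -> z != v -> e v z -> z != u2 ->
    (forall u, u \in S -> u \in W :\: Y) -> v \notin S ->
    (forall u w, u \in S -> w != v -> w != u2 -> u != u2 -> e u w -> w \in S) ->
    connect g v u2.
  move=> zS zv evz zu2 SY vS Scl.
  apply: (@connect_trans _ _ z).
    apply: connect1; rewrite /g inducedE vY SY // /del_edge /= evz (negPf zu2) andbF /=.
    by rewrite (negPf nv2).
  have lt1 : (#|[set v]| < 2)%N by rewrite cards1.
  have zv' : z \in W :\ v by have /andP[_ zW] := e_W evz; rewrite !inE zv zW.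
  have u2v : u2 \in W :\ v by rewrite !inE eq_sym nv2.
  have := k_connected_cut W2 lt1 zv' u2v.
  pose P w := connect g z u2 \/ [/\ w \in S, w != u2 & connect g z w].
  move=> cz; suff: P u2 by case=> // -[]; rewrite eqxx.
  apply: (connect_indP _ _ cz); first by right.
  move=> u w [c1|[uS uu2 cu]] /and3P[uv wv euw]; first by left.
  have uY := SY _ uS; have uv' : u != v by apply: contraNneq vS => <-.
  have [wu2|wu2] := eqVneq w u2.
    left; apply: connect_trans cu (connect1 _).
    by rewrite /g inducedE uY u2Y /del_edge /= -wu2 euw (negPf uv') wu2 (negPf uu2).
  have wv' : w != v by move: wv; rewrite !inE => /andP[].
  have wS := Scl u w uS wv' wu2 uu2 euw.
  right; split=> //; apply: connect_trans cu (connect1 _).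
  by rewrite /g inducedE uY SY // /del_edge /= euw (negPf uv') (negPf uu2).
have [/existsP[y /andP[yY yA]]|noY] := boolP [exists y, (y \in Y) && (y \in A)].
  have YE : Y = [set y].
    by apply/eqP; rewrite eq_sym eqEcard sub1set yY cards1.
  apply: (toU2 ((W :\: A) :\ u2) u1) => //; rewrite ?[_ == v]eq_sym //.
  - by rewrite !inE n12 u1W andbT; move: u1A; rewrite inE.
  - move=> u; rewrite YE !inE => /and3P[_ uA ->]; rewrite andbT.
    by apply: contraNneq uA => ->; move: yA; rewrite inE.
  - by rewrite !in_setD !inE connect0 andbF.
  move=> u w; rewrite !in_setD in_set1 => /and3P[uu2 uA uW] wv wu2 _ euw.
  have /andP[_ wW] := e_W euw; rewrite in_set1 wu2 wW andbT /=.
  apply: contra uA => wA; have [uv|uv] := eqVneq u v; first by rewrite uv inE connect0.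
  by apply: (Acl w u) => //; rewrite e_sym.
have u3A : u3 \in A.
  rewrite inE; apply: connect1; rewrite /f inducedE !inE vW u3W nv2 /= (eq_sym u3) n23 /=.
  by rewrite /del_edge /= e3 eqxx (eq_sym u3) (negPf n13) (negPf nv1).
apply: (toU2 (A :\ v) u3) => //; rewrite ?[_ == v]eq_sym //.
- by rewrite in_setD1 u3A andbT eq_sym.
- by rewrite eq_sym.
- move=> u; rewrite in_setD1 in_setD => /andP[uv uA].
  apply/andP; split; first by apply/negP => uY; case/negP: noY; apply/existsP; exists u; rewrite uY.
  move: uA; rewrite inE => cu; have := connect_in cu; rewrite !inE nv2 vW.
  by case/(_ isT)/andP.
- by rewrite in_setD1 eqxx.
move=> u w; rewrite !in_setD1 => /andP[uv uA] wv wu2 uu2 euw; rewrite wv /=.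
exact: Acl euw uA.
Qed.

End Swap.

(** * Degree five in unit disk graphs *)

Section Geometry.
Variable R : rcfType.
Implicit Types (x y a b c d p q : R).
Local Open Scope ring_scope.

(* [(a, b)] and [(c, d)] are coordinates along two rays at angle 60 degrees, in
   which the squared length is [a^2 + ab + b^2]. *)
Lemma half_open_cone a b c d : 0 < a -> 0 <= b -> 0 < c -> 0 <= d ->
  a ^+ 2 + a * b + b ^+ 2 < 2 * (a * c + b * d) + a * d + b * c \/
  c ^+ 2 + c * d + d ^+ 2 < 2 * (a * c + b * d) + a * d + b * c.
Proof.
move=> a0 b0 c0 d0.
have [ac|ca] := leP a c; have [bd|db] := leP b d.
- left; nra.
- have [le|lt] := leP (b - d) (c - a); [left|right]; nra.
- have [le|lt] := leP (d - b) (a - c); [right|left]; nra.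
right; nra.
Qed.

(** Here [p] stands for a scalar product with a reference vector and [h] for the cross product
    divided by [sqrt 3]. The four conditions are the directions in [60,120), [120,180), [180,240)
    and [240,300) degrees; in each, combinations of [p] and [h] serve as coordinates along the
    bounding rays. *)
Lemma half_open_sector p h p' h' :
  let same P := P p h && P p' h' in
  [|| same (fun p h => (0 < h) && (p <= h) && (- h < p)),
      same (fun p h => (0 < h) && (p <= - h)),
      same (fun p h => (h <= 0) && (p < h)) |
      same (fun p h => (h < 0) && (h <= p) && (p < - h))] ->
  p ^+ 2 + 3 * h ^+ 2 < 2 * (p * p' + 3 * (h * h')) \/
  p' ^+ 2 + 3 * h' ^+ 2 < 2 * (p * p' + 3 * (h * h')).
Proof.
have H a b c d : 0 < a -> 0 <= b -> 0 < c -> 0 <= d ->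
  p ^+ 2 + 3 * h ^+ 2 = a ^+ 2 + a * b + b ^+ 2 ->
  p' ^+ 2 + 3 * h' ^+ 2 = c ^+ 2 + c * d + d ^+ 2 ->
  2 * (p * p' + 3 * (h * h')) = 2 * (a * c + b * d) + a * d + b * c ->
  p ^+ 2 + 3 * h ^+ 2 < 2 * (p * p' + 3 * (h * h')) \/
  p' ^+ 2 + 3 * h' ^+ 2 < 2 * (p * p' + 3 * (h * h')).
  by move=> a0 b0 c0 d0 -> -> ->; apply: half_open_cone.
move=> same /or4P[]; rewrite /same => /andP[].
- move=> /andP[/andP[h1 h2] h3] /andP[/andP[h4 h5] h6].
  apply: (H (h + p) (h - p) (h' + p') (h' - p')); by [lra|ring].
- move=> /andP[h1 h2] /andP[h4 h5].
  apply: (H (2 * h) (- p - h) (2 * h') (- p' - h')); by [lra|ring].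
- move=> /andP[h1 h2] /andP[h4 h5].
  apply: (H (h - p) (- 2 * h) (h' - p') (- 2 * h')); by [lra|ring].
move=> /andP[/andP[h1 h2] h3] /andP[/andP[h4 h5] h6].
apply: (H (- h - p) (p - h) (- h' - p') (p' - h')); by [lra|ring].
Qed.

Definition sqnorm (z : R * R) : R := z.1 ^+ 2 + z.2 ^+ 2.

Lemma sqnorm_gt0 z : z != 0 -> 0 < sqnorm z.
Proof.
rewrite -pair_eqE /= negb_and /sqnorm => /orP[] h.
  by rewrite ltr_wpDr ?sqr_ge0 // lt_def sqr_ge0 sqrf_eq0 h.
by rewrite ltr_wpDl ?sqr_ge0 // lt_def sqr_ge0 sqrf_eq0 h.
Qed.

Variables (V : finType) (z : V -> R * R) (S : {set V}).
Hypothesis z_neq0 : {in S, forall u, z u != 0}.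
Hypothesis S6 : (6 <= #|S|)%N.

(* Strictly closer than [z u], or equally far and closer in the second
   coordinate: this tie-break excludes the regular hexagon. *)
Definition lex_closer (u w : V) :=
  sqnorm (z u - z w) < sqnorm (z u) \/
  (sqnorm (z u - z w) = sqnorm (z u) /\ ((z u).2 - (z w).2) ^+ 2 < (z u).2 ^+ 2).

Lemma six_neighbours : exists u w, [/\ u \in S, w \in S, u != w & lex_closer u w].
Proof.
apply: contrapT => no.
have far u w : u \in S -> w \in S -> u != w ->
    sqnorm (z u) <= sqnorm (z u - z w) /\
    (sqnorm (z u - z w) = sqnorm (z u) -> (z u).2 ^+ 2 <= ((z u).2 - (z w).2) ^+ 2).
  move=> uS wS uw; split=> [|E]; rewrite leNgt; apply/negP => lt; apply: no.
    by exists u, w; split=> //; left.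
  by exists u, w; split=> //; right.
pose s : R := Num.sqrt 3.
have s2 : s ^+ 2 = 3 by rewrite sqr_sqrtr // ler0n.
have s0 : 0 < s by rewrite sqrtr_gt0 ltr0n.
have sn0 : s != 0 by rewrite gt_eqF.
pose p u w := (z u).1 * (z w).1 + (z u).2 * (z w).2.
pose h u w := ((z u).1 * (z w).2 - (z u).2 * (z w).1) / s.
have hE u w : s * h u w = (z u).1 * (z w).2 - (z u).2 * (z w).1.
  by rewrite /h mulrC divfK.
have ph u w : p u w ^+ 2 + 3 * h u w ^+ 2 = sqnorm (z u) * sqnorm (z w).
  by rewrite -s2 -exprMn hE /p /sqnorm; ring.
have ph2 u w w' : p u w * p u w' + 3 * (h u w * h u w') = sqnorm (z u) * p w w'.
  have -> : 3 * (h u w * h u w') = (s * h u w) * (s * h u w') by rewrite -s2; ring.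
  by rewrite !hE /p /sqnorm; ring.
have dist u w : sqnorm (z u - z w) = sqnorm (z u) + sqnorm (z w) - 2 * p u w.
  by rewrite /sqnorm /p /=; ring.
have far' u w : u \in S -> w \in S -> u != w ->
    2 * p u w <= sqnorm (z u) /\ 2 * p u w <= sqnorm (z w).
  move=> uS wS uw; have [+ _] := far u w uS wS uw; have wu : w != u by rewrite eq_sym.
  have [+ _] := far w u wS uS wu.
  rewrite !dist; have -> : p w u = p u w by rewrite /p; ring.
  by move=> ? ?; split; lra.
(* The witness is [z u] turned by -60 degrees. Measured from [z u], the at least five other points
   have directions from 60 to 300 degrees, and each half-open sector holds at most one of them. So
   one lies at exactly 300 degrees, and the distance bounds force it to be as long as [z u]. *)
have next u : u \in S -> exists2 w, w \in S &
    z w = (((z u).1 + s * (z u).2) / 2, ((z u).2 - s * (z u).1) / 2).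
  move=> uS; have nu := sqnorm_gt0 (z_neq0 uS).
  apply: contrapT => nonext.
  pose C1 w := (0 < h u w) && (p u w <= h u w) && (- h u w < p u w).
  pose C2 w := (0 < h u w) && (p u w <= - h u w).
  pose C3 w := (h u w <= 0) && (p u w < h u w).
  pose C4 w := (h u w < 0) && (h u w <= p u w) && (p u w < - h u w).
  pose cls w : 'I_4 := if C1 w then inord 0 else if C2 w then inord 1
    else if C3 w then inord 2 else inord 3.
  have clsP w : w \in S :\ u -> [|| C1 w, C2 w, C3 w | C4 w].
    rewrite /C1 /C2 /C3 /C4.
    rewrite in_setD1 => /andP[wu wS]; have uw : u != w by rewrite eq_sym.
    have nw := sqnorm_gt0 (z_neq0 wS).
    have [f1 f2] := far' u w uS wS uw.
    have E := ph u w.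
    have pabs : p u w <= 0 \/ p u w ^+ 2 <= h u w ^+ 2.
      have [le|lt] := leP (p u w) 0; [by left|right].
      have : (2 * p u w) ^+ 2 <= sqnorm (z u) * sqnorm (z w).
        by rewrite expr2; apply: ler_pM => //; lra.
      by rewrite -E; nra.
    have nz : 0 < p u w ^+ 2 + 3 * h u w ^+ 2 by rewrite E mulr_gt0.
    have [hp|hn] := ltP 0 (h u w).
      have le1 : p u w <= h u w by case: pabs => ?; nra.
      by rewrite le1 /=; case: ltP.
    have le1 : p u w <= - h u w by case: pabs => ?; nra.
    rewrite /=; have [//|hle /=] := ltP (p u w) (h u w).
    have hlt : h u w < 0.
      by rewrite lt_neqAle hn andbT; apply/negP => /eqP h0; move: nz hle le1; rewrite h0; nra.
    rewrite hlt /=; case: ltP => // ge; case: nonext; exists w => //.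
    have pE : p u w = - h u w by apply/eqP; rewrite eq_le le1 ge.
    have p4 : 4 * p u w ^+ 2 = sqnorm (z u) * sqnorm (z w) by rewrite -E pE; ring.
    have pp : 0 < p u w by rewrite pE; lra.
    have pu : 2 * p u w = sqnorm (z u).
      apply/eqP; rewrite eq_le f1 /= leNgt; apply/negP => lt; move: p4 lt f2 nw pp; clear; nra.
    have cE := hE u w; have h2 : h u w = - (sqnorm (z u) / 2) by move: pE pu; clear; lra.
    rewrite h2 in cE.
    have q1 : sqnorm (z u) * (z w).1 = sqnorm (z u) * (((z u).1 + s * (z u).2) / 2).
      have -> : sqnorm (z u) * (z w).1 = (z u).1 * p u w - (z u).2 * ((z u).1 * (z w).2 - (z u).2 * (z w).1).
        by rewrite /sqnorm /p; ring.
      have -> : p u w = sqnorm (z u) / 2 by rewrite -pu; field.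
      by rewrite -cE; field.
    have q2 : sqnorm (z u) * (z w).2 = sqnorm (z u) * (((z u).2 - s * (z u).1) / 2).
      have -> : sqnorm (z u) * (z w).2 = (z u).2 * p u w + (z u).1 * ((z u).1 * (z w).2 - (z u).2 * (z w).1).
        by rewrite /sqnorm /p; ring.
      have -> : p u w = sqnorm (z u) / 2 by rewrite -pu; field.
      by rewrite -cE; field.
    have nn0 : sqnorm (z u) != 0 by rewrite gt_eqF.
    by rewrite [z w]surjective_pairing (mulfI nn0 q1) (mulfI nn0 q2).
  have ninj : ~ {in S :\ u &, injective cls}.
    move=> /card_in_imset E; have := max_card (mem [set cls x | x in S :\ u]).
    by rewrite E card_ord; move: S6; rewrite (cardsD1 u) uS; lia.
  apply: ninj => w w' wS w'S /(congr1 val); rewrite /cls !(fun_if val) /= !inordK // => ecl.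
  apply/eqP/negPn/negP => nww.
  have sec : [|| C1 w && C1 w', C2 w && C2 w', C3 w && C3 w' | C4 w && C4 w'].
    move: (clsP w wS) (clsP w' w'S) ecl.
    case: (C1 w); case: (C1 w'); rewrite //=; case: (C2 w); case: (C2 w'); rewrite //=;
      by case: (C3 w); case: (C3 w'); rewrite //=; case: (C4 w); case: (C4 w').
  move/half_open_sector: sec => sec.
  move: wS w'S; rewrite !in_setD1 => /andP[_ wS] /andP[_ w'S].
  have [f1 f2] := far' w w' wS w'S nww.
  by move: sec; rewrite !ph ph2 mulrCA => -[]; rewrite ltr_pM2l //; lra.
have [u uS] : exists u, u \in S by apply/set0Pn; rewrite -card_gt0; lia.
(* Three turns reach the antipode, with second coordinates [A], [B], [B - A], [-A]. The tie-break
   makes [A ^+ 2], [B ^+ 2] and [(B - A) ^+ 2] equal, so [A = B = 0], and then [z u] vanishes. *)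
have [u1 u1S E1] := next u uS; have [u2 u2S E2] := next u1 u1S; have [u3 u3S E3] := next u2 u2S.
have step v w : v \in S -> w \in S ->
    z w = (((z v).1 + s * (z v).2) / 2, ((z v).2 - s * (z v).1) / 2) ->
    (z v).2 ^+ 2 <= ((z v).2 - (z w).2) ^+ 2 /\ (z w).2 ^+ 2 <= ((z v).2 - (z w).2) ^+ 2.
  move=> vS wS E; have nv := sqnorm_gt0 (z_neq0 vS).
  have nw : sqnorm (z w) = sqnorm (z v).
    rewrite E /sqnorm /=; apply: (@mulIf _ 4); first by rewrite pnatr_eq0.
    have -> : (((z v).1 + s * (z v).2) / 2) ^+ 2 + (((z v).2 - s * (z v).1) / 2) ^+ 2 = ((1 + s ^+ 2) / 4) * sqnorm (z v).
      by rewrite /sqnorm; field.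
    by rewrite s2 /sqnorm; field.
  have pv : 2 * p v w = sqnorm (z v) by rewrite /p E /sqnorm /=; field.
  have vw : v != w by apply/negP => /eqP vw; move: pv; rewrite -vw /p /sqnorm; move: nv; rewrite /sqnorm; nra.
  have [_ a1] := far v w vS wS vw.
  have wv : w != v by rewrite eq_sym.
  have [_ a2] := far w v wS vS wv.
  split; first by apply: a1; rewrite dist nw pv; ring.
  have -> : ((z v).2 - (z w).2) ^+ 2 = ((z w).2 - (z v).2) ^+ 2 by ring.
  apply: a2; rewrite dist nw; have -> : p w v = p v w by rewrite /p; ring.
  by rewrite pv; ring.
have [a1 a2] := step _ _ uS u1S E1; have [a3 a4] := step _ _ u1S u2S E2.
have [a5 a6] := step _ _ u2S u3S E3.
pose A := (z u).2; pose B := (z u1).2.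
have y2 : (z u2).2 = B - A.
  rewrite E2 /B /A /= E1 /=; apply: (@mulIf _ 4); first by rewrite pnatr_eq0.
  transitivity (2 * ((z u).2 - s * (z u).1 - s * (z u).1 - s ^+ 2 * (z u).2) / 2); first by field.
  by rewrite s2; field.
have y3 : (z u3).2 = - A.
  have x2 : (z u2).1 = (z u1).1 - (z u).1.
    rewrite E2 /= E1 /=; apply: (@mulIf _ 4); first by rewrite pnatr_eq0.
    transitivity (2 * ((z u).1 + s * (z u).2 + s * (z u).2 - s ^+ 2 * (z u).1) / 2); first by field.
    by rewrite s2; field.
  rewrite E3 /= y2 x2 /A /B E1 /=; apply: (@mulIf _ 4); first by rewrite pnatr_eq0.
  transitivity (- (z u).2 - s * (z u).1 + s * (z u).1 - s ^+ 2 * (z u).2); first by field.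
  by rewrite s2; field.
move: a1 a2 a3 a4 a5 a6; rewrite y2 y3 -/A -/B => a1 a2 a3 a4 a5 a6.
have e1 : A ^+ 2 = B ^+ 2 by lra.
have e2 : B ^+ 2 = 2 * (A * B) by lra.
have A0 : A = 0.
  apply/eqP; rewrite -sqrf_eq0; move/eqP: e1; rewrite eqf_sqr => /orP[] /eqP E.
    by apply/eqP; move: e2; rewrite E; lra.
  by apply/eqP; move: e2; rewrite E; lra.
have B0 : B = 0 by apply/eqP; rewrite -sqrf_eq0 e2 A0 mul0r mulr0.
have := z_neq0 uS; rewrite -pair_eqE /= -/A A0 eqxx andbT => /negP; apply.
move: B0; rewrite /B E1 /= -/A A0 sub0r => /eqP.
by rewrite mulf_eq0 invr_eq0 pnatr_eq0 orbF oppr_eq0 mulf_eq0 (negPf sn0).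
Qed.

End Geometry.

(** * Minimal 2-connected spanning subgraphs of unit disk graphs *)

Section DegreeFive.
Variable R : rcfType.
Local Open Scope ring_scope.

Lemma lex_minimum (T : finType) (P : pred T) (F G : T -> R) i0 : P i0 ->
  exists2 i, P i & forall j, P j -> F i <= F j /\ (F j = F i -> G i <= G j).
Proof.
move=> P0; have [i Pi mini] := arg_minP F P0.
have Qi : [pred j | P j && (F j == F i)] i by rewrite /= Pi eqxx.
have [j /andP[/= Pj /eqP Fj] minj] := arg_minP G Qi.
exists j => // l Pl; split=> [|E]; first by rewrite Fj; apply: mini.
by apply: minj; rewrite /= Pl E Fj eqxx.
Qed.

Variables (V : finType) (pos : V -> R * R) (g : rel V) (W : {set V}).
Hypothesis pos_inj : injective pos.
Hypothesis gE : forall u w, g u w = (u != w) && (sqnorm (pos u - pos w) <= 1).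

Lemma sqnormN (z : R * R) : sqnorm (- z) = sqnorm z.
Proof. by rewrite -[LHS]/((- z.1) ^+ 2 + (- z.2) ^+ 2) !sqrrN. Qed.

Lemma unit_disk_degree_five : k_connected g 2 W ->
  exists E : rel V, [/\ symmetric E, subrel E (induced g W), k_connected E 2 W &
    forall v, (#|[set u | E v u]| <= 5)%N].
Proof.
move=> gW2.
have gs : symmetric g by move=> u w; rewrite !gE eq_sym -sqnormN opprB.
have gi : irreflexive g by move=> u; rewrite gE eqxx.
pose rE (E : {set V * V}) : rel V := fun u w => (u, w) \in E.
pose cand (E : {set V * V}) := `[< [/\ symmetric (rE E), subrel (rE E) (induced g W) &
  k_connected (rE E) 2 W] >].
have c0 : cand (edges (induced g W)).
  apply/asboolP; split.
  - by move=> u w; rewrite /rE !inE; apply: induced_sym.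
  - by move=> u w; rewrite /rE inE.
  case: gW2 => ltW cW; split=> // X XW ltX x y xW yW.
  apply: connect_subP (cW X XW ltX x y xW yW) => u w /and3P[uW wW guw].
  apply: connect1; rewrite inducedE uW wW /rE inE [induced _ _ _ _]inducedE guw andbT.
  by move: uW wW; rewrite !inE => /andP[_ ->] /andP[_ ->].
(* The minimised quantity is the sum of squared lengths, with the sum of squared second coordinates
   of the edge vectors as tie-break. Both orientations of an edge are counted, whence the factors 2
   below. *)
pose Phi (f : R * R -> R) (E : {set V * V}) := \sum_(q in E) f (pos q.1 - pos q.2).
pose dy (z : R * R) := z.2 ^+ 2.
have [E /asboolP[Es Eg kE] Emin] := lex_minimum (Phi (@sqnorm R)) (Phi dy) c0.
have sq0 (z : R * R) : 0 <= sqnorm z by rewrite addr_ge0 ?sqr_ge0.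
have dy0 z : 0 <= dy z by rewrite sqr_ge0.
have dyN z : dy (- z) = dy z by rewrite -[LHS]/((- z.2) ^+ 2) sqrrN.
pose D x y := E :\ (x, y) :\ (y, x).
have relD x y : rE (D x y) =2 del_edge (rE E) x y.
  move=> u w; rewrite /rE /del_edge /= !inE -!pair_eqE /= /pair_eq /=.
  by case: (_ \in E); case: (u == x); case: (u == y); case: (w == x); case: (w == y).
have PhiD f x y : (forall z, f (- z) = f z) -> rE E x y ->
    Phi f E = 2 * f (pos x - pos y) + Phi f (D x y).
  move=> fN Exy; have Eyx : rE E y x by rewrite -(Es x y).
  have nxy : x != y by apply: contraTneq Exy => ->; apply/negP => /Eg/and3P[_ _]; rewrite gi.
  rewrite /Phi (big_setD1 (x, y)) //= (big_setD1 (y, x)) /=; last first.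
    by rewrite !inE -pair_eqE /= (eq_sym y) (negPf nxy) andbF.
  by rewrite addrA -(opprB (pos x)) fN mulr_natl mulr2n.
have crit x y : rE E x y -> ~ k_connected (del_edge (rE E) x y) 2 W.
  move=> Exy kd; have cD : cand (D x y).
    apply/asboolP; split.
    - by move=> u w; rewrite !relD; apply: del_edge_sym.
    - by move=> u w; rewrite relD => /del_edge_sub/Eg.
    by apply: k_connected_sub kd => u w; rewrite relD.
  have [+ _] := Emin _ cD; rewrite (PhiD _ x y sqnormN Exy).
  have : 0 < sqnorm (pos x - pos y).
    apply: sqnorm_gt0; rewrite subr_eq0; apply/negP => /eqP/pos_inj xy.
    by move: Exy => /Eg/and3P[_ _]; rewrite xy gi.
  by lra.
exists (rE E); split=> // v; rewrite leqNgt; apply/negP => lt5.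
pose S := [set u | rE E v u].
have vS u : u \in S -> rE E v u by rewrite inE.
have zn : {in S, forall u, pos u - pos v != 0}.
  move=> u /vS/Eg/and3P[_ _ gvu]; rewrite subr_eq0; apply/negP => /eqP/pos_inj uv.
  by move: gvu; rewrite uv gi.
have [u1 [u2 [u1S u2S n12 closer]]] := six_neighbours zn lt5.
have [u3 u3S] : exists u3, u3 \in S :\ u1 :\ u2.
  apply/set0Pn; rewrite -card_gt0; have := cardsD1 u1 S; have := cardsD1 u2 (S :\ u1).
  by move: lt5; rewrite -/S; case: (u1 \in S); case: (u2 \in S :\ u1); lia.
move: u3S; rewrite !in_setD1 => /and3P[n32 n31 u3S].
have [e1 e2 e3] := And3 (vS _ u1S) (vS _ u2S) (vS _ u3S).
have Ei : irreflexive (rE E) by move=> u; apply/negP => /Eg/and3P[_ _]; rewrite gi.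
have EW x y : rE E x y -> (x \in W) && (y \in W) by move/Eg/and3P=> [-> ->].
have n13 : u1 != u3 by rewrite eq_sym.
have n23 : u2 != u3 by rewrite eq_sym.
have ksw := swap_2_connected Es Ei EW kE e1 e2 e3 n12 n13 n23 (crit _ _ e2).
have d12 : pos u1 - pos v - (pos u2 - pos v) = pos u1 - pos u2.
  by rewrite opprB addrA subrK.
have y12 : (pos u1 - pos v).2 - (pos u2 - pos v).2 = (pos u1 - pos u2).2 by rewrite -d12.
rewrite /lex_closer d12 y12 in closer.
have g12 : g u1 u2.
  rewrite gE n12 /=; have /Eg/and3P[_ _] := e1; rewrite gE => /andP[_ le1].
  rewrite -sqnormN opprB in le1; apply: le_trans le1.
  by case: closer => [/ltW//|[-> _]].
pose E' := (u1, u2) |: ((u2, u1) |: D v u1).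
have relE' : rE E' =2 swap_edge (rE E) v u1 u2.
  move=> u w; rewrite /swap_edge /= -relD /rE !in_setU1 -!pair_eqE /= /pair_eq /=.
  by rewrite orbA orbC.
have cE' : cand E'.
  apply/asboolP; split.
  - move=> u w; rewrite !relE' /swap_edge /= (del_edge_sym v u1 Es u w).
    by rewrite (andbC (u == u1)) (andbC (u == u2)) (orbC ((w == u2) && _)).
  - move=> u w; rewrite relE' /swap_edge => /orP[/del_edge_sub/Eg //|].
    have /andP[_ w1] := EW _ _ e1; have /andP[_ w2] := EW _ _ e2.
    by case/orP=> /andP[/eqP -> /eqP ->]; rewrite inducedE w1 w2 // gs.
  by apply: k_connected_sub ksw => u w; rewrite relE'.
have PhiU f q F : (forall z, 0 <= f z) -> Phi f (q |: F) <= f (pos q.1 - pos q.2) + Phi f F.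
  move=> f0; have [qF|qF] := boolP (q \in F).
    by rewrite (setUidPr _) ?sub1set // lerDr.
  by rewrite /Phi big_setU1.
have Phi' f : (forall z, 0 <= f z) -> (forall z, f (- z) = f z) ->
    Phi f E' <= Phi f E - 2 * f (pos u1 - pos v) + 2 * f (pos u1 - pos u2).
  move=> f0 fN; rewrite (PhiD f v u1 fN e1).
  have := PhiU f (u1, u2) ((u2, u1) |: D v u1) f0; have := PhiU f (u2, u1) (D v u1) f0.
  rewrite /= -/E' -(opprB (pos u1) (pos u2)) -(opprB (pos u1) (pos v)) !fN.
  by move=> ? ?; lra.
have [m1 m2] := Emin _ cE'.
have s1 := Phi' (@sqnorm R) sq0 sqnormN; have s2 := Phi' dy dy0 dyN.
case: closer => [lt|[eqn lt]]; first by move: m1 s1 lt; clear; lra.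
have PE : Phi (@sqnorm R) E' = Phi (@sqnorm R) E.
  by apply/eqP; rewrite eq_le m1 andbT; move: s1 eqn; clear; lra.
have {}lt : dy (pos u1 - pos u2) < dy (pos u1 - pos v) by [].
by move: (m2 PE) s2 lt; clear; lra.
Qed.

End DegreeFive.

(** * The hub graph *)

Section HubGraph.
Variables (V U : finType) (g : rel V) (code : V -> V -> nat).
Variables (ow : U -> V) (ly : U -> nat) (slot : V -> nat -> U).
Hypotheses (g_sym : symmetric g) (g_irr : irreflexive g).
Hypothesis codeE : forall u v, (code u v != 0) = g u v.
Hypothesis code_lt : forall u v, (code u v < 9)%N.
Hypothesis code_clique : forall u v w,
  g u v -> code u v = code u w -> v != w -> g v w.
Hypothesis ow_slot : forall v j, (j < 9)%N -> ow (slot v j) = v.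
Hypothesis ly_slot : forall v j, (j < 9)%N -> ly (slot v j) = j.
Hypothesis slotK : forall x, slot (ow x) (ly x) = x.
Hypothesis ly_lt : forall x, (ly x < 9)%N.

Definition hub_link : rel U := [rel x y | (ly x == 0) &&
  (if ly y == 0 then code (ow x) (ow y) != 0
   else (ow x == ow y) || (code (ow y) (ow x) == ly y))].

Definition hub_adj : rel U := [rel x y | hub_link x y || hub_link y x].

Definition emb v := slot v 0.

Lemma ow_emb v : ow (emb v) = v. Proof. exact: ow_slot. Qed.
Lemma ly_emb v : ly (emb v) = 0. Proof. exact: ly_slot. Qed.
Lemma emb_ow x : ly x = 0 -> emb (ow x) = x.
Proof. by move=> l0; rewrite /emb -l0 slotK. Qed.
Lemma emb_inj : injective emb.
Proof. by move=> u v E; rewrite -(ow_emb u) E ow_emb. Qed.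

Lemma hub_adj_sym : symmetric hub_adj.
Proof. by move=> x y; rewrite /hub_adj /= orbC. Qed.

Lemma hub_adj_irr : irreflexive hub_adj.
Proof.
move=> x; rewrite /hub_adj /= orbb /hub_link /=.
by case: eqP => // l0; rewrite codeE g_irr.
Qed.

Lemma hub_adj_emb x y : ly x = 0 -> ly y = 0 -> hub_adj x y = g (ow x) (ow y).
Proof.
move=> lx lly; rewrite /hub_adj /hub_link /= lx lly /= !codeE.
by rewrite (g_sym (ow y)) orbb.
Qed.

Lemma hub_adj_hub x y : ly y != 0 -> hub_adj x y ->
  ly x = 0 /\ ((ow x == ow y) || (code (ow y) (ow x) == ly y)).
Proof.
rewrite /hub_adj /hub_link /= => /negPf ->; rewrite orbF.
by case/andP=> /eqP.
Qed.

(** Two steps through a hub thus project to an edge of [g] or to no step at all. *)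
Lemma hub_clique x y z : ly y != 0 -> hub_adj x y -> hub_adj y z ->
  [/\ ly x = 0, ly z = 0 & ow x = ow z \/ g (ow x) (ow z)].
Proof.
move=> ny axy; rewrite hub_adj_sym => azy.
have [lx qx] := hub_adj_hub ny axy; have [lz qz] := hub_adj_hub ny azy.
split=> //; have [|ne] := eqVneq (ow x) (ow z); [by left | right].
have gq w : code (ow y) w = ly y -> g (ow y) w by rewrite -codeE => ->.
case/orP: qx => /eqP qx; case/orP: qz => /eqP qz.
- by rewrite qx qz eqxx in ne.
- by rewrite qx; apply: gq.
- by rewrite g_sym qz; apply: gq.
by apply: (code_clique (gq _ qx)); rewrite // qx qz.
Qed.

(** * From paths of the hub graph to connectivity in the original graph *)

Section Soundness.
Variables (F : rel U) (D : {set V}) (k : nat).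
Hypotheses (F_sym : symmetric F) (F_sub : subrel F hub_adj).

(** The threshold is two because each edge carries half the weight of its end: a node taken here is
    paid in full, and interior nodes of paths qualify. *)
Definition used := [set v | (v \notin D) && (1 < #|[set y | F (emb v) y]|)%N].

Lemma interior_degree s t p y : path F s (rcons p t) -> uniq (s :: rcons p t) ->
  y \in p -> (1 < #|[set z | F y z]|)%N.
Proof.
move=> pp up /splitPr py; case: py pp up => p1 p2.
rewrite rcons_cat rcons_cons cat_path /= => /and3P[_ F1 F2] /andP[s1 u2].
apply/card_gt1P; exists (last s p1), (head t p2).
rewrite !inE F_sym F1; split=> //; first by case: p2 F2 {s1 u2} => [|z p2] /= /andP[].
apply: contraL (mem_last s p1) => /eqP ->.
have hd : head t p2 \in rcons p2 t by case: (p2) => [|z q] /=; rewrite mem_head.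
rewrite inE negb_or; apply/andP; split.
  by apply: contraNneq s1 => <-; rewrite mem_cat inE hd !orbT.
move: u2; rewrite cat_uniq => /and3P[_ /hasPn H _].
by apply: H; rewrite inE hd orbT.
Qed.

(** A hub is skipped together with the step out of it, so two entries of the list may disappear at
    once; hence the induction on its length. *)
Lemma project_path (W : {set V}) t : t \in W -> forall p z, ly z = 0 -> ow z \in W ->
  path F z (rcons p (emb t)) -> (forall y, y \in p -> ly y = 0 -> ow y \in W) ->
  connect (induced g W) (ow z) t.
Proof.
move=> tW p; have [N] := ubnP (size p); elim: N p => // N IH [|y p] /= leN z lz zW.
  rewrite andbT => /F_sub; rewrite hub_adj_emb ?ly_emb // ow_emb => gzt _.
  by apply: connect1; rewrite inducedE zW tW.
case/andP=> Fzy pp inW; have [ly0|nly] := eqVneq (ly y) 0.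
  have yW : ow y \in W by apply: inW; rewrite ?mem_head.
  apply: (@connect_trans _ _ (ow y)).
    by apply: connect1; rewrite inducedE zW yW -hub_adj_emb // F_sub.
  by apply: (IH p) => // y' y'p; apply: inW; rewrite inE y'p orbT.
have step y2 : F y y2 -> ow y2 \in W ->
    ly y2 = 0 /\ connect (induced g W) (ow z) (ow y2).
  move=> Fy y2W; have [_ l2 c2] := hub_clique nly (F_sub Fzy) (F_sub Fy).
  split=> //; case: c2 => [-> //|gz].
  by apply: connect1; rewrite inducedE zW y2W.
case: p leN pp inW => [|y2 p] leN /= /andP[Fy pp] inW.
  by have := step _ Fy; rewrite ow_emb => /(_ tW) [].
have [_ l2 _] := hub_clique nly (F_sub Fzy) (F_sub Fy).
have y2W : ow y2 \in W by apply: inW; rewrite // !inE eqxx orbT.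
have [_ c2] := step _ Fy y2W; apply: connect_trans c2 _.
apply: (IH p) => //; first by move: leN => /=; lia.
by move=> y' y'p; apply: inW; rewrite !inE y'p !orbT.
Qed.

(** A node of [Y] has one copy in layer 0 and so blocks at most one of the [k] disjoint paths. Hubs
    on a free path may belong to [Y], since they vanish in the projection. *)
Lemma used_connect s t (Y : {set V}) : s \in D -> t \in D -> s \notin Y -> t \notin Y ->
  disjoint_paths F k (emb s) (emb t) -> (#|Y| < k)%N ->
  connect (induced g ((D :|: used) :\: Y)) s t.
Proof.
move=> sD tD sY tY [p [pw _ pd]] ltY.
have [i noY] : exists i, forall y, y \in p i -> ly y = 0 -> ow y \notin Y.
  apply: contrapT => H.
  have /choice[f fP] : forall i, exists y, [/\ y \in p i, ly y = 0 & ow y \in Y].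
    move=> i; apply: contrapT => H'; apply: H; exists i => y yp ly0.
    by apply/negP => yY; apply: H'; exists y.
  have inj : injective (fun i => ow (f i)).
    move=> i j E; apply/eqP/negPn/negP => /pd/pred0P/(_ (f i)) /=.
    have [fi li _] := fP i; have [fj lj _] := fP j.
    by rewrite fi -(emb_ow li) E (emb_ow lj) fj.
  have : (k <= #|Y|)%N.
    rewrite -[k]card_ord -(card_imset _ inj) subset_leq_card //.
    by apply/subsetP => _ /imsetP[i _ ->]; case: (fP i).
  by rewrite leqNgt ltY.
have [pp up] := pw i.
rewrite -(ow_emb s); apply: (project_path _ _ _ pp) => //.
- by rewrite !inE tD tY.
- by rewrite ly_emb.
- by rewrite ow_emb !inE sD sY.
move=> y yp ly0; rewrite !inE noY //=; case: (boolP (ow y \in D)) => //= _.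
by rewrite (emb_ow ly0); apply: interior_degree pp up yp.
Qed.

End Soundness.

(** * Lifting [k]-connectivity to the hub graph with small degrees *)

Section Completeness.
Variables (D W : {set V}) (k : nat).
Hypothesis DW : D \subset W.

(** A cut [X] of the hub graph becomes a cut [Y] of [E] that is no larger: each deleted node is
    charged to its owner, except hubs owned by nodes of [D], which are ignored. What remains is to
    lift a single edge whose ends are both uncharged. *)
Lemma disjoint_paths_lift (E : rel V) (F : rel U) s t : symmetric E ->
  k_connected E k W -> s \in D -> t \in D -> s != t ->
  F (emb s) (emb t) = E s t ->
  (forall (X : {set U}) u w, E u w -> u \in W -> w \in W ->
     (forall x, x \in X -> ly x = 0 \/ ow x \notin D -> (u != ow x) && (w != ow x)) ->
     ~~ ((u == s) && (w == t) || (u == t) && (w == s)) ->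
     connect (induced (del_edge F (emb s) (emb t)) (~: X)) (emb u) (emb w)) ->
  disjoint_paths F k (emb s) (emb t).
Proof.
move=> Es kE sD tD nst FE lift.
have neq : emb s != emb t by apply: contra nst => /eqP/emb_inj ->.
apply: disjoint_pathsP => // X sX tX ltX.
pose Y := ow @: [set x in X | (ly x == 0) || (ow x \notin D)].
have leY : (#|Y| <= #|X|)%N.
  by apply: leq_trans (leq_imset_card _ _) _; apply/subset_leq_card/subsetP => x; rewrite inE => /andP[].
have inY v : v \in D -> emb v \notin X -> v \in W :\: Y.
  move=> vD vX; rewrite inE (subsetP DW) // andbT; apply/negP => /imsetP[x].
  rewrite inE => /andP[xX lx] vx.
  move: lx; rewrite -vx vD orbF => /eqP lx.
  by move: vX; rewrite vx (emb_ow lx) xX.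
have ltY : (#|Y| + E s t < k)%N by rewrite -FE; apply: leq_ltn_trans ltX; rewrite leq_add2r.
have := k_connected_del_edge Es kE (inY s sD sX) (inY t tD tX) nst ltY.
have gen a b : connect (induced (del_edge E s t) (W :\: Y)) a b ->
    connect (induced (del_edge F (emb s) (emb t)) (~: X)) (emb a) (emb b).
  apply: (connect_indP (P := fun b => connect _ (emb a) (emb b))) => [//|u w cu].
  rewrite inducedE !in_setD => /and3P[/andP[uY uW] /andP[wY wW] /andP[Euw no]].
  apply: connect_trans cu (lift X u w Euw uW wW _ no) => x xX xl.
  have xY : ow x \in Y.
    by apply/imsetP; exists x; rewrite // inE xX; case: xl => [->|->]; rewrite ?orbT.
  by apply/andP; split; [apply: contraNneq uY => -> | apply: contraNneq wY => ->].
exact: gen.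
Qed.

Lemma direct_complete (E : rel V) : symmetric E -> subrel E (induced g W) ->
  k_connected E k W ->
  let F : rel U := [rel x y | [&& ly x == 0, ly y == 0 & E (ow x) (ow y)]] in
  [/\ symmetric F, subrel F hub_adj,
    {in D &, forall s t, s != t -> disjoint_paths F k (emb s) (emb t)},
    (forall v, v \notin W -> [set y | F (emb v) y] = set0) &
    (forall v, #|[set y | F (emb v) y]| <= #|[set u | E v u]|)%N].
Proof.
move=> Es Eg kE F; split.
- by move=> x y; rewrite /F /= Es; case: (ly x == 0); case: (ly y == 0).
- move=> x y /and3P[/eqP lx /eqP lly /Eg/and3P[_ _ gxy]].
  by rewrite hub_adj_emb.
- move=> s t sD tD nst; apply: (disjoint_paths_lift Es kE) => //.
    by rewrite /F /= !ow_emb !ly_emb.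
  move=> X u w Euw uW wW nX no; apply: connect1; rewrite inducedE !in_setC.
  have out v : (forall x, x \in X -> ly x = 0 \/ ow x \notin D -> v != ow x) -> emb v \notin X.
    by move=> H; apply/negP => vX; have := H _ vX (or_introl (ly_emb v)); rewrite ow_emb eqxx.
  rewrite !out; last 2 first.
  + by move=> x xX xl; case/andP: (nX x xX xl).
  + by move=> x xX xl; case/andP: (nX x xX xl).
  by rewrite /del_edge /= /F /= !ow_emb !ly_emb Euw !(inj_eq emb_inj) no.
- move=> v vW; apply/setP => y; rewrite !inE; apply/negP => /and3P[_ _ /Eg/and3P[+ _ _]].
  by rewrite ow_emb (negPf vW).
move=> v; rewrite -(card_imset _ emb_inj); apply/subset_leq_card/subsetP => y.
rewrite inE /F /= ow_emb => /and3P[_ /eqP lly Evy]; apply/imsetP; exists (ow y).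
  by rewrite inE.
by rewrite emb_ow.
Qed.

Variables (K : rel V) (par : V -> V).
Hypothesis kK : k_connected (keep_edges g D K) k W.
Hypothesis K_par : forall u v, K u v -> [/\ g u v, u \in W :\: D, v \in W :\: D &
  par u = v \/ par v = u].

(** Only nodes outside [D] use their hubs; these collect the owner, its neighbours in [D] and its
    children in the forest. An edge leaving [D] or a forest edge is thus replaced by a detour
    through a hub of an end outside [D]. *)
Definition star_link : rel U := [rel x y | (ly x == 0) &&
  (if ly y == 0 then [&& ow x \in D, ow y \in D & g (ow x) (ow y)]
   else (ow y \in W :\: D) && ((ow x == ow y) || (code (ow y) (ow x) == ly y) &&
     ((ow x \in D) || (ow x \in W :\: D) && (par (ow x) == ow y))))].

Definition star_edges : rel U := [rel x y | star_link x y || star_link y x].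

Lemma star_edges_sym : symmetric star_edges.
Proof. by move=> x y; rewrite /star_edges /= orbC. Qed.

Lemma star_link_sub x y : star_link x y -> hub_link x y.
Proof.
rewrite /star_link /hub_link /= => /andP[-> /=]; case: ifP => _.
  by rewrite codeE => /and3P[].
by case/andP=> _ /orP[->|/andP[->]]; rewrite ?orbT.
Qed.

(** Nine is eight hubs of [v] plus one hub of its parent; within layer 0 a node outside [D] gets no
    edge. *)
Lemma star_degree v : v \in W :\: D -> (#|[set y | star_edges (emb v) y]| <= 9)%N.
Proof.
move=> vC; have vD : v \notin D by move: vC; rewrite inE => /andP[].
pose Hs := [set slot v j.+1 | j : 'I_8].
have cH : (#|Hs| <= 8)%N by rewrite -[8]card_ord leq_imset_card.
apply: (@leq_trans #|slot (par v) (code (par v) v) |: Hs|); last first.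
  by rewrite cardsU1; case: (_ \notin _); lia.
apply/subset_leq_card/subsetP => y; rewrite inE /star_edges /star_link /=.
rewrite !ly_emb !ow_emb eqxx !(negPf vD) /= ?andbF /=.
have hub : ly y != 0 -> v = ow y -> y \in Hs.
  move=> ny E; have lt := ly_lt y; have lt8 : ((ly y).-1 < 8)%N by lia.
  apply/imsetP; exists (Ordinal lt8) => //=; rewrite prednK ?lt0n // E.
  by rewrite slotK.
have [l0|nl] := eqVneq (ly y) 0 => /=; first by rewrite ?andbF.
rewrite ?andbF ?orbF in_setU1 => /andP[_ /orP[/eqP E|/andP[/eqP c /andP[_ /eqP p]]]].
  by rewrite hub // orbT.
by rewrite p c slotK eqxx.
Qed.

Lemma star_degree0 v : v \notin W -> [set y | star_edges (emb v) y] = set0.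
Proof.
move=> vW; have vD : v \notin D by apply: contra vW; apply: (subsetP DW).
apply/setP => y; rewrite !inE /star_edges /star_link /= !ly_emb !ow_emb eqxx !inE.
rewrite (negPf vW) (negPf vD) /= !andbF /= orbF.
by case: (ly y == 0) => //=; apply/negP => /andP[/andP[_ yW] /orP[/eqP E|]];
  rewrite ?andbF // -E (negPf vW) in yW.
Qed.

Lemma star_complete :
  [/\ symmetric star_edges, subrel star_edges hub_adj &
    {in D &, forall s t, s != t -> disjoint_paths star_edges k (emb s) (emb t)}].
Proof.
split; first exact: star_edges_sym.
  by move=> x y /orP[] /star_link_sub h; rewrite /hub_adj /= h ?orbT.
move=> s t sD tD nst.
have Ks u v : K u v || K v u -> g u v.
  by case/orP => /K_par[]; rewrite // g_sym.
pose K' := [rel u v | K u v || K v u].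
have K's : symmetric K' by move=> u v; rewrite /K' /= orbC.
have Es := keep_edges_sym D g_sym K's.
have kE : k_connected (keep_edges g D K') k W.
  apply: k_connected_sub kK => u v; rewrite /keep_edges /= => /andP[-> /or3P[->|->|->]];
    by rewrite ?orbT.
apply: (disjoint_paths_lift Es kE) => //.
  rewrite /star_edges /star_link /keep_edges /= !ly_emb !ow_emb eqxx sD tD /=.
  by rewrite (g_sym t) orbb andbT.
move=> X u w /andP[guw DK] uW wW nX no.
pose G := induced (del_edge star_edges (emb s) (emb t)) (~: X).
have Gs : connect_sym G := sym_connect_sym (induced_sym _ (del_edge_sym _ _ star_edges_sym)).
have out v : v = u \/ v = w -> forall x, x \in X -> ly x = 0 \/ ow x \notin D -> v != ow x.
  by move=> vuw x xX xl; case/andP: (nX x xX xl) => ? ?; case: vuw => ->.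
have embX v : v = u \/ v = w -> emb v \notin X.
  move=> vuw; apply/negP => vX.
  by have := out v vuw _ vX (or_introl (ly_emb v)); rewrite ow_emb eqxx.
have hubX v j : v = u \/ v = w -> v \notin D -> (j < 9)%N -> slot v j \notin X.
  move=> vuw vD lj; apply/negP => vX; have := out v vuw _ vX.
  by rewrite ow_slot // eqxx => /(_ (or_intror vD)).
have [/andP[uD wD]|nDD] := boolP ((u \in D) && (w \in D)).
  apply: connect1; rewrite inducedE !in_setC !embX; [|by right|by left].
  by rewrite /del_edge /= !(inj_eq emb_inj) no /star_edges /star_link /= !ly_emb !ow_emb uD wD guw.
(* Through a hub of the end [b], which must lie outside [D]. *)
have via a b : (a = u /\ b = w) \/ (a = w /\ b = u) -> b \in W :\: D -> g b a ->
    (a \in D) || (a \in W :\: D) && (par a == b) -> connect G (emb a) (emb b).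
  move=> ab bC gba Da.
  have [ha hb] : (a = u \/ a = w) /\ (b = u \/ b = w).
    by case: ab => -[-> ->]; split; [left|right|right|left].
  have bD : b \notin D by move: bC; rewrite inE => /andP[].
  have lt := code_lt b a; have nz : code b a != 0 by rewrite codeE.
  pose h := slot b (code b a); have hX : h \notin X by apply: hubX.
  have hne v : emb v != h by apply: contra nz => /eqP/(congr1 ly); rewrite ly_emb ly_slot // => <-.
  have Gh x : emb x \notin X -> star_link (emb x) h -> G (emb x) h.
    move=> xX sl; rewrite /G inducedE !in_setC xX hX /del_edge /=.
    rewrite /star_edges /= sl /= (eq_sym h) (eq_sym h).
    by rewrite !(negPf (hne _)) !andbF.
  apply: (@connect_trans _ _ h).
    apply/connect1/Gh; first exact: embX.
    by rewrite /star_link /= ly_emb !ow_slot ?ly_slot // (negPf nz) bC !eqxx Da /= ?orbT.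
  rewrite Gs; apply/connect1/Gh; first exact: embX.
  by rewrite /star_link /= ly_emb !ow_slot ?ly_slot // (negPf nz) bC !eqxx.
have gwu : g w u by rewrite g_sym.
have [uD|uD] := boolP (u \in D).
  have wD : w \notin D by move: nDD; rewrite uD.
  by apply: via; rewrite ?uD //; [left | rewrite inE wD wW].
have [wD|wD] := boolP (w \in D).
  by rewrite -/G Gs; apply: via; rewrite ?wD //; [right | rewrite inE uD uW].
have uC : u \in W :\: D by rewrite inE uD uW.
have wC : w \in W :\: D by rewrite inE wD wW.
have pp : par u = w \/ par w = u.
  move: DK; rewrite (negPf uD) (negPf wD) /= => /orP[] /K_par[] //.
  by move=> _ _ _ [->|->]; [right|left].
case: pp => E.
  by apply: via => //; [left | rewrite uC E eqxx orbT].
by rewrite -/G Gs; apply: via => //; [right | rewrite wC E eqxx orbT].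
Qed.

End Completeness.
End HubGraph.

(** * The hub graph of a unit disk graph as an edge-weighted instance *)

Section Instance.
Variable R : realType.
Local Open Scope ring_scope.

(* 0 for non-adjacent nodes, otherwise one plus the octant of [v] as seen from
   [u]; two nodes in the same octant are at distance at most one. *)
Definition octant_code (px py : nat -> R) (u v : nat) : nat :=
  let dx := px v - px u in let dy := py v - py u in
  if (u != v) && (dx * dx + dy * dy <= 1) then
    (1 + (0 <= dx)%R + 2 * (0 <= dy)%R + 4 * (dx * dx <= dy * dy)%R)%N
  else 0%N.

(* Node [x < 9 * n] of the hub graph: its owner is [x %% n], and [x %/ n] is 0 for
   the owner itself and [j] for the owner's hub with octant code [j]. *)
Definition hubN (n : nat) (cd : nat -> nat -> nat) (x y : nat) : bool :=
  let lk x y := ((x %/ n == 0) && (if y %/ n == 0 then cd (x %% n) (y %% n) != 0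
    else (x %% n == y %% n) || (cd (y %% n) (x %% n) == y %/ n)))%N in
  lk x y || lk y x.

Definition termN (n : nat) (D : pred nat) (x : nat) : bool :=
  ((x %/ n == 0)%N && D (x %% n)%N).

Definition shareN (n : nat) (D : pred nat) (pc : nat -> R) (x : nat) : R :=
  if (x %/ n == 0)%N && ~~ D (x %% n)%N then pc (x %% n)%N / 2 else 0.

(** Both points have the same dominant coordinate, say the second. Then [y * y'] is at least the
    smaller of the two squares, so [2 * (y * y')] absorbs the whole squared length of one point, and
    that of the other is at most one. *)
Lemma octant_dist (x y x' y' : R) : (0 <= x) = (0 <= x') -> (0 <= y) = (0 <= y') ->
  (x * x <= y * y) = (x' * x' <= y' * y') ->
  x * x + y * y <= 1 -> x' * x' + y' * y' <= 1 ->
  (x' - x) * (x' - x) + (y' - y) * (y' - y) <= 1.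
Proof.
have same (a b : R) : (0 <= a) = (0 <= b) -> 0 <= a * b /\ (a * a <= a * b \/ b * b <= a * b).
  have [a0|a0] := leP 0 a; have [b0|b0] := leP 0 b => // _.
    by split; [nra | have [le|lt] := leP a b; [left|right]; nra].
  by split; [nra | have [le|lt] := leP a b; [right|left]; nra].
move=> /same[xx cx] /same[yy cy] E n1 n2.
have [le|lt] := leP (x * x) (y * y); rewrite le_eqVlt in E.
  have le' : x' * x' <= y' * y' by rewrite -E -le_eqVlt.
  by case: cy => ?; lra.
have lt' : y' * y' < x' * x' by rewrite ltNge -E -le_eqVlt -ltNge.
by case: cx => ?; lra.
Qed.

Lemma sum_edges (N : nat) (F : rel 'I_N) (sh : 'I_N -> R) :
  symmetric F -> irreflexive F ->
  \sum_(u < N) \sum_(v < N | (u < v)%N && F u v) (sh u + sh v) =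
  \sum_(u < N) sh u *+ #|[set v | F u v]|.
Proof.
move=> Fs Fi.
transitivity (\sum_(u < N) (\sum_(v < N | (u < v)%N && F u v) sh u +
    \sum_(v < N | (v < u)%N && F u v) sh u)).
  rewrite [RHS]big_split /=; under eq_bigr => u _ do rewrite big_split /=.
  rewrite big_split /=; congr (_ + _).
  rewrite (exchange_big_dep xpredT) //=; apply: eq_bigr => u _.
  by apply: eq_bigl => v; rewrite Fs.
apply: eq_bigr => u _; rewrite -sumr_const.
rewrite [RHS](bigID (fun v : 'I_N => (u < v)%N)) /=; congr (_ + _).
  by apply: eq_bigl => v; rewrite inE andbC.
apply: eq_bigl => v; rewrite inE -leqNgt [RHS]andbC.
have [->|ne] := eqVneq v u; first by rewrite Fi !andbF.
by rewrite ltn_neqAle -[(v == u :> nat)]/(v == u) ne.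
Qed.

Variables (G : wudg R) (D : {set 'I_(un G)}).
Local Notation n := (un G).
Local Notation g := (@uadj R G).

Definition padx := pad 0 (fun v : 'I_n => (upos v).1).
Definition pady := pad 0 (fun v : 'I_n => (upos v).2).
Definition padc := pad 0 (fun v : 'I_n => uweight v).
Definition padD : pred nat := pad false (fun v : 'I_n => v \in D).

Lemma pad_ord (A : Type) (a : A) (f : 'I_n -> A) (v : 'I_n) : pad a f v = f v.
Proof. by rewrite /pad valK. Qed.

Definition code (u v : 'I_n) := octant_code padx pady u v.

Lemma uadjE u v : g u v = (u != v) && (sqnorm (upos u - upos v) <= 1).
Proof.
rewrite /uadj /=; congr (_ && _); rewrite /edist -[X in _ <= X]sqrtr1.
by rewrite ler_sqrt // ltr01.
Qed.

Lemma uadj_sym : symmetric g.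
Proof. by move=> u v; rewrite !uadjE eq_sym -sqnormN opprB. Qed.

Lemma uadj_irr : irreflexive g.
Proof. by move=> u; rewrite uadjE eqxx. Qed.

Lemma codeE u v : (code u v != 0%N) = g u v.
Proof.
rewrite /code /octant_code /padx /pady !pad_ord uadj_sym uadjE /sqnorm /= (eq_sym v u) -!expr2.
by case: (_ && _).
Qed.

Lemma code_lt u v : (code u v < 9)%N.
Proof.
rewrite /code /octant_code; case: ifP => // _.
by case: (_ <= _); case: (_ <= _); case: (_ <= _).
Qed.

Lemma code_clique u v w : g u v -> code u v = code u w -> v != w -> g v w.
Proof.
move=> guv E vw; have guw : g u w by rewrite -codeE -E codeE.
move: E; rewrite /code /octant_code /padx /pady !pad_ord.
have dE a b : g a b -> (val a != val b) && (((upos b).1 - (upos a).1) * ((upos b).1 - (upos a).1) +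
    ((upos b).2 - (upos a).2) * ((upos b).2 - (upos a).2) <= 1).
  by rewrite uadj_sym uadjE /sqnorm /= (eq_sym b a) -!expr2.
rewrite (dE _ _ guv) (dE _ _ guw) => E.
have /andP[_ d1] := dE _ _ guv; have /andP[_ d2] := dE _ _ guw.
rewrite uadj_sym uadjE (eq_sym w v) vw /= /sqnorm /= !expr2.
have -> : (upos w).1 - (upos v).1 = ((upos w).1 - (upos u).1) - ((upos v).1 - (upos u).1) by ring.
have -> : (upos w).2 - (upos v).2 = ((upos w).2 - (upos u).2) - ((upos v).2 - (upos u).2) by ring.
apply: octant_dist => //; move: E;
  by do 6 case: (_ <= _).
Qed.

Lemma nodes_gt0 (x : 'I_(9 * n)) : (0 < n)%N.
Proof. by have := leq_ltn_trans (leq0n x) (ltn_ord x); rewrite muln_gt0. Qed.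

Lemma own_lt (x : 'I_(9 * n)) : (x %% n < n)%N.
Proof. by rewrite ltn_mod (nodes_gt0 x). Qed.

Definition own (x : 'I_(9 * n)) : 'I_n := Ordinal (own_lt x).

Lemma slot_lt (v : 'I_n) j : (v + (j %% 9) * n < 9 * n)%N.
Proof.
have := ltn_ord v; have : (j %% 9 <= 8)%N by rewrite -ltnS ltn_mod.
by move=> /(leq_mul (leqnn n)); rewrite mulnC; lia.
Qed.

Definition slot (v : 'I_n) (j : nat) : 'I_(9 * n) := Ordinal (slot_lt v j).
Definition lay (x : 'I_(9 * n)) : nat := (x %/ n)%N.

Lemma own_slot v j : (j < 9)%N -> own (slot v j) = v.
Proof. by move=> j9; apply: val_inj; rewrite /= addnC modnMDl modn_small. Qed.

Lemma lay_slot v j : (j < 9)%N -> lay (slot v j) = j.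
Proof.
move=> j9; have n0 : (0 < n)%N by apply: leq_ltn_trans (ltn_ord v).
by rewrite /lay /= addnC divnMDl // divn_small // addn0 modn_small.
Qed.

Lemma lay_lt x : (lay x < 9)%N.
Proof.
by rewrite /lay ltn_divLR // (nodes_gt0 x).
Qed.

Lemma slotK x : slot (own x) (lay x) = x.
Proof.
apply: val_inj; rewrite /= (modn_small (lay_lt x)).
by rewrite addnC -divn_eq.
Qed.

Definition hubG (x y : 'I_(9 * n)) := hubN n (octant_code padx pady) x y.

Lemma hubGE : hubG =2 hub_adj code own lay.
Proof. by move=> x y; rewrite /hubG /hubN /hub_adj /hub_link /= -!val_eqE. Qed.

Definition share (x : 'I_(9 * n)) := shareN n padD padc x.

Lemma share_ge0 x : 0 <= share x.
Proof.
rewrite /share /shareN; case: ifP => // _; rewrite divr_ge0 // /padc /pad.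
by case: insubP => //= v _ _; apply/ltW/uweight_gt0.
Qed.

Lemma hubG_sym : symmetric hubG.
Proof. by move=> x y; rewrite !hubGE hub_adj_sym. Qed.

Lemma hubG_irr : irreflexive hubG.
Proof. by move=> x; rewrite hubGE; apply: hub_adj_irr; [exact: uadj_irr | exact: codeE]. Qed.

Definition hub_inst : skcs_inst R :=
  @SkCSInst R (9 * n)%N hubG (fun x y => share x + share y)
    [set x | termN n padD (val x)] hubG_sym hubG_irr
    (fun x y _ => addrC _ _) (fun x y _ => addr_ge0 (share_ge0 x) (share_ge0 y)).

Local Notation emb := (emb slot).

Lemma termP x : reflect (exists2 v, v \in D & x = emb v) (x \in sterm hub_inst).
Proof.
rewrite inE /termN; apply: (iffP andP) => [[/eqP l0]|[v vD ->]].
  rewrite -[(_ %% _)%N]/(val (own x)) /padD pad_ord => oD.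
  by exists (own x) => //; rewrite (emb_ow slotK l0).
rewrite -[(_ %% _)%N]/(val (own (emb v))) /padD pad_ord own_slot //.
by rewrite -[(_ %/ _)%N]/(lay (emb v)) lay_slot.
Qed.

Lemma share_emb v : share (emb v) = if v \in D then 0 else uweight v / 2.
Proof.
rewrite /share /shareN -[(_ %% _)%N]/(val (own (emb v))) -[(_ %/ _)%N]/(lay (emb v)).
by rewrite own_slot // lay_slot // /padD /padc !pad_ord; case: (v \in D).
Qed.

(** Double counting over edge ends; hubs and copies of [D] have share 0, so only copies of nodes
    outside [D] contribute. *)
Lemma cost_degree (F : rel 'I_(9 * n)) : symmetric F -> subrel F hubG ->
  skcs_cost (I := hub_inst) F =
  \sum_(v | v \notin D) uweight v / 2 *+ #|[set y | F (emb v) y]|.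
Proof.
move=> Fs Fsub; have Fi : irreflexive F.
  by move=> x; apply/negP => /Fsub; rewrite hubG_irr.
rewrite /skcs_cost /= (sum_edges share Fs Fi) (bigID (fun x => lay x == 0%N)) /=.
rewrite [X in _ + X]big1 ?addr0; last first.
  by move=> x /negPf l0; rewrite /share /shareN -[(_ %/ _)%N]/(lay x) l0 mul0rn.
rewrite (reindex_onto emb own) /=; last by move=> x /eqP l0; exact: (emb_ow slotK l0).
rewrite (eq_bigl xpredT); last by move=> v; rewrite lay_slot // own_slot // !eqxx.
rewrite (bigID (fun v => v \in D)) /= big1 ?add0r; last first.
  by move=> v vD; rewrite share_emb vD mul0rn.
by apply: eq_bigr => v /negPf vD; rewrite share_emb vD.
Qed.

Variables (k m : nat).
Hypotheses (km : (k <= m)%N).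

Lemma dominating_nbrs v : m_fold_dominating g m D -> v \notin D ->
  (k <= #|[set u in D | g v u]|)%N.
Proof. by move=> domD vD; apply: leq_trans km (domD v vD). Qed.

Definition rounded (F : rel 'I_(9 * n)) := D :|: used slot F D.

(** The second clause is [k_connected] without its size condition, which may fail when [D] has only
    [k] nodes; an added outsider repairs this later. *)
Lemma rounded_sound (F : rel 'I_(9 * n)) : m_fold_dominating g m D ->
  skcs_feasible k (I := hub_inst) F ->
  [/\ m_fold_dominating g m (rounded F),
    (forall Y : {set 'I_n}, (#|Y| < k)%N -> connected_in g (rounded F :\: Y)) &
    set_weight (rounded F) <= set_weight D + skcs_cost (I := hub_inst) F].
Proof.
move=> domD [Fs Fsub Fk].
have Fsub' : subrel F (hub_adj code own lay) by move=> x y /Fsub; rewrite -hubGE.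
split.
- move=> v; rewrite inE negb_or => /andP[vD _]; apply: leq_trans (domD v vD) _.
  by apply/subset_leq_card/subsetP => u; rewrite !inE => /andP[-> ->].
- apply: (dominated_connected uadj_sym (subsetUl _ _)) => [Y ltY s t|v _ vD]; last first.
    exact: dominating_nbrs.
  rewrite !inE => /andP[sY sD] /andP[tY tD].
  have [->|nst] := eqVneq s t; first exact: connect0.
  apply: (used_connect uadj_sym codeE code_clique own_slot lay_slot slotK Fs Fsub') ltY => //.
  apply: Fk; [by apply/termP; exists s | by apply/termP; exists t |].
  by apply: contra nst => /eqP/(congr1 own); rewrite !own_slot // => ->.
rewrite cost_degree // /set_weight /rounded.
have -> : \sum_(v in D :|: used slot F D) uweight v =
    \sum_(v in D) uweight v + \sum_(v in used slot F D) uweight v.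
  rewrite (big_setID D) /=; congr (_ + _); apply: eq_bigl => v; rewrite !inE.
    by case: (v \in D); rewrite ?andbF.
  by case: (v \in D).
rewrite lerD2l [leRHS](bigID (fun v => v \in used slot F D)) /=.
apply: ler_wpDr.
  by apply: sumr_ge0 => v _; rewrite mulrn_wge0 // divr_ge0 // ltW // uweight_gt0.
rewrite [leRHS](eq_bigl (fun v => v \in used slot F D)); last first.
  by move=> v; rewrite inE; case: (v \in D).
apply: ler_sum => v; rewrite inE => /andP[_ deg].
have c0 := uweight_gt0 v.
apply: (@le_trans _ _ (uweight v / 2 *+ 2)); first by rewrite -mulr_natr divfK // pnatr_eq0.
by rewrite ler_wpMn2l // divr_ge0 // ltW.
Qed.

Lemma cost_bound (S : {set 'I_n}) (F : rel 'I_(9 * n)) d : symmetric F -> subrel F hubG ->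
  (forall v, v \notin D :|: S -> [set y | F (emb v) y] = set0) ->
  (forall v, v \in (D :|: S) :\: D -> (#|[set y | F (emb v) y]| <= d)%N) ->
  skcs_cost (I := hub_inst) F <= d%:R / 2 * set_weight S.
Proof.
move=> Fs Fsub F0 Fd; rewrite cost_degree // (bigID (fun v => v \in S)) /=.
rewrite [X in _ + X]big1 ?addr0; last first.
  by move=> v /andP[vD vS]; rewrite F0 ?cards0 ?mulr0n // inE negb_or vD.
rewrite /set_weight mulr_sumr [leRHS](bigID (fun v => v \notin D)) /=.
apply: ler_wpDr.
  by apply: sumr_ge0 => v _; rewrite mulr_ge0 ?divr_ge0 ?ler0n // ltW // uweight_gt0.
rewrite [leRHS](eq_bigl (fun v => (v \notin D) && (v \in S))); last by move=> v; rewrite andbC.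
apply: ler_sum => v /andP[vD vS]; have c0 := uweight_gt0 v.
have -> : d%:R / 2 * uweight v = uweight v / 2 *+ d by rewrite -mulr_natl; ring.
by rewrite ler_wpMn2l ?divr_ge0 ?ltW // Fd // !inE vD vS orbT.
Qed.

Lemma union_k_connected S : km_CDS g k m S -> k_connected g k (D :|: S).
Proof.
move=> [domS [ltS cS]]; split.
  by apply: leq_trans ltS (subset_leq_card (subsetUr _ _)).
move=> Y _; apply: (dominated_connected uadj_sym (subsetUr D S)) => [Z ltZ s t sZ tZ|v _ vS].
  have := k_connected_cut (conj ltS cS) ltZ sZ tZ.
  apply: connect_sub => a b; rewrite !inducedE !inE => /and3P[/andP[aZ aS] /andP[bZ bS] gab].
  by apply: connect1; rewrite inducedE !inE aZ aS bZ bS gab !orbT.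
by apply: leq_trans km (domS v vS).
Qed.

Lemma hub_optimum S : m_fold_dominating g m D -> km_CDS g k m S ->
  exists2 F, skcs_feasible k (I := hub_inst) F &
    skcs_cost (I := hub_inst) F <= 9 / 2 * set_weight S.
Proof.
move=> domD kS; have kW := union_k_connected kS; have DW := subsetUl D S.
have [|K [par [kK Kpar]]] := sparse_k_connected uadj_sym uadj_irr kW DW.
  by move=> v _ vD; apply: dominating_nbrs.
have [Fs Fsub Fk] := star_complete uadj_sym codeE code_lt own_slot lay_slot slotK DW kK Kpar.
have Fsub' : subrel (star_edges g code own lay D (D :|: S) par) hubG.
  by move=> x y /Fsub; rewrite hubGE.
exists (star_edges g code own lay D (D :|: S) par).
  split=> // x y /termP[s sD ->] /termP[t tD ->] nst; apply: Fk => //.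
  by apply: contra nst => /eqP ->.
apply: cost_bound => // v vW.
  exact: (star_degree0 _ _ own_slot lay_slot DW).
exact: (star_degree _ _ own_slot lay_slot slotK lay_lt DW).
Qed.

Lemma hub_optimum_two S : k = 2%N -> km_CDS g k m S ->
  exists2 F, skcs_feasible k (I := hub_inst) F &
    skcs_cost (I := hub_inst) F <= 5 / 2 * set_weight S.
Proof.
move=> k2 kS; have kW := union_k_connected kS; have DW := subsetUl D S.
rewrite k2 in kW; have [E [Es Eg kE dE]] := unit_disk_degree_five (@upos_inj R G) uadjE kW.
have [Fs Fsub Fk F0 Fd] := direct_complete uadj_sym codeE own_slot lay_slot slotK DW Es Eg kE.
set F := (X in symmetric X) in Fs Fsub Fk F0 Fd.
have Fsub' : subrel F hubG by move=> x y /Fsub; rewrite hubGE.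
exists F.
  split=> // x y /termP[s sD ->] /termP[t tD ->] nst; rewrite k2; apply: Fk => //.
  by apply: contra nst => /eqP ->.
by apply: cost_bound => // v _; apply: leq_trans (Fd v) (dE v).
Qed.

End Instance.

(** * Programs *)

Section Programs.
Variable R : realType.
Implicit Types (s : state R) (c p : cmd) (Q : state R -> Prop).

Section Renaming.
Variable f : nat -> nat.
Hypothesis f_inj : injective f.

Fixpoint nren (e : nexp) : nexp :=
  match e with
  | NConst n => NConst n
  | NGet a e1 e2 => NGet (f a) (nren e1) (nren e2)
  | NAdd e1 e2 => NAdd (nren e1) (nren e2)
  | NSub e1 e2 => NSub (nren e1) (nren e2)
  end.

Fixpoint rren (e : rexp) : rexp :=
  match e with
  | RZero => RZero
  | ROne => ROne
  | RGet a e1 e2 => RGet (f a) (nren e1) (nren e2)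
  | RAdd e1 e2 => RAdd (rren e1) (rren e2)
  | RSub e1 e2 => RSub (rren e1) (rren e2)
  | RMul e1 e2 => RMul (rren e1) (rren e2)
  | RDiv e1 e2 => RDiv (rren e1) (rren e2)
  end.

Fixpoint bren (b : bexp) : bexp :=
  match b with
  | NLe e1 e2 => NLe (nren e1) (nren e2)
  | RLe e1 e2 => RLe (rren e1) (rren e2)
  | BNot b1 => BNot (bren b1)
  | BAnd b1 b2 => BAnd (bren b1) (bren b2)
  end.

Fixpoint cren (c : cmd) : cmd :=
  match c with
  | Skip => Skip
  | NSet a e1 e2 e => NSet (f a) (nren e1) (nren e2) (nren e)
  | RSet a e1 e2 e => RSet (f a) (nren e1) (nren e2) (rren e)
  | Seq p q => Seq (cren p) (cren q)
  | If b p q => If (bren b) (cren p) (cren q)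
  | While b p => While (bren b) (cren p)
  end.

Definition renamed s0 s :=
  (forall a i j, nmem s (f a) i j = nmem s0 a i j) /\
  (forall a i j, rmem s (f a) i j = rmem s0 a i j).

Definition untouched s s' := forall a, (forall b, a <> f b) -> forall i j,
  nmem s' a i j = nmem s a i j /\ rmem s' a i j = rmem s a i j.

Lemma neval_ren s0 s e : renamed s0 s -> neval s (nren e) = neval s0 e.
Proof.
move=> [hn _]; elim: e => //= [a e1 -> e2 ->|e1 -> e2 ->|e1 -> e2 ->] //.
Qed.

Lemma reval_ren s0 s e : renamed s0 s -> reval s (rren e) = reval s0 e.
Proof.
move=> h; elim: e => //= [a e1 e2|e1 -> e2 ->|e1 -> e2 ->|e1 -> e2 ->|e1 -> e2 ->] //.
by rewrite !(neval_ren _ h) h.2.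
Qed.

Lemma beval_ren s0 s b : renamed s0 s -> beval s (bren b) = beval s0 b.
Proof.
move=> h; elim: b => //= [e1 e2|e1 e2|b1 -> //|b1 -> b2 ->] //.
  by rewrite !(neval_ren _ h).
by rewrite !(reval_ren _ h).
Qed.

Lemma upd_ren A (M M0 : nat -> nat -> nat -> A) a i j x :
  (forall a i j, M (f a) i j = M0 a i j) ->
  forall a' i' j', upd M (f a) i j x (f a') i' j' = upd M0 a i j x a' i' j'.
Proof. by move=> h a' i' j'; rewrite /upd (inj_eq f_inj) h. Qed.

Lemma upd_untouched A (M : nat -> nat -> nat -> A) a i j x a' i' j' :
  (forall b, a' <> f b) -> upd M (f a) i j x a' i' j' = M a' i' j'.
Proof. by move=> h; rewrite /upd; case: eqP => [/h|]. Qed.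

(** Programs cannot compute array names, so an injective renaming commutes with execution at the
    same running time. The clause [untouched] is the frame property that protects the data of the
    surrounding program. *)
Lemma exec_ren p s0 t s1 : exec p s0 t s1 -> forall s, renamed s0 s ->
  exists s', [/\ exec (cren p) s t s', renamed s1 s' & untouched s s'].
Proof.
elim=> {p s0 t s1} [s0|a e1 e2 e s0|a e1 e2 e s0|p q s0 s1 s2 t1 t2 _ IH1 _ IH2|
  b p q s0 s1 t _ IH|b p s0 nb|b p s0 s1 s2 t1 t2 hb _ IH1 _ IH2] s h.
- by exists s; split=> //; exact: exec_skip.
- eexists; split; first exact: exec_nset.
    rewrite !(neval_ren _ h); split=> /= [|a' i j]; last exact: h.2.
    by apply: upd_ren; exact: h.1.
  by move=> a' ha i j /=; rewrite upd_untouched.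
- eexists; split; first exact: exec_rset.
    rewrite !(neval_ren _ h) (reval_ren _ h); split=> /= [a' i j|]; first exact: h.1.
    by apply: upd_ren; exact: h.2.
  by move=> a' ha i j /=; rewrite upd_untouched.
- have [s' [x1 h1 u1]] := IH1 s h; have [s'' [x2 h2 u2]] := IH2 s' h1.
  exists s''; split=> //; first exact: exec_seq x1 x2.
  by move=> a ha i j; have [-> ->] := u2 a ha i j; exact: u1.
- have [s' [x1 h1 u1]] := IH s h; exists s'; split=> //.
  by apply: exec_if; rewrite (beval_ren _ h); case: ifP x1 => _.
- by exists s; split=> //; apply: exec_while_false; rewrite (beval_ren _ h).
have [s' [x1 h1 u1]] := IH1 s h; have [s'' [x2 h2 u2]] := IH2 s' h1.
exists s''; split=> //.
  by apply: exec_while_true x1 x2; rewrite (beval_ren _ h).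
by move=> a ha i j; have [-> ->] := u2 a ha i j; exact: u1.
Qed.

End Renaming.

(** * Hoare-style rules with time bounds *)

Definition runs c (T : nat) s Q :=
  exists t s', [/\ exec c s t s', (t <= T)%N & Q s'].

Lemma runs_le c T T' s Q : runs c T s Q -> (T <= T')%N -> runs c T' s Q.
Proof. by move=> [t [s' [? ? ?]]] le; exists t, s'; split=> //; apply: leq_trans le. Qed.

Lemma runs_post c T s Q Q' : runs c T s Q -> (forall s', Q s' -> Q' s') -> runs c T s Q'.
Proof. by move=> [t [s' [? ? q]]] h; exists t, s'; split=> //; apply: h. Qed.

Lemma runs_skip s Q : Q s -> runs Skip 1 s Q.
Proof. by move=> q; exists 1, s; split=> //; exact: exec_skip. Qed.

Lemma runs_nset a e1 e2 e s Q :
  Q (State (upd (nmem s) a (neval s e1) (neval s e2) (neval s e)) (rmem s)) ->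
  runs (NSet a e1 e2 e) 1 s Q.
Proof. by move=> q; eexists; eexists; split; [exact: exec_nset | | exact: q]. Qed.

Lemma runs_rset a e1 e2 e s Q :
  Q (State (nmem s) (upd (rmem s) a (neval s e1) (neval s e2) (reval s e))) ->
  runs (RSet a e1 e2 e) 1 s Q.
Proof. by move=> q; eexists; eexists; split; [exact: exec_rset | | exact: q]. Qed.

Lemma runs_seq c1 c2 T1 T2 s Q :
  runs c1 T1 s (fun s1 => runs c2 T2 s1 Q) -> runs (Seq c1 c2) (T1 + T2) s Q.
Proof.
move=> [t1 [s1 [x1 l1 [t2 [s2 [x2 l2 q]]]]]]; exists (t1 + t2)%N, s2.
by split=> //; [exact: exec_seq x1 x2 | exact: leq_add].
Qed.

Lemma runs_if b c1 c2 T1 T2 s Q : (beval s b -> runs c1 T1 s Q) ->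
  (~~ beval s b -> runs c2 T2 s Q) -> runs (If b c1 c2) (T1 + T2).+1 s Q.
Proof.
move=> h1 h2; case: (boolP (beval s b)) => hb.
  have [t [s' [x l q]]] := h1 hb; exists t.+1, s'; split=> //.
    by apply: exec_if; rewrite hb.
  by rewrite ltnS; apply: leq_trans l (leq_addr _ _).
have [t [s' [x l q]]] := h2 hb; exists t.+1, s'; split=> //.
  by apply: exec_if; rewrite (negPf hb).
by rewrite ltnS; apply: leq_trans l (leq_addl _ _).
Qed.

(* Array 1 holds the scratch variables. *)
Definition var x := NGet 1 (NConst x) (NConst 0).
Definition setv x e := NSet 1 (NConst x) (NConst 0) e.
Definition vput s x v := State (upd (nmem s) 1 x 0 v) (rmem s).

Definition For x (N : nexp) c := Seq (setv x (NConst 0))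
  (While (BNot (NLe N (var x))) (Seq c (setv x (NAdd (var x) (NConst 1))))).

(** A round costs the body, the test and the increment; the final [2] is the initialisation and the
    failing test. *)
Lemma runs_for x N n T c s (Inv : nat -> state R -> Prop) :
  Inv 0 (vput s x 0) ->
  (forall i s, Inv i s -> neval s N = n) ->
  (forall i s, (i < n)%N -> Inv i s -> nmem s 1 x 0 = i ->
     runs c T s (fun s' => nmem s' 1 x 0 = i /\ Inv i.+1 (vput s' x i.+1))) ->
  runs (For x N c) (n * (T + 2) + 2) s (Inv n).
Proof.
move=> h0 hN hb.
have loop d i s1 : (d + i = n)%N -> Inv i s1 -> nmem s1 1 x 0 = i ->
    runs (While (BNot (NLe N (var x))) (Seq c (setv x (NAdd (var x) (NConst 1)))))
      (d * (T + 2) + 1) s1 (Inv n).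
  elim: d i s1 => [|d IH] i s1 E Ii vi.
    have Ein : i = n by rewrite -E.
    exists 1, s1; split=> //; last by rewrite -Ein.
    by apply: exec_while_false; rewrite /= (hN i) // vi Ein leqnn.
  have lti : (i < n)%N by rewrite -E; lia.
  have [t1 [s2 [x1 l1 [v2 I2]]]] := hb i s1 lti Ii vi.
  have E' : (d + i.+1 = n)%N by rewrite -E addSnnS.
  have v3 : nmem (vput s2 x i.+1) 1 x 0 = i.+1 by rewrite /vput /upd /= !eqxx.
  have [t2 [s3 [x2 l2 q]]] := IH i.+1 _ E' I2 v3.
  exists (t1 + 1 + t2).+1, s3; split=> //; last by lia.
  apply: exec_while_true x2; first by rewrite /= (hN i) // vi -ltnNge.
  apply: exec_seq x1 _; rewrite /setv.
  have := exec_nset 1 (NConst x) (NConst 0) (NAdd (var x) (NConst 1)) s2.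
  by rewrite /= v2 addn1.
have v0 : nmem (vput s x 0) 1 x 0 = 0 by rewrite /vput /upd /= !eqxx.
have [t [s' [x1 l1 q]]] := loop n 0 _ (addn0 n) h0 v0.
exists (1 + t)%N, s'; split=> //; last by lia.
by apply: exec_seq x1; exact: exec_nset.
Qed.

Lemma runs_for1 x N n T c s (Inv : nat -> state R -> Prop) :
  Inv 0 s ->
  (forall i s v, Inv i s -> Inv i (vput s x v)) ->
  (forall i s, Inv i s -> neval s N = n) ->
  (forall i s, (i < n)%N -> Inv i s -> nmem s 1 x 0 = i ->
     runs c T s (fun s' => nmem s' 1 x 0 = i /\ Inv i.+1 s')) ->
  runs (For x N c) (n * (T + 2) + 2) s (Inv n).
Proof.
move=> h0 st hN hb; apply: runs_for => [|//|i s1 lt Ii vi]; first exact: st.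
by apply: runs_post (hb i s1 lt Ii vi) _ => s' [-> I]; split=> //; apply: st.
Qed.

Lemma runs_for2 x y N M n m T c s (Inv : nat -> nat -> state R -> Prop) : x != y ->
  Inv 0 0 s ->
  (forall i j s v, Inv i j s -> Inv i j (vput s x v) /\ Inv i j (vput s y v)) ->
  (forall i j s, Inv i j s -> neval s N = n /\ neval s M = m) ->
  (forall i s, Inv i m s -> Inv i.+1 0 s) ->
  (forall i j s, (i < n)%N -> (j < m)%N -> Inv i j s -> nmem s 1 x 0 = i ->
     nmem s 1 y 0 = j ->
     runs c T s (fun s' => [/\ nmem s' 1 x 0 = i, nmem s' 1 y 0 = j & Inv i j.+1 s'])) ->
  runs (For x N (For y M c)) (n * (m * (T + 2) + 2 + 2) + 2) s (Inv n 0).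
Proof.
move=> xy h0 st hN row hb; apply: (runs_for1 (Inv := fun i => Inv i 0)) => //.
- by move=> i s1 v /(st _ _ _ v)[].
- by move=> i s1 /hN[].
move=> i s1 lti I1 vi.
apply: (@runs_post _ _ _ (fun s' => nmem s' 1 x 0 = i /\ Inv i m s')).
  apply: (runs_for1 (Inv := fun j s' => nmem s' 1 x 0 = i /\ Inv i j s')) => //.
  - move=> j s2 v [v2 I2]; split; last by case: (st _ _ _ v I2).
    by rewrite /vput /upd /= (negPf xy).
  - by move=> j s2 [_ /hN[]].
  move=> j s2 ltj [v2 I2] vj; apply: runs_post (hb i j s2 lti ltj I2 v2 vj) _.
  by move=> s' [].
by move=> s' [-> /row].
Qed.

Definition same (L M : seq nat) s s' :=
  (forall a, a \notin L -> forall i j, nmem s' a i j = nmem s a i j) /\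
  (forall a, a \notin M -> forall i j, rmem s' a i j = rmem s a i j).

Lemma same_nset L M s s' a i j x : same L M s s' -> a \in L ->
  same L M s (State (upd (nmem s') a i j x) (rmem s')).
Proof.
move=> [h1 h2] aL; split=> //= b bL i' j'; rewrite /upd h1 //.
by case: eqP => // E; rewrite E aL in bL.
Qed.

Lemma same_rset L M s s' a i j x : same L M s s' -> a \in M ->
  same L M s (State (nmem s') (upd (rmem s') a i j x)).
Proof.
move=> [h1 h2] aL; split=> //= b bL i' j'; rewrite /upd h2 //.
by case: eqP => // E; rewrite E aL in bL.
Qed.

End Programs.

Local Notation "# c" := (NConst c) (at level 5, c at level 4).
Ltac keep_same := do ![apply: same_nset => // | apply: same_rset => //].

(** * Running the first program and tabulating owners, layers, shares and codes *)

Section Algorithm.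
Variables (R : realType) (G : wudg R).
Local Open Scope ring_scope.
Local Notation n := (un G).
Local Notation enc := (wudg_encode G).

(* The two given programs run in the even and odd arrays from 8 on, which the
   rest of the program uses only to pass their inputs and outputs; so both start
   from the initial memory they expect and leave the original input intact. *)
Definition ds_array (a : nat) : nat := (8 + (a + a))%N.
Definition sk_array (a : nat) : nat := (9 + (a + a))%N.

Lemma ds_array_inj : injective ds_array.
Proof. by move=> a b; rewrite /ds_array; lia. Qed.

Lemma sk_array_inj : injective sk_array.
Proof. by move=> a b; rewrite /sk_array; lia. Qed.

Definition base (s : state R) := [/\ nmem s 0 0 0 = n,
  forall i, rmem s 0 i 0 = padx G i, forall i, rmem s 0 i 1 = pady G i &
  forall i, rmem s 1 i 0 = padc G i].

Lemma base_same L M s s' : same L M s s' -> 0%N \notin L -> 0%N \notin M ->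
  1%N \notin M -> base s -> base s'.
Proof.
move=> [h1 h2] L0 M0 M1 [b1 b2 b3 b4]; split; first by rewrite h1.
- by move=> i; rewrite h2.
- by move=> i; rewrite h2.
by move=> i; rewrite h2.
Qed.

Lemma base_enc : base enc.
Proof. by split. Qed.

Definition nN := NGet 0 (NConst 0) (NConst 0).
Lemma nN_eval (s : state R) : base s -> neval s nN = n.
Proof. by case. Qed.


(** Arrays 8 and 10 are the images of 0 and 1 under [ds_array]. The other even arrays from 8 on are
    still zero, as the encoding demands. *)
Definition copy_input :=
  Seq (NSet 8 #0 #0 nN)
   (For 0 nN (Seq (RSet 8 (var 0) #0 (RGet 0 (var 0) #0))
             (Seq (RSet 8 (var 0) #1 (RGet 0 (var 0) #1))
                  (RSet 10 (var 0) #0 (RGet 1 (var 0) #0))))).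


Lemma copy_input_runs : runs copy_input (n * 5 + 3) enc (fun s =>
  renamed ds_array enc s /\ same [:: 1; 8]%N [:: 8; 10]%N enc s).
Proof.
apply: (@runs_le _ _ (1 + (n * (1 + (1 + 1) + 2) + 2))); last by lia.
apply: runs_seq; apply: runs_nset.
pose Inv i s := [/\ same [:: 1; 8]%N [:: 8; 10]%N enc s,
  forall l j, nmem s 8 l j = if (l == 0%N) && (j == 0%N) then n else 0%N,
  forall l j, rmem s 8 l j = if (l < i)%N then (if j == 0%N then padx G l else
     if j == 1%N then pady G l else 0) else 0 &
  forall l j, rmem s 10 l j = if (l < i)%N && (j == 0%N) then padc G l else 0].
apply: (@runs_post _ _ _ _ (Inv n)).
  apply: runs_for1.
  - by split=> //; keep_same.
  - by move=> i s v [? ? ? ?]; split=> //; keep_same.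
  - by move=> i s [/base_same /(_ isT isT isT base_enc) b _ _ _]; apply: nN_eval.
  move=> i s lti [sm h1 h2 h3] vi.
  have [_ bx by_ bc] := base_same sm isT isT isT base_enc.
  apply: runs_seq; apply: runs_rset; apply: runs_seq; apply: runs_rset; apply: runs_rset.
  split=> //; split.
  - by keep_same.
  - by [].
  - move=> l j; rewrite /= /upd /= vi h2 ltnS [(l <= i)%N]leq_eqVlt.
    have [->|nli] := eqVneq l i => /=; last by [].
    by rewrite bx by_ ltnn; case: j => [|[|j]].
  move=> l j; rewrite /= /upd /= vi h3 ltnS [(l <= i)%N]leq_eqVlt.
  by have [->|nli] := eqVneq l i => //=; rewrite bc ltnn; case: j.
move=> s [sm h1 h2 h3]; split=> //; case: (sm) => sn sr; split=> a i j.
  case: a => [|a]; first by rewrite h1; case: i => [|i]; case: j.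
  by rewrite sn // /ds_array !inE; lia.
case: a => [|[|a]]; last by rewrite sr // /ds_array !inE; lia.
  rewrite h2 /=; case: ltnP => // le; rewrite /pad insubF ?ltnNge ?le //=.
  by case: j => [|[|j]].
rewrite h3 /=; case: j => [|j] //=; rewrite ?andbF // andbT.
by case: ltnP => // le; rewrite /pad insubF ?ltnNge ?le.
Qed.

(** Index arithmetic has no multiplication. *)
Definition n9 := NAdd nN (NAdd nN (NAdd nN (NAdd nN (NAdd nN (NAdd nN (NAdd nN (NAdd nN nN))))))).

Lemma n9_eval (s : state R) : base s -> neval s n9 = (9 * n)%N.
Proof. by case=> E _ _ _; rewrite /n9 /= !E; lia. Qed.

Lemma dvdn_succ d i : (0 < d)%N -> (d <= (i %% d).+1)%N = (d %| i.+1)%N.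
Proof.
move=> d0; rewrite {2}(divn_eq i d) -addnS dvdn_addr ?dvdn_mull //.
apply/idP/idP => [le|/dvdn_leq -> //].
have -> : (i %% d).+1 = d; last by [].
by apply/eqP; rewrite eqn_leq le ltn_pmod.
Qed.

(** Index arithmetic has no division either: quotients and remainders by [n] are tabulated with two
    counters, one of which wraps round at [n]. *)
Definition fill_tables :=
  Seq (setv 1 #0) (Seq (setv 2 #0) (For 0 n9
    (Seq (NSet 2 (var 0) #0 (var 1)) (Seq (NSet 2 (var 0) #1 (var 2))
      (Seq (setv 1 (NAdd (var 1) #1))
        (If (NLe nN (var 1)) (Seq (setv 1 #0) (setv 2 (NAdd (var 2) #1))) Skip)))))).

Definition tables (s : state R) := forall y, (y < 9 * n)%N ->
  nmem s 2 y 0 = (y %% n)%N /\ nmem s 2 y 1 = (y %/ n)%N.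

Lemma fill_tables_runs s0 : base s0 ->
  runs fill_tables (9 * n * 9 + 4) s0 (fun s => same [:: 1; 2]%N [::] s0 s /\ tables s).
Proof.
move=> b0.
apply: (@runs_le _ _ (1 + (1 + (9 * n * (1 + (1 + (1 + (1 + 1 + 1).+1)) + 2) + 2)))); last by lia.
apply: runs_seq; apply: runs_nset; apply: runs_seq; apply: runs_nset.
pose Inv i s := [/\ same [:: 1; 2]%N [::] s0 s,
  nmem s 1 1 0 = (i %% n)%N, nmem s 1 2 0 = (i %/ n)%N &
  forall y, (y < i)%N -> nmem s 2 y 0 = (y %% n)%N /\ nmem s 2 y 1 = (y %/ n)%N].
apply: (@runs_post _ _ _ _ (Inv (9 * n)%N)); last by move=> s [].
apply: runs_for1.
- split=> //; first by keep_same.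
  + by rewrite mod0n.
  by rewrite div0n.
- by move=> i s v [? ? ? ?]; split=> //; keep_same.
- by move=> i s [/base_same /(_ isT isT isT b0) b _ _ _]; apply: n9_eval.
move=> i s lti [sm h1 h2 h3] vi.
have [nE _ _ _] := base_same sm isT isT isT b0.
have n0 : (0 < n)%N by case: (posnP n) lti => // ->; rewrite muln0.
have tab y : (y < i.+1)%N -> (if y == i then (i %% n)%N else nmem s 2 y 0) = (y %% n)%N /\
    (if y == i then (i %/ n)%N else nmem s 2 y 1) = (y %/ n)%N.
  by rewrite ltnS leq_eqVlt; have [->//|nyi /= lt] := eqVneq y i; exact: h3.
apply: runs_seq; apply: runs_nset; apply: runs_seq; apply: runs_nset.
apply: runs_seq; apply: runs_nset.
have E := dvdn_succ i n0.
apply: runs_if => hb.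
  have {}hb : (n %| i.+1)%N by move: hb; rewrite /= /upd /= nE h1 addn1 E.
  apply: runs_seq; apply: runs_nset; apply: runs_nset.
  split=> //; split.
  - by keep_same.
  - by rewrite /= /upd /= modnS hb.
  - by rewrite /= /upd /= divnS // hb addn1 h2.
  by move=> y /tab; rewrite /= /upd /= vi h1 h2 !andbT !andbF.
have {}hb : ~~ (n %| i.+1)%N by move: hb; rewrite /= /upd /= nE h1 addn1 E.
apply: runs_skip; split=> //; split.
- by keep_same.
- by rewrite /= /upd /= modnS (negPf hb) h1 addn1.
- by rewrite /= /upd /= divnS // (negPf hb) h2.
by move=> y /tab; rewrite /= /upd /= vi h1 h2 !andbT !andbF.
Qed.

(** Array 14 is [ds_array 3], the output of the first program. *)
Definition isD (s : state R) : pred nat := fun i => nmem s 14 i 0 != 0%N.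
Definition own_e x := NGet 2 (var x) #0.
Definition lay_e x := NGet 2 (var x) #1.

(** Array 13 is [sk_array 2], where the second program looks for its terminals. *)
Definition fill_terminals := For 0 n9
  (If (BAnd (NLe (lay_e 0) #0) (BNot (NLe (NGet 14 (own_e 0) #0) #0)))
     (NSet 13 (var 0) #0 #1) Skip).

Lemma fill_terminals_runs s0 : base s0 -> tables s0 ->
  (forall i j, nmem s0 13 i j = 0%N) ->
  runs fill_terminals (9 * n * 5 + 2) s0 (fun s => same [:: 1; 13]%N [::] s0 s /\
    forall i j, nmem s 13 i j =
      nat_of_bool [&& (i < 9 * n)%N, j == 0%N & termN n (isD s0) i]).
Proof.
move=> b0 tb z0; rewrite -[5%N]/((1 + 1).+1 + 2)%N.
pose Inv x s := same [:: 1; 13]%N [::] s0 s /\ forall i j, nmem s 13 i j =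
  nat_of_bool [&& (i < x)%N, j == 0%N & termN n (isD s0) i].
apply: (runs_for1 (Inv := Inv)).
- by split=> // i j; rewrite z0.
- by move=> i s v [? ?]; split=> //; keep_same.
- by move=> i s [/base_same /(_ isT isT isT b0) b _]; apply: n9_eval.
move=> x s ltx [sm h] vx; have [tx1 tx2] := tb x ltx.
have c : beval s (BAnd (NLe (lay_e 0) #0) (BNot (NLe (NGet 14 (own_e 0) #0) #0))) = termN n (isD s0) x.
  by rewrite /= vx !sm.1 // tx1 tx2 !leqn0.
have upd1 i j : (if (i == x) && (j == 0%N) then nat_of_bool (termN n (isD s0) x) else nmem s 13 i j) =
    nat_of_bool [&& (i < x.+1)%N, j == 0%N & termN n (isD s0) i].
  rewrite h ltnS [(i <= x)%N]leq_eqVlt; have [->|nix] := eqVneq i x => //.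
  by case: j => [|j] /=; rewrite ?ltnn ?andbF.
apply: runs_if; rewrite c => hb.
  apply: runs_nset; split=> //; split; first by keep_same.
  by move=> i j; rewrite -upd1 /= /upd /= vx hb.
apply: runs_skip; split=> //; split=> // i j; rewrite -upd1 (negPf hb) h.
have [->|//] := eqVneq i x; case: j => //=; by rewrite ltnn.
Qed.

Definition fill_shares := For 0 n9
  (If (BAnd (NLe (lay_e 0) #0) (NLe (NGet 14 (own_e 0) #0) #0))
     (RSet 2 (var 0) #0 (RDiv (RGet 1 (own_e 0) #0) (RAdd ROne ROne))) Skip).

Lemma fill_shares_runs s0 : base s0 -> tables s0 ->
  (forall i, rmem s0 2 i 0 = 0) ->
  runs fill_shares (9 * n * 5 + 2) s0 (fun s => same [:: 1]%N [:: 2]%N s0 s /\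
    forall i, (i < 9 * n)%N -> rmem s 2 i 0 = shareN n (isD s0) (padc G) i).
Proof.
move=> b0 tb z0; rewrite -[5%N]/((1 + 1).+1 + 2)%N.
pose Inv x s := same [:: 1]%N [:: 2]%N s0 s /\ forall i, rmem s 2 i 0 =
  if (i < x)%N then shareN n (isD s0) (padc G) i else 0.
apply: (@runs_post _ _ _ _ (Inv (9 * n)%N)); last first.
  by move=> s [sm h]; split=> // i lti; rewrite h lti.
apply: (runs_for1 (Inv := Inv)).
- by split=> // i; rewrite z0.
- by move=> i s v [? ?]; split=> //; keep_same.
- by move=> i s [/base_same /(_ isT isT isT b0) b _]; apply: n9_eval.
move=> x s ltx [sm h] vx; have [tx1 tx2] := tb x ltx.
have [_ _ _ bc] := base_same sm isT isT isT b0.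
have c : beval s (BAnd (NLe (lay_e 0) #0) (NLe (NGet 14 (own_e 0) #0) #0)) =
    (x %/ n == 0%N)%N && ~~ isD s0 (x %% n)%N.
  by rewrite /= vx !sm.1 // tx1 tx2 !leqn0 negbK.
have upd1 i : (if i == x then shareN n (isD s0) (padc G) x else rmem s 2 i 0) =
    if (i < x.+1)%N then shareN n (isD s0) (padc G) i else 0.
  by rewrite h ltnS [(i <= x)%N]leq_eqVlt; have [->|nix] := eqVneq i x.
apply: runs_if; rewrite c => hb.
  apply: runs_rset; split=> //; split; first by keep_same.
  move=> i; rewrite -upd1 /= /upd /= vx andbT /shareN hb bc.
  by rewrite !sm.1 // tx1.
apply: runs_skip; split=> //; split=> // i; rewrite -upd1.
have [->|//] := eqVneq i x; by rewrite h ltnn /shareN (negPf hb).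
Qed.

Definition dx := RSub (RGet 0 (var 4) #0) (RGet 0 (var 3) #0).
Definition dy := RSub (RGet 0 (var 4) #1) (RGet 0 (var 3) #1).
Definition incr_code b c :=
  If b (NSet 4 (var 3) (var 4) (NAdd (NGet 4 (var 3) (var 4)) #c)) Skip.
Definition nodes_adjacent := BAnd (BNot (BAnd (NLe (var 3) (var 4)) (NLe (var 4) (var 3))))
  (RLe (RAdd (RMul dx dx) (RMul dy dy)) ROne).

(** One conditional increment per summand of [octant_code]; the adjacency test is repeated in each,
    so that non-adjacent pairs keep the code 0. *)
Definition code_body := Seq (incr_code nodes_adjacent 1)
  (Seq (incr_code (BAnd nodes_adjacent (RLe RZero dx)) 1)
  (Seq (incr_code (BAnd nodes_adjacent (RLe RZero dy)) 2)
       (incr_code (BAnd nodes_adjacent (RLe (RMul dx dx) (RMul dy dy))) 4))).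

Definition fill_codes := For 3 nN (For 4 nN code_body).

Lemma beval_and (s : state R) b1 b2 : beval s (BAnd b1 b2) = beval s b1 && beval s b2.
Proof. by []. Qed.

Lemma incr_code_runs b c u v x (s : state R) : nmem s 1 3 0 = u -> nmem s 1 4 0 = v ->
  nmem s 4 u v = x ->
  runs (incr_code b c) 3 s (fun s' => [/\ forall a i j, a != 4%N -> nmem s' a i j = nmem s a i j,
    forall a i j, rmem s' a i j = rmem s a i j &
    forall i j, nmem s' 4 i j = if (i == u) && (j == v) then (x + c * beval s b)%N else nmem s 4 i j]).
Proof.
move=> e3 e4 ex; rewrite -[3%N]/(1 + 1).+1; apply: runs_if => hb.
  apply: runs_nset; split=> // [a i j na|i j].
    by rewrite /= /upd (negPf na).
  by rewrite /= /upd /= e3 e4 ex hb muln1.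
apply: runs_skip; split=> // i j; rewrite (negPf hb) muln0 addn0 -ex.
by case: ifP => // /andP[/eqP -> /eqP ->].
Qed.

Lemma fill_codes_runs s0 : base s0 -> (forall i j, nmem s0 4 i j = 0%N) ->
  runs fill_codes (n * (n * (12 + 2) + 2 + 2) + 2) s0 (fun s => same [:: 1; 4]%N [::] s0 s /\
    forall u v, (u < n)%N -> (v < n)%N ->
      nmem s 4 u v = octant_code (padx G) (pady G) u v).
Proof.
move=> b0 z0; rewrite -[12%N]/(3 + (3 + (3 + 3)))%N.
pose Inv u v s := same [:: 1; 4]%N [::] s0 s /\ forall i j, nmem s 4 i j =
  if (j < n)%N && ((i < u) || (i == u) && (j < v))%N then octant_code (padx G) (pady G) i j else 0%N.
apply: (@runs_post _ _ _ _ (Inv n 0%N)); last first.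
  by move=> s [sm h]; split=> // u v ltu ltv; rewrite h ltu ltv.
apply: runs_for2 => //.
- by split=> // i j; rewrite z0 ltn0 !andbF.
- by move=> i j s v [? ?]; split; (split=> //; keep_same).
- by move=> i j s [/base_same /(_ isT isT isT b0) [b _ _ _] _].
- move=> u s [sm h]; split=> // i j; rewrite h ltn0 andbF orbF ltnS [(i <= u)%N]leq_eqVlt.
  by case: (j < n)%N; rewrite ?andbT //= orbC.
move=> u v s ltu ltv [sm h] e3 e4.
have [bn bx by_ _] := base_same sm isT isT isT b0.
have nb : beval s nodes_adjacent = (u != v) && ((padx G v - padx G u) * (padx G v - padx G u) +
    (pady G v - pady G u) * (pady G v - pady G u) <= 1).
  by rewrite /= e3 e4 !bx !by_ -eqn_leq.
have h0 : nmem s 4 u v = 0%N by rewrite h !ltnn eqxx /= andbF.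
apply: runs_seq; apply: runs_post (incr_code_runs _ _ e3 e4 h0) _ => s1 [n1 r1 c1].
have e31 : nmem s1 1 3 0 = u by rewrite n1.
have e41 : nmem s1 1 4 0 = v by rewrite n1.
have x1 : nmem s1 4 u v = (0 + 1 * beval s nodes_adjacent)%N by rewrite c1 !eqxx.
apply: runs_seq; apply: runs_post (incr_code_runs _ _ e31 e41 x1) _ => s2 [n2 r2 c2].
have e32 : nmem s2 1 3 0 = u by rewrite n2.
have e42 : nmem s2 1 4 0 = v by rewrite n2.
have x2 := c2 u v; rewrite !eqxx andbT in x2.
apply: runs_seq; apply: runs_post (incr_code_runs _ _ e32 e42 x2) _ => s3 [n3 r3 c3].
have e33 : nmem s3 1 3 0 = u by rewrite n3.
have e43 : nmem s3 1 4 0 = v by rewrite n3.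
have x3 := c3 u v; rewrite !eqxx andbT in x3.
apply: runs_post (incr_code_runs _ _ e33 e43 x3) _ => s4 [n4 r4 c4].
have N4 a i j : a != 4%N -> nmem s4 a i j = nmem s a i j.
  by move=> na; rewrite n4 // n3 // n2 // n1.
split; rewrite ?N4 //; split.
  split=> a na i j; last by rewrite r4 r3 r2 r1; exact: sm.2.
  by rewrite N4; [exact: sm.1 | apply: contraNneq na => ->].
move=> i j; rewrite c4 c3 c2 c1 h.
have cE : (0 + 1 * beval s nodes_adjacent + 1 * beval s1 (BAnd nodes_adjacent (RLe RZero dx)) +
   2 * beval s2 (BAnd nodes_adjacent (RLe RZero dy)) +
   4 * beval s3 (BAnd nodes_adjacent (RLe (RMul dx dx) (RMul dy dy))))%N = octant_code (padx G) (pady G) u v.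
  have na1 : beval s1 nodes_adjacent = beval s nodes_adjacent by rewrite /= !n1 // !r1.
  have na2 : beval s2 nodes_adjacent = beval s nodes_adjacent by rewrite /= !n2 // !n1 // !r2 !r1.
  have na3 : beval s3 nodes_adjacent = beval s nodes_adjacent.
    by rewrite /= !n3 // !n2 // !n1 // !r3 !r2 !r1.
  rewrite !(beval_and _ nodes_adjacent) na1 na2 na3 nb /octant_code.
  case: ((u != v) && _) => //=.
  rewrite !n3 // !n2 // !n1 // !r3 !r2 !r1 e3 e4 !bx !by_.
  by rewrite add0n !mul1n.
rewrite cE; have [->|niu] := eqVneq i u => /=; last by [].
rewrite ltnn /= ltnS [(j <= v)%N]leq_eqVlt.
by have [->|njv] := eqVneq j v => //=; rewrite ltv.
Qed.

End Algorithm.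

(** * Writing the hub instance, rounding its solution, adding an outsider *)

Section Algorithm2.
Variables (R : realType) (G : wudg R).
Local Open Scope ring_scope.
Local Notation n := (un G).
Local Notation enc := (wudg_encode G).

Definition bor b1 b2 := BNot (BAnd (BNot b1) (BNot b2)).
Definition nat_eq_test e1 e2 := BAnd (NLe e1 e2) (NLe e2 e1).

Definition link_test x y := BAnd (NLe (lay_e x) #0)
  (bor (BAnd (NLe (lay_e y) #0) (BNot (NLe (NGet 4 (own_e x) (own_e y)) #0)))
       (BAnd (BNot (NLe (lay_e y) #0))
             (bor (nat_eq_test (own_e x) (own_e y))
                  (nat_eq_test (NGet 4 (own_e y) (own_e x)) (lay_e y))))).

(** Arrays 11 and 9 are [sk_array 1] and [sk_array 0]. Cells of non-edges keep their initial 0, as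
    [skcs_encode] prescribes. *)
Definition edge_body := If (bor (link_test 3 4) (link_test 4 3))
  (Seq (NSet 11 (var 3) (var 4) #1)
       (RSet 9 (var 3) (var 4) (RAdd (RGet 2 (var 3) #0) (RGet 2 (var 4) #0)))) Skip.

Definition fill_edges := Seq (NSet 9 #0 #0 n9) (For 3 n9 (For 4 n9 edge_body)).

Lemma beval_bor (s : state R) b1 b2 : beval s (bor b1 b2) = beval s b1 || beval s b2.
Proof. by rewrite /bor /= negb_and !negbK. Qed.

Lemma beval_nat_eq_test (s : state R) e1 e2 :
  beval s (nat_eq_test e1 e2) = (neval s e1 == neval s e2).
Proof. by rewrite eqn_leq. Qed.

Lemma fill_edges_runs s0 (cd : nat -> nat -> nat) (sh : nat -> R) : base G s0 -> tables G s0 ->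
  (forall u v, (u < n)%N -> (v < n)%N -> nmem s0 4 u v = cd u v) ->
  (forall i, (i < 9 * n)%N -> rmem s0 2 i 0 = sh i) ->
  (forall i j, nmem s0 9 i j = 0%N) -> (forall i j, nmem s0 11 i j = 0%N) ->
  (forall i j, rmem s0 9 i j = 0) ->
  runs fill_edges (9 * n * (9 * n * 6 + 4) + 3) s0 (fun s =>
    [/\ same [:: 1; 9; 11]%N [:: 9]%N s0 s,
    forall i j, nmem s 9 i j = if (i == 0%N) && (j == 0%N) then (9 * n)%N else 0%N,
    forall i j, nmem s 11 i j = nat_of_bool [&& (i < 9 * n)%N, (j < 9 * n)%N & hubN n cd i j] &
    forall i j, rmem s 9 i j = if [&& (i < 9 * n)%N, (j < 9 * n)%N & hubN n cd i j] then sh i + sh j else 0]).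
Proof.
move=> b0 tb cdE shE z9 z11 w9.
apply: (@runs_le _ _ (1 + (9 * n * (9 * n * ((1 + 1 + 1).+1 + 2) + 2 + 2) + 2))); last by lia.
apply: runs_seq; apply: runs_nset; rewrite (n9_eval b0).
pose in_ x y i j := (j < 9 * n)%N && ((i < x) || (i == x) && (j < y))%N.
pose Inv x y s := [/\ same [:: 1; 9; 11]%N [:: 9]%N s0 s,
  forall i j, nmem s 9 i j = if (i == 0%N) && (j == 0%N) then (9 * n)%N else 0%N,
  forall i j, nmem s 11 i j = nat_of_bool (in_ x y i j && hubN n cd i j) &
  forall i j, rmem s 9 i j = if in_ x y i j && hubN n cd i j then sh i + sh j else 0].
have in_row x i j : in_ x (9 * n)%N i j = in_ x.+1 0%N i j.
  rewrite /in_ ltn0 andbF orbF ltnS [(i <= x)%N]leq_eqVlt.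
  by case: (j < 9 * n)%N; rewrite //= andbT orbC.
apply: (@runs_post _ _ _ _ (Inv (9 * n)%N 0%N)); last first.
  move=> s [sm h1 h2 h3]; split=> // i j; [rewrite h2 | rewrite h3];
    by rewrite /in_ ltn0 andbF orbF (andbC (j < _)%N) -!andbA.
apply: runs_for2 => //.
- split; first by keep_same.
  + by move=> i j; rewrite /= /upd /= z9.
  + by move=> i j; rewrite /= /upd /= z11 /in_ ltn0 andbF andbF.
  by move=> i j; rewrite /= w9 /in_ ltn0 andbF andbF.
- by move=> i j s v [? ? ? ?]; split; (split=> //; keep_same).
- move=> i j s [/base_same /(_ isT isT isT b0) b _ _ _]; by rewrite (n9_eval b).
- by move=> x s [sm h1 h2 h3]; split=> // i j; rewrite ?h2 ?h3 in_row.
move=> x y s ltx lty [sm h1 h2 h3] e3 e4.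
have n0 : (0 < n)%N by case: (posnP n) ltx => // ->; rewrite muln0.
have [tx1 tx2] := tb x ltx; have [ty1 ty2] := tb y lty.
have mn i : (i %% n < n)%N by rewrite ltn_mod.
have lk a b i j : (i < 9 * n)%N -> (j < 9 * n)%N -> nmem s 1 a 0 = i -> nmem s 1 b 0 = j ->
    beval s (link_test a b) = ((i %/ n == 0) && (if j %/ n == 0 then cd (i %% n) (j %% n) != 0
    else (i %% n == j %% n) || (cd (j %% n) (i %% n) == j %/ n)))%N.
  move=> lti ltj ea eb; have [ti1 ti2] := tb i lti; have [tj1 tj2] := tb j ltj.
  rewrite /link_test beval_and !beval_bor !beval_and beval_bor !beval_nat_eq_test /=.
  rewrite ea eb !sm.1 // ti1 ti2 tj1 tj2 !cdE // !leqn0.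
  by case: (j %/ n == 0)%N; rewrite /= ?orbF.
have c : beval s (bor (link_test 3 4) (link_test 4 3)) = hubN n cd x y.
  by rewrite beval_bor !(lk _ _ _ _ _ _ e3 e4, lk _ _ _ _ _ _ e4 e3).
have in_step i j : in_ x y.+1 i j = (i == x) && (j == y) || in_ x y i j.
  rewrite /in_ ltnS [(j <= y)%N]leq_eqVlt.
  have [->|_] := eqVneq j y; last by rewrite andbF.
  by rewrite lty ltnn /= !andbT !andbF orbF orbC.
have nin : in_ x y x y = false by rewrite /in_ !ltnn andbF andbF.
apply: runs_if; rewrite c => hb.
  apply: runs_seq; apply: runs_nset; apply: runs_rset; split=> //; split; first by keep_same.
  - by move=> i j; rewrite /= /upd /= h1.
  - move=> i j; rewrite /= /upd /= e3 e4 in_step h2.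
    by case: (altP (i =P x)) => [->|_] //=; case: (altP (j =P y)) => [->|_] //=; rewrite hb.
  move=> i j; rewrite /= /upd /= e3 e4 in_step h3.
  case: (altP (i =P x)) => [->|_] //=; case: (altP (j =P y)) => [->|_] //=.
  by rewrite hb !sm.2 // !shE.
apply: runs_skip; split=> //; split=> // i j; [rewrite h2|rewrite h3];
  by rewrite in_step; case: (altP (i =P x)) => [->|_] //=;
     case: (altP (j =P y)) => [->|_] //=; rewrite (negPf hb) ?andbF.
Qed.

(** Array 15 is [sk_array 3], the output of the second program. The node [emb v] has number [v], so
    its degree is read from row [v]. *)
Definition count_degree := Seq (setv 5 #0) (For 4 n9
  (If (NLe (NGet 15 (var 3) (var 4)) #0) Skip (setv 5 (NAdd (var 5) #1)))).

Definition degree (s : state R) i := (\sum_(0 <= j < 9 * n) (nmem s 15 i j != 0))%N.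

Lemma count_degree_runs s0 v : base G s0 -> nmem s0 1 3 0 = v ->
  runs count_degree (9 * n * 5 + 3) s0 (fun s => [/\ same [:: 1]%N [::] s0 s,
    nmem s 1 3 0 = v & nmem s 1 5 0 = degree s0 v]).
Proof.
move=> b0 e3; apply: (@runs_le _ _ (1 + (9 * n * ((1 + 1).+1 + 2) + 2))); last by lia.
apply: runs_seq; apply: runs_nset.
pose Inv j s := [/\ same [:: 1]%N [::] s0 s, nmem s 1 3 0 = v &
  nmem s 1 5 0 = (\sum_(0 <= j < j) (nmem s0 15 v j != 0))%N].
apply: (runs_for1 (Inv := Inv)).
- by split; [keep_same | | rewrite big_nil].
- by move=> i s w [? ? ?]; split=> //; keep_same.
- by move=> i s [/base_same /(_ isT isT isT b0) b _ _]; rewrite (n9_eval b).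
move=> j s ltj [sm s3 s5] s4.
have c : beval s (NLe (NGet 15 (var 3) (var 4)) #0) = (nmem s0 15 v j == 0%N).
  by rewrite /= s3 s4 sm.1 // leqn0.
apply: runs_if; rewrite c => hb.
  apply: runs_skip; split=> //; split=> //.
  by rewrite big_nat_recr //= -s5 hb addn0.
apply: runs_nset; split=> //; split=> //; first by keep_same.
by rewrite /= /upd /= big_nat_recr //= -s5 hb.
Qed.

Definition round_solution := For 3 nN
  (If (NLe (NGet 14 (var 3) #0) #0)
     (Seq count_degree (If (NLe #2 (var 5)) (NSet 3 (var 3) #0 #1) Skip))
     (NSet 3 (var 3) #0 #1)).

Lemma round_solution_runs s0 : base G s0 -> (forall i, nmem s0 3 i 0 = 0%N) ->
  runs round_solution (n * (9 * n * 5 + 10) + 2) s0 (fun s => same [:: 1; 3]%N [::] s0 s /\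
    forall i, nmem s 3 i 0 = nat_of_bool ((i < n)%N && (isD s0 i || (1 < degree s0 i)%N))).
Proof.
move=> b0 z0.
apply: (@runs_le _ _ (n * ((9 * n * 5 + 3 + (1 + 1).+1 + 1).+1 + 2) + 2)); last by lia.
pose O x i := (i < x)%N && (isD s0 i || (1 < degree s0 i)%N).
pose Inv x s := same [:: 1; 3]%N [::] s0 s /\ forall i, nmem s 3 i 0 = nat_of_bool (O x i).
apply: (runs_for1 (Inv := Inv)).
- by split=> // i; rewrite z0.
- by move=> i s v [? ?]; split=> //; keep_same.
- by move=> i s [/base_same /(_ isT isT isT b0) b _]; exact: (nN_eval b).
move=> x s ltx [sm h] e3.
have bs := base_same sm isT isT isT b0.
have stepO i : O x.+1 i = if i == x then isD s0 x || (1 < degree s0 x)%N else O x i.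
  by rewrite /O ltnS leq_eqVlt; have [->|] := eqVneq i x.
have c : beval s (NLe (NGet 14 (var 3) #0) #0) = ~~ isD s0 x.
  by rewrite /= e3 sm.1 // leqn0 negbK.
apply: runs_if; rewrite c => hb.
  apply: runs_seq; apply: runs_post (count_degree_runs bs e3) _ => s1 [sm1 f3 f5].
  have sm' : same [:: 1; 3]%N [::] s0 s1.
    split=> a na i j; last by rewrite sm1.2 // sm.2.
    by rewrite sm1.1 ?sm.1 //; apply: contra na; rewrite !inE => ->.
  have dE : degree s x = degree s0 x by apply: eq_bigr => j _; rewrite sm.1.
  have h' i : nmem s1 3 i 0 = nat_of_bool (O x i) by rewrite sm1.1 // h.
  apply: runs_if => /=; rewrite f5 dE => hd.
    apply: runs_nset; split=> //; split; first by keep_same.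
    by move=> i; rewrite /= /upd /= f3 andbT stepO hd orbT; case: (i == x); rewrite // h'.
  apply: runs_skip; split=> //; split=> // i; rewrite stepO (negPf hd) (negPf hb) h'.
  by have [->|//] := eqVneq i x; rewrite /O ltnn.
apply: runs_nset; split=> //; split; first by keep_same.
move=> i; rewrite /= /upd /= e3 andbT stepO; rewrite negbK in hb; rewrite hb.
by case: (i == x); rewrite // h.
Qed.

Variable k : nat.

(** Variable 6 counts chosen nodes; variable 7 is the cheapest outsider plus one, or 0 for none. In
    the latter case the truncated subtraction reads cell 0, but the disjunction is already true. *)
Definition best_body := If (NLe (NGet 3 (var 3) #0) #0)
  (If (bor (NLe (var 7) #0)
        (BNot (RLe (RGet 1 (NSub (var 7) #1) #0) (RGet 1 (var 3) #0))))
      (setv 7 (NAdd (var 3) #1)) Skip)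
  (setv 6 (NAdd (var 6) #1)).

Definition add_outsider := Seq (setv 6 #0) (Seq (setv 7 #0) (Seq (For 3 nN best_body)
  (If (BAnd (NLe (var 6) #k) (BNot (NLe (var 7) #0)))
      (NSet 3 (NSub (var 7) #1) #0 #1) Skip))).

Lemma add_outsider_runs s0 (O := fun i => nmem s0 3 i 0 != 0%N)
    (cnt := (\sum_(0 <= i < n) O i)%N) : base G s0 ->
  runs add_outsider (n * 7 + 7) s0 (fun s =>
    ((forall i, (nmem s 3 i 0 != 0%N) = O i) /\
      ((k < cnt)%N \/ forall i, (i < n)%N -> O i)) \/
    exists b, [/\ (b < n)%N, ~~ O b, (cnt <= k)%N,
      forall i, (i < n)%N -> ~~ O i -> padc G b <= padc G i &
      forall i, (nmem s 3 i 0 != 0%N) = (i == b) || O i]).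
Proof.
move=> b0.
apply: (@runs_le _ _ (1 + (1 + (n * (((1 + 1).+1 + 1).+1 + 2) + 2 + (1 + 1).+1)))); last by lia.
apply: runs_seq; apply: runs_nset; apply: runs_seq; apply: runs_nset; apply: runs_seq.
pose best x w := (w = 0%N /\ forall i, (i < x)%N -> O i) \/
  exists b, [/\ w = b.+1, (b < x)%N, ~~ O b &
    forall i, (i < x)%N -> ~~ O i -> padc G b <= padc G i].
pose Inv x s := [/\ same [:: 1]%N [::] s0 s, nmem s 1 6 0 = (\sum_(0 <= i < x) O i)%N &
  best x (nmem s 1 7 0)].
apply: (@runs_post _ _ _ _ (Inv n)).
  apply: runs_for1.
  - split; first by keep_same.
    + by rewrite big_nil.
    by left.
  - by move=> i s v [? ? ?]; split=> //; keep_same.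
  - by move=> i s [/base_same /(_ isT isT isT b0) b _ _]; exact: (nN_eval b).
  move=> x s ltx [sm h6 h7] e3.
  have [_ _ _ bc] := base_same sm isT isT isT b0.
  have c : beval s (NLe (NGet 3 (var 3) #0) #0) = ~~ O x.
    by rewrite /= e3 sm.1 // leqn0 negbK.
  apply: runs_if; rewrite c => hO; last first.
    rewrite negbK in hO.
    apply: runs_nset; split=> //; split; first by keep_same.
      by rewrite /= /upd /= big_nat_recr //= hO h6.
    rewrite /= /upd /=; case: h7 => [[-> al]|[b [-> lb nb bm]]].
      by left; split=> // i; rewrite ltnS leq_eqVlt => /predU1P[->|/al].
    right; exists b; split=> //; first exact: ltnW.
    move=> i; rewrite ltnS leq_eqVlt => /predU1P[->|]; last exact: bm.
    by rewrite hO.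
  have s6 : (\sum_(0 <= i < x.+1) O i)%N = nmem s 1 6 0.
    by rewrite big_nat_recr //= (negPf hO) addn0 h6.
  apply: runs_if; rewrite beval_bor => hb.
    apply: runs_nset; split=> //; split; first by keep_same.
      by rewrite s6.
    rewrite /= /upd /= e3 addn1; right; exists x; split=> //.
    move=> i; rewrite ltnS leq_eqVlt => /predU1P[-> //|lti nOi].
    move: hb; rewrite /= leqn0 e3 !bc; case: h7 => [[-> al]|[b [-> lb nb bm]]].
      by have := al i lti; rewrite (negPf nOi).
    rewrite /= subn1 /= -ltNge => lt; exact: le_trans (ltW lt) (bm i lti nOi).
  apply: runs_skip; split=> //; split=> //.
  move: hb; rewrite negb_or /= negbK leqn0 e3 !bc => /andP[n7 le].
  case: h7 => [[E _]|[b [E lb nb bm]]]; first by rewrite E in n7.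
  right; exists b; split=> //; first exact: ltnW.
  move=> i; rewrite ltnS leq_eqVlt => /predU1P[-> _|]; last exact: bm.
  by move: le; rewrite E subn1.
move=> s [sm h6 h7]; rewrite -/cnt in h6.
have c : beval s (BAnd (NLe (var 6) #k) (BNot (NLe (var 7) #0))) = (cnt <= k)%N && (nmem s 1 7 0 != 0%N).
  by rewrite /= h6 leqn0.
apply: runs_if; rewrite c => hb.
  apply: runs_nset; right; case/andP: hb => lek n7.
  case: h7 => [[E _]|[b [E lb nb bm]]]; first by rewrite E in n7.
  exists b; split=> // i; rewrite /= /upd /= E subn1 /= andbT.
  by case: (i == b) => //=; rewrite sm.1.
apply: runs_skip; left; split=> [i|]; first by rewrite sm.1.
move: hb; rewrite negb_and -ltnNge negbK => /orP[|/eqP E]; first by left.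
by right; case: h7 => [[_ al]|[b [E' _ _ _]]] //; rewrite E in E'.
Qed.

End Algorithm2.

(** * The approximation algorithm *)

Section Program.
Variables (R : realType) (G : wudg R) (k : nat).
Local Open Scope ring_scope.
Local Notation n := (un G).
Local Notation enc := (wudg_encode G).

Definition reduction_program (pD pS : cmd) : cmd :=
  Seq copy_input (Seq (cren ds_array pD) (Seq fill_tables (Seq fill_terminals
    (Seq fill_shares (Seq fill_codes (Seq fill_edges (Seq (cren sk_array pS)
      (Seq round_solution (add_outsider k))))))))).

Definition reduction_time (N : nat) : nat :=
  (N * 5 + 3 + (9 * N * 9 + 4) + (9 * N * 5 + 2) + (9 * N * 5 + 2) +
   (N * (N * (12 + 2) + 2 + 2) + 2) + (9 * N * (9 * N * 6 + 4) + 3) +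
   (N * (9 * N * 5 + 10) + 2) + (N * 7 + 7))%N.

Lemma runs_ren (f : nat -> nat) p (s0 s1 s : state R) t : injective f ->
  exec p s0 t s1 -> renamed f s0 s ->
  runs (cren f p) t s (fun s' => renamed f s1 s' /\ untouched f s s').
Proof.
move=> fi x h; have [s' [x' h' u']] := exec_ren fi x h.
by exists t, s'.
Qed.

Lemma same_trans L M L' M' (s s' s'' : state R) : same L M s s' -> same L' M' s' s'' ->
  same (L ++ L') (M ++ M') s s''.
Proof.
move=> [h1 h2] [h1' h2']; split=> a; rewrite mem_cat negb_or => /andP[a1 a2] i j.
  by rewrite h1' // h1.
by rewrite h2' // h2.
Qed.

Lemma base_untouched f (s s' : state R) : untouched f s s' ->
  (forall b, 0%N <> f b) -> (forall b, 1%N <> f b) -> base G s -> base G s'.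
Proof.
move=> u f0 f1 [b1 b2 b3 b4]; split; first by rewrite (u _ f0 _ _).1.
- by move=> i; rewrite (u _ f0 _ _).2.
- by move=> i; rewrite (u _ f0 _ _).2.
by move=> i; rewrite (u _ f1 _ _).2.
Qed.

Lemma tables_same L M (s s' : state R) : same L M s s' -> 2%N \notin L -> tables G s -> tables G s'.
Proof. by move=> [h _] L2 tb y /tb[t1 t2]; rewrite !h. Qed.

Lemma padE (A : Type) N (a : A) (h : nat -> A) i :
  pad a (fun v : 'I_N => h v) i = if (i < N)%N then h i else a.
Proof. by rewrite /pad; case: insubP => [v -> /= ->|/negPf ->]. Qed.

Lemma isD_decode (sD s : state R) : (forall i, nmem s 14 i 0 = nmem sD 3 i 0) ->
  forall i, (i < n)%N -> isD s i = padD (wudg_decode G sD) i.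
Proof.
move=> h i lti; rewrite /isD h /padD.
by rewrite -[i]/(val (Ordinal lti)) pad_ord inE.
Qed.

Lemma reduction_runs (pD pS : cmd) t1 sD t2 sS
    (D := wudg_decode G sD) (F := skcs_decode (I := hub_inst D) sS)
    (O := rounded D F) :
  exec pD enc t1 sD -> exec pS (skcs_encode (hub_inst D)) t2 sS ->
  runs (reduction_program pD pS) (reduction_time n + t1 + t2) enc (fun s =>
    (wudg_decode G s = O /\ ((k < #|O|)%N \/ O = [set: 'I_n])) \/
    exists b, [/\ b \notin O, (#|O| <= k)%N,
      forall v, v \notin O -> uweight b <= uweight v & wudg_decode G s = b |: O]).
Proof.
move=> xD xS.
apply: (@runs_le _ _ (n * 5 + 3 + (t1 + (9 * n * 9 + 4 + (9 * n * 5 + 2 + (9 * n * 5 + 2 +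
  (n * (n * (12 + 2) + 2 + 2) + 2 + (9 * n * (9 * n * 6 + 4) + 3 +
  (t2 + (n * (9 * n * 5 + 10) + 2 + (n * 7 + 7))))))))))); last by rewrite /reduction_time; lia.
apply: runs_seq; apply: runs_post (copy_input_runs G) _ => s1 [rn1 sm1].
have ds0 a : (a < 8)%N -> forall b, a <> ds_array b by rewrite /ds_array => ? b; lia.
have dsodd a b : (9 + (a + a))%N <> ds_array b by rewrite /ds_array; lia.
have sk0 a : (a < 9)%N -> forall b, a <> sk_array b by rewrite /sk_array => ? b; lia.
have b1 := base_same sm1 isT isT isT (base_enc G).
apply: runs_seq; apply: runs_post (runs_ren ds_array_inj xD rn1) _ => s2 [rn2 un2].
have b2 := base_untouched un2 (ds0 0 isT) (ds0 1 isT) b1.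
(* Odd arrays and those below 8 other than the scratch array still have their initial contents after
   the first program. *)
have zn a i j : (forall b, a <> ds_array b) -> a != 1%N ->
    nmem s2 a i j = nmem enc a i j /\ rmem s2 a i j = rmem enc a i j.
  move=> ha a1; have [-> ->] := un2 a ha i j; split.
    apply: sm1.1; rewrite !inE negb_or a1; apply/eqP => E; exact: (ha 0 E).
  by apply: sm1.2; rewrite !inE negb_or; apply/andP; split; apply/eqP => E;
    [exact: (ha 0 E) | exact: (ha 1%N E)].
apply: runs_seq; apply: runs_post (fill_tables_runs b2) _ => s3 [sm3 tb3].
have b3 := base_same sm3 isT isT isT b2.
have z13 i j : nmem s3 13 i j = 0%N.
  by rewrite sm3.1 // (zn 13 i j (dsodd 2) isT).1.
apply: runs_seq; apply: runs_post (fill_terminals_runs b3 tb3 z13) _ => s4 [sm4 t4].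
have b4 := base_same sm4 isT isT isT b3; have tb4 := tables_same sm4 isT tb3.
have zr2 i : rmem s4 2 i 0 = 0.
  by rewrite sm4.2 // sm3.2 // (zn 2 i 0%N (ds0 2 isT) isT).2.
apply: runs_seq; apply: runs_post (fill_shares_runs b4 tb4 zr2) _ => s5 [sm5 h5].
have b5 := base_same sm5 isT isT isT b4; have tb5 := tables_same sm5 isT tb4.
have z4 i j : nmem s5 4 i j = 0%N.
  by rewrite sm5.1 // sm4.1 // sm3.1 // (zn 4 i j (ds0 4 isT) isT).1.
apply: runs_seq; apply: runs_post (fill_codes_runs b5 z4) _ => s6 [sm6 h6].
have b6 := base_same sm6 isT isT isT b5; have tb6 := tables_same sm6 isT tb5.
have h5' i : (i < 9 * n)%N -> rmem s6 2 i 0 = shareN n (isD s4) (padc G) i.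
  by move=> lti; rewrite sm6.2 // h5.
have sm26 := same_trans (same_trans (same_trans sm3 sm4) sm5) sm6.
have z9 i j : nmem s6 9 i j = 0%N by rewrite sm26.1 // (zn 9 i j (dsodd 0) isT).1.
have z11 i j : nmem s6 11 i j = 0%N by rewrite sm26.1 // (zn 11 i j (dsodd 1%N) isT).1.
have w9 i j : rmem s6 9 i j = 0 by rewrite sm26.2 // (zn 9 i j (dsodd 0) isT).2.
apply: runs_seq; apply: runs_post (fill_edges_runs b6 tb6 h6 h5' z9 z11 w9) _ => s7 [sm7 n7 e7 w7].
have b7 := base_same sm7 isT isT isT b6.
have sm27 := same_trans sm26 sm7.
have D2 i : nmem s2 14 i 0 = nmem sD 3 i 0 by exact: (rn2.1 3%N i 0%N).
have isD4 i : (i < n)%N -> isD s4 i = padD D i.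
  by apply: isD_decode => j; rewrite sm4.1 // sm3.1 // D2.
have isD3 i : (i < n)%N -> isD s3 i = padD D i.
  by apply: isD_decode => j; rewrite sm3.1 // D2.
have mn x : (x < 9 * n)%N -> (x %% n < n)%N.
  by move=> ltx; rewrite ltn_mod; case: (posnP n) ltx => // ->; rewrite muln0.
have shE x : (x < 9 * n)%N -> shareN n (isD s4) (padc G) x = shareN n (padD D) (padc G) x.
  by move=> ltx; rewrite /shareN isD4 ?mn.
(* Through [sk_array] the second program sees exactly the encoding of the hub instance, so its run
   on that encoding can be transferred. *)
have rn7 : renamed sk_array (skcs_encode (hub_inst D)) s7.
  split=> a i j.
    case: a => [|[|[|a]]].
    - by rewrite n7 /=; case: i => [|i]; case: j.
    - rewrite e7; symmetry; pose h x y := nat_of_bool (hubN n (octant_code (padx G) (pady G)) x y).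
      apply: etrans (padE (9 * n) 0%N (fun x => pad 0%N (fun v : 'I_(9 * n) => h x v) j) i) _.
      case: ltnP => //= _; apply: etrans (padE (9 * n) 0%N (h i) j) _.
      by case: ltnP.
    - rewrite sm7.1 // sm6.1 // sm5.1 // t4; symmetry.
      case: j => [|j]; last by rewrite andbF.
      rewrite [LHS]/= eqxx /=.
      have -> : pad 0%N (fun v : 'I_(9 * n) => nat_of_bool (v \in sterm (hub_inst D))) i =
          pad 0%N (fun v : 'I_(9 * n) => nat_of_bool (termN n (padD D) v)) i.
        by rewrite /pad; case: insub => //= v; rewrite inE.
      apply: etrans (padE (9 * n) 0%N (fun x => nat_of_bool (termN n (padD D) x)) i) _.
      by case: ltnP => //= lti; rewrite /termN isD3 ?mn.
    rewrite sm27.1; last by rewrite /sk_array !inE; lia.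
    by rewrite (zn _ i j (dsodd _) _).1 //; lia.
  case: a => [|a]; last first.
    rewrite sm27.2; last by rewrite /sk_array !inE; lia.
    by rewrite (zn _ i j (dsodd _) _).2 //; lia.
  rewrite w7; symmetry; pose h x y := if hubN n (octant_code (padx G) (pady G)) x y then
       shareN n (padD D) (padc G) x + shareN n (padD D) (padc G) y else 0.
  apply: etrans (padE (9 * n) 0 (fun x => pad 0 (fun v : 'I_(9 * n) => h x v) j) i) _.
  case: ltnP => //= lti; apply: etrans (padE (9 * n) 0 (h i) j) _.
  by case: ltnP => //= ltj; rewrite /h !shE.
apply: runs_seq; apply: runs_post (runs_ren sk_array_inj xS rn7) _ => s8 [rn8 un8].
have b8 := base_untouched un8 (sk0 0 isT) (sk0 1%N isT) b7.
have z3 i : nmem s8 3 i 0 = 0%N.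
  by rewrite (un8 3%N (sk0 3%N isT) i 0%N).1 sm27.1 // (zn 3%N i 0%N (ds0 3%N isT) isT).1.
apply: runs_seq; apply: runs_post (round_solution_runs b8 z3) _ => s9 [sm9 h9].
have b9 := base_same sm9 isT isT isT b8.
have isD8 i : (i < n)%N -> isD s8 i = padD D i.
  apply: isD_decode => j; rewrite (un8 14 _ j 0%N).1 ?sm27.1 // => b.
  by rewrite /sk_array; lia.
have inO (v : 'I_n) : (nmem s9 3 v 0 != 0%N) = (v \in O).
  rewrite h9 ltn_ord isD8 // /padD pad_ord /O /rounded !inE.
  have -> : degree G s8 v = #|[set y | F (emb (@slot _ G) v) y]|.
    rewrite /degree big_mkord -sum1_card [RHS]big_mkcond /=; apply: eq_bigr => y _.
    rewrite inE /F /skcs_decode /= (rn8.1 3%N v y) mod0n mul0n addn0.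
    by case: (_ == _).
  by case: (nmem sD 3 v 0 == 0%N) => //=; case: (1 < _)%N.
have cntE : (\sum_(0 <= i < n) (nmem s9 3 i 0 != 0))%N = #|O|.
  rewrite big_mkord -sum1_card [RHS]big_mkcond /=; apply: eq_bigr => v _.
  by rewrite inO; case: (v \in O).
apply: runs_post (add_outsider_runs k b9) _ => s [[h or]|[b [ltb nb lek bm h]]].
  left; split; first by apply/setP => v; rewrite inE h inO.
  case: or => [lt|al]; [left; by rewrite -cntE | right].
  by apply/setP => v; rewrite in_setT -inO; exact: (al v (ltn_ord v)).
right; exists (Ordinal ltb); split.
- by rewrite -inO.
- by rewrite -cntE.
- move=> v; rewrite -inO => nv; have := bm v (ltn_ord v) nv.
  by rewrite -[X in padc G X <= _]/(val (Ordinal ltb)) /padc !pad_ord.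
by apply/setP => v; rewrite in_setU1 inE h inO -val_eqE.
Qed.

End Program.

(** * Existence of optima and lower bounds on the ratios *)

Section Optima.
Variables (R : realType) (k : nat).
Local Open Scope ring_scope.

(** Subgraphs are relations; coding them by finite edge sets makes the minimum available to which
    the guarantee of the second algorithm refers. *)
Lemma skcs_optimum (I : skcs_inst R) (F0 : rel 'I_(sn I)) : skcs_feasible k F0 ->
  exists2 F : rel 'I_(sn I), optimal (P := SkCS R k) (I := I) F & skcs_cost F <= skcs_cost F0.
Proof.
move=> f0; pose rE (E : {set 'I_(sn I) * 'I_(sn I)}) : rel 'I_(sn I) := fun u v => (u, v) \in E.
have rK (F : rel 'I_(sn I)) : rE (edges F) = F.
  by apply/funext => u; apply/funext => v; rewrite /rE inE.
pose P : pred {set 'I_(sn I) * 'I_(sn I)} := fun E => `[< skcs_feasible k (rE E) >].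
have P0 : P (edges F0) by apply/asboolP; rewrite rK.
have [E /asboolP fE minE] := arg_minP (fun E => skcs_cost (rE E)) P0.
have opt (F : rel 'I_(sn I)) : skcs_feasible k F -> skcs_cost (rE E) <= skcs_cost F.
  by move=> fF; rewrite -(rK F); apply: minE; apply/asboolP; rewrite rK.
by exists (rE E); [split | exact: opt].
Qed.

Lemma mfold_optimum (m : nat) (G : wudg R) :
  exists S : {set 'I_(un G)}, optimal (P := MW_mfold_DS R m) (I := G) S.
Proof.
pose P : pred {set 'I_(un G)} := fun S => `[< m_fold_dominating (@uadj R G) m S >].
have P0 : P setT by apply/asboolP => v; rewrite inE.
have [S /asboolP fS minS] := arg_minP (fun S => set_weight S) P0.
by exists S; split=> // S' fS'; apply: minS; apply/asboolP.
Qed.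

Lemma set_weight_gt0 (G : wudg R) (S : {set 'I_(un G)}) : S != set0 -> 0 < set_weight S.
Proof.
case/set0Pn => v vS; rewrite /set_weight (big_setD1 v) //=.
apply: ltr_wpDr (uweight_gt0 v); apply: sumr_ge0 => u _; exact/ltW/uweight_gt0.
Qed.

Lemma set_weight_ge0 (G : wudg R) (S : {set 'I_(un G)}) : 0 <= set_weight S.
Proof. by apply: sumr_ge0 => u _; exact/ltW/uweight_gt0. Qed.

(** The complete graph on [k + 2] nodes with unit weights and two terminals: the other [k] nodes
    carry [k] disjoint paths. *)
Definition complete_inst : skcs_inst R :=
  @SkCSInst R k.+2 [rel u v | u != v] (fun _ _ => 1) [set ord0; ord_max]
    (fun u v => congr1 negb (eq_sym u v)) (fun u => congr1 negb (eqxx u))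
    (fun _ _ _ => erefl) (fun _ _ _ => ler01).

(** A hub instance may have optimum 0 and then says nothing about [rho], so the algorithm is tested
    on an instance whose optimum is positive. *)
Lemma skcs_ratio_ge1 (rho : R) : (0 < k)%N -> admits_approx (SkCS R k) rho -> 1 <= rho.
Proof.
move=> k0 [p [a [d /(_ complete_inst)[t [s [_ _ ok]]]]]].
have f0 : skcs_feasible k (I := complete_inst) [rel u v | u != v].
  split=> //; first by move=> u v; rewrite /= eq_sym.
  have om : (ord0 : 'I_k.+2) != ord_max by [].
  pose q (i : 'I_k) : seq 'I_k.+2 := [:: inord i.+1].
  have q0 (i : 'I_k) : (ord0 : 'I_k.+2) != inord i.+1.
    by rewrite -val_eqE /= inordK //; have := ltn_ord i; lia.
  have q1 (i : 'I_k) : inord i.+1 != (ord_max : 'I_k.+2).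
    by rewrite -val_eqE /= inordK; have := ltn_ord i; lia.
  have inj i j : (inord i.+1 : 'I_k.+2) = inord j.+1 -> (i < k)%N -> (j < k)%N -> i = j.
    by move=> /(congr1 val) /= E lti ltj; move: E; rewrite !inordK; lia.
  move=> x y; rewrite !inE => /orP[] /eqP -> /orP[] /eqP ->; rewrite ?eqxx // => _; exists q; split.
  - by move=> i; rewrite /q /= !inE negb_or q0 q1 om.
  - by move=> i j [/inj E]; apply/val_inj/E.
  - move=> i j nij; apply/pred0P => z /=; rewrite !inE; apply/negP => /andP[/eqP-> /eqP/inj E].
    by case/negP: nij; apply/eqP/val_inj/E.
  - by move=> i; rewrite /q /= !inE negb_or !(eq_sym _ (inord _)) !(eq_sym ord_max) om (eq_sym _ ord0) q0 q1.
  - by move=> i j [/inj E]; apply/val_inj/E.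
  move=> i j nij; apply/pred0P => z /=; rewrite !inE; apply/negP => /andP[/eqP-> /eqP/inj E].
  by case/negP: nij; apply/eqP/val_inj/E.
have [F optF _] := skcs_optimum f0.
have [fd le] := ok F optF.
have le' : skcs_cost F <= rho * skcs_cost F by apply: le_trans le; apply: optF.2.
suff pos : 0 < skcs_cost F by rewrite -(ler_pM2r pos) mul1r.
have [[Fs Fsub Fk] _] := optF.
have [||//|q [qp _ _]] := Fk ord0 ord_max; try by rewrite !inE eqxx ?orbT.
have [+ _] := qp (Ordinal k0); case: (rcons _ _) (size_rcons (q (Ordinal k0)) ord_max) => // y r _ /= /andP[Fy _].
have ny : (0 < y)%N.
  by rewrite lt0n; apply: contraTneq (Fsub _ _ Fy) => y0; rewrite /= negbK -val_eqE /= y0.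
have nn (A : pred 'I_k.+2) (B : pred 'I_k.+2) : 0 <= \sum_(u < k.+2 | A u) \sum_(v < k.+2 | (u < v)%N && F u v) (1 : R).
  by apply: sumr_ge0 => u _; apply: sumr_ge0.
rewrite /skcs_cost /= (bigD1 ord0) //=; apply: ltr_wpDr; first exact: (nn _ xpredT).
rewrite (bigD1 y) /=; last by rewrite ny.
by apply: ltr_wpDr; [exact: sumr_ge0 | exact: ltr01].
Qed.

End Optima.

(** * The approximation guarantee *)

Section Approximation.
Variables (R : realType) (k m : nat) (alpha rho beta : R).
Local Open Scope ring_scope.
Hypotheses (k2 : (2 <= k)%N) (km : (k <= m)%N) (beta1 : 1 <= beta).
Hypothesis optimum_bound : forall (G : wudg R) (D S : {set 'I_(un G)}),
  m_fold_dominating (@uadj R G) m D -> km_CDS (@uadj R G) k m S ->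
  exists2 F, skcs_feasible k (I := hub_inst D) F &
    skcs_cost (I := hub_inst D) F <= beta * set_weight S.

Lemma reduction_time_le N : (reduction_time N <= 1000 * N.+1 ^ 2)%N.
Proof. by rewrite /reduction_time; nia. Qed.

Lemma set_weightU1 (G : wudg R) (b : 'I_(un G)) (O : {set 'I_(un G)}) : b \notin O ->
  set_weight (b |: O) = uweight b + set_weight O.
Proof. by move=> bO; rewrite /set_weight big_setU1. Qed.

(** A node [b] outside [D] has at least [m >= k] neighbours in [D], so [#|O| <= k] forces [O = D],
    and [b] is adjacent to all of it. Hence [b] joins whatever survives, unless it is deleted
    itself, and then the connectivity of [O] applies. *)
Lemma add_outsider_connected (G : wudg R) (D O : {set 'I_(un G)}) b :
  m_fold_dominating (@uadj R G) m D -> D \subset O -> b \notin O -> (#|O| <= k)%N ->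
  (forall Y : {set 'I_(un G)}, (#|Y| < k)%N -> connected_in (@uadj R G) (O :\: Y)) ->
  O = D /\ k_connected (@uadj R G) k (b |: O).
Proof.
move=> domD DO bO leO cO.
have bD : b \notin D by apply: contra bO; apply: (subsetP DO).
have dsub : [set u in D | uadj b u] \subset D by apply/subsetP => u; rewrite inE => /andP[].
have leD : (k <= #|D|)%N by apply: leq_trans km (leq_trans (domD b bD) (subset_leq_card dsub)).
have OD : O = D by apply/eqP; rewrite eq_sym eqEcard DO (leq_trans leO leD).
have adj u : u \in D -> uadj b u.
  move=> uD; have /eqP E : [set u in D | uadj b u] == D.
    by rewrite eqEcard dsub (leq_trans _ (domD b bD)) // -OD (leq_trans leO km).
  by move: uD; rewrite -{1}E inE => /andP[].
split=> //; split; first by rewrite cardsU1 bO OD add1n ltnS.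
move=> X _ ltX; have [bX|bX] := boolP (b \in X).
  have -> : (b |: O) :\: X = O :\: X.
    by apply/setP => z; rewrite !inE; have [->|] := eqVneq z b; rewrite ?bX.
  exact: cO.
have toB z : z \in (b |: O) :\: X -> connect (induced (@uadj R G) ((b |: O) :\: X)) b z.
  move=> zO; have bO' : b \in (b |: O) :\: X by rewrite !inE eqxx bX.
  have [->|zb] := eqVneq z b; first exact: connect0.
  apply: connect1; rewrite inducedE zO bO' adj //.
  by move: zO; rewrite !inE (negPf zb) OD => /andP[].
move=> x y xO yO; apply: connect_trans (toB y yO).
by rewrite (sym_connect_sym (induced_sym _ (@uadj_sym R G))); apply: toB.
Qed.

Lemma MWCDS_approx : admits_approx (MW_mfold_DS R m) alpha ->
  admits_approx (SkCS R k) rho -> admits_approx (MWCDS R k m) (alpha + beta * rho).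
Proof.
move=> [pD [a1 [d1 okD]]] hS.
have rho1 : 1 <= rho by apply: skcs_ratio_ge1 hS; exact: ltnW.
case: hS => [pS [a2 [d2 okS]]].
exists (reduction_program k pD pS), (1000 + a1 + a2 * 9 ^ d2)%N, (2 + d1 + d2)%N => G.
have [t1 [sD [xD lt1 oD]]] := okD G; pose D := wudg_decode G sD.
have [t2 [sS [xS lt2 oS]]] := okS (hub_inst D); pose F := skcs_decode (I := hub_inst D) sS.
have [t [s [x lt out]]] := reduction_runs k xD xS.
exists t, s; split=> //.
  apply: leq_trans lt _; move: lt1 lt2; rewrite /= => lt1 lt2.
  (* The second program runs on [9 * un G] nodes; the nine is moved into the constant as
     [9 ^ d2]. *)
  have n9 : ((9 * un G).+1 <= 9 * (un G).+1)%N by lia.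
  have {}lt2 : (t2 <= a2 * 9 ^ d2 * (un G).+1 ^ d2)%N.
    apply: leq_trans lt2 _; rewrite -mulnA -expnMn leq_mul2l.
    by case: (posnP d2) => [->|d0]; [rewrite !expn0 orbT | rewrite leq_exp2r // n9 orbT].
  have N0 : (0 < (un G).+1)%N by [].
  have e2 : ((un G).+1 ^ 2 <= (un G).+1 ^ (2 + d1 + d2))%N by rewrite leq_pexp2l //; lia.
  have e1 : ((un G).+1 ^ d1 <= (un G).+1 ^ (2 + d1 + d2))%N by rewrite leq_pexp2l //; lia.
  have e3 : ((un G).+1 ^ d2 <= (un G).+1 ^ (2 + d1 + d2))%N by rewrite leq_pexp2l //; lia.
  rewrite !mulnDl; apply: leq_add; first apply: leq_add.
  - by apply: leq_trans (reduction_time_le _) _; rewrite leq_mul2l e2 orbT.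
  - by apply: leq_trans lt1 _; rewrite leq_mul2l e1 orbT.
  by apply: leq_trans lt2 _; rewrite leq_mul2l e3 orbT.
move=> S [/= kS _].
have [S0 optS0] := mfold_optimum m G.
have [domD leD] := oD S0 optS0; rewrite -/D in domD leD.
have [ltS cS] : k_connected (@uadj R G) k S by case: kS.
(* [G] has a node since [S] does, and [m] is positive, so the empty set does not dominate. The
   optimum is therefore positive and yields [1 <= alpha]. *)
have S0n : S0 != set0.
  have /card_gt0P[v _] : (0 < #|S|)%N by apply: leq_ltn_trans ltS.
  apply: contraTneq km => S00; rewrite -ltnNge.
  have := optS0.1 v; rewrite S00 inE => /(_ isT).
  have -> : [set u in set0 | uadj v u] = set0 by apply/setP => u; rewrite !inE.
  by rewrite cards0; move: k2; lia.
have w0 := set_weight_gt0 S0n.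
have alpha1 : 1 <= alpha.
  rewrite -(ler_pM2r w0) mul1r; apply: le_trans leD; exact: optS0.2.
have leD' : set_weight D <= alpha * set_weight S.
  apply: le_trans leD _; rewrite ler_wpM2l //; first by apply: le_trans alpha1.
  by apply: optS0.2; case: kS.
have [F0 f0 leF0] := optimum_bound domD kS.
have [Fo optFo leFo] := skcs_optimum f0.
have [fF leF] := oS Fo optFo; rewrite -/F in fF leF.
have rho0 : 0 <= rho by apply: le_trans rho1.
have leF' : skcs_cost F <= beta * rho * set_weight S.
  apply: le_trans leF _; rewrite (mulrC beta) -mulrA ler_wpM2l //.
  exact: le_trans leFo leF0.
have [domO cO wO] := rounded_sound km domD fF.
rewrite -/D -/F in out; set O := rounded D F in domO cO wO out.
have DO : D \subset O by exact: subsetUl.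
case: out => [[-> big]|[b [bO leO bm ->]]].
  split; last by apply: le_trans wO _; rewrite mulrDl lerD.
  split=> //; split=> [|X _ ltX]; last exact: cO.
  (* If no outsider exists, [O] consists of all nodes and contains [S], which has more than [k]. *)
  case: big => // ->; apply: leq_trans ltS _; apply: subset_leq_card; exact: subsetT.
have [OD kO] := add_outsider_connected domD DO bO leO cO.
split.
  split=> // v; rewrite in_setU1 negb_or => /andP[_ vO].
  apply: leq_trans (domO v vO) _; apply/subset_leq_card/subsetP => u.
  by rewrite !inE => /andP[-> ->]; rewrite orbT.
(* Since [O = D], the budget [beta * rho] is still unspent and pays for [b]: some node of [S] lies
   outside [O], because [S] has more than [k] nodes, and [b] is no heavier than it. *)
rewrite set_weightU1 // OD mulrDl addrC lerD //.
have [w wS wO'] : exists2 w, w \in S & w \notin O.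
  apply/subsetPn/negP => /subset_leq_card le.
  by have := leq_trans ltS (leq_trans le leO); rewrite ltnn.
apply: le_trans (bm w wO') _.
have wle : uweight w <= set_weight S.
  rewrite /set_weight (big_setD1 w) //= lerDl; apply: sumr_ge0 => u _; exact/ltW/uweight_gt0.
apply: le_trans wle _; rewrite -[leLHS]mul1r ler_wpM2r ?set_weight_ge0 //.
by rewrite -[leLHS]mul1r ler_pM.
Qed.

End Approximation.

Local Open Scope ring_scope.

Theorem theorem3 (R : realType) (k m : nat) (alpha rho : R)
    (hk : (2 <= k)%N) (hkm : (k <= m)%N)
    (hDS : admits_approx (MW_mfold_DS R m) alpha)
    (hSkCS : admits_approx (SkCS R k) rho) :
  ((3 <= k)%N -> admits_approx (MWCDS R k m) (alpha + 5 * rho)) /\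
  (k = 2%N -> admits_approx (MWCDS R k m) (alpha + (5 / 2) * rho)).
Proof.
have w0 (G : wudg R) (S : {set 'I_(un G)}) := set_weight_ge0 S.
have ge1 : 1 <= 5 / 2 :> R by rewrite ler_pdivlMr // mul1r ler_nat.
have ge1' : 1 <= 5 :> R by rewrite ler1n.
have le95 : 9 / 2 <= 5 :> R by rewrite ler_pdivrMr // -natrM ler_nat.
split=> hk'; apply: MWCDS_approx => // G D S domD kS.
  have [F fF le] := hub_optimum hkm domD kS.
  by exists F => //; apply: le_trans le _; rewrite ler_wpM2r.
by have [F] := hub_optimum_two D hkm hk' kS; exists F.
Qed.
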